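(* Let $N\ge2$ be an integer and let $m_0:\mathbb{T}\to\mathbb{C}$ be Lipschitz and non-singular, with $R_{m_0,m_0}1=1$. Let $C=\{z_1,z_2=z_1^N,\dots,z_p=z_{p-1}^N\}$, $z_p^N=z_1$, be an $m_0$-cycle, $m_0(z_k)=\sqrt Ne^{i\theta_k}$ for $k\in\{1,\dots,p\}$, and $\theta_C=\theta_1+\dots+\theta_p$. All indices $k$ below are taken modulo $p$. Define $$\varphi_{k,m_0,C}(x)=\prod_{l=1}^\infty\frac{e^{-i\theta_C}\alpha_{z_k}(m_0^{(p)})\left(\frac{x}{N^{lp}}\right)}{\sqrt{N^p}},\quad(x\in\mathbb{R},\ k\in\{1,\dots,p\}).$$ (i) $\varphi_{k,m_0,C}$ is a well defined continuous function that belongs to $L^2(\mathbb{R})$. (ii) Define $g_{k,m_0,C}=\alpha_{z_k^{-1}}\left(\operatorname{Per}|\varphi_{k,m_0,C}|^2\right)$ for $k\in\{1,\dots,p\}$. Then $g_{k,m_0,C}$ is Lipschitz (and a trigonometric polynomial if $m_0$ is one), $R_{m_0,m_0}^pg_{k,m_0,C}=g_{k,m_0,C}$, $R_{m_0,m_0}g_{k,m_0,C}=g_{k+1,m_0,C}$, $g_{k,m_0,C}(z_j)=\delta_{kj}$, and $g_{k,m_0,C}$ is $0$ on every $m_0$-cycle disjoint from $C$. (iii) Define $h_{m_0,C}=\sum_{k=1}^pg_{k,m_0,C}$. Then $h_{m_0,C}$ is Lipschitz (and a trigonometric polynomial if $m_0$ is one), $R_{m_0,m_0}h_{m_0,C}=h_{m_0,C}$,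 $h_{m_0,C}(z_k)=1$ for all $k\in\{1,\dots,p\}$, and $h_{m_0,C}$ is $0$ on every $m_0$-cycle disjoint from $C$. (iv) $h_{m_0,C}$ is minimal: if $h'$ is continuous, $0\le h'\le c\,h_{m_0,C}$ for some $c>0$, and $R_{m_0,m_0}h'=h'$, then there exists $\lambda\ge0$ such that $h'=\lambda h_{m_0,C}$. (v) If $h\ge0$ is continuous, $R_{m_0,m_0}h=h$ and $h$ is $1$ on $C$, then $h\ge h_{m_0,C}$. (vi) Let $U_C:L^2(\mathbb{R})^p\to L^2(\mathbb{R})^p$, $$U_C(\xi_1,\dots,\xi_p)=\left(e^{i\theta_1}U_1\xi_2,\dots,e^{i\theta_{p-1}}U_1\xi_p,e^{i\theta_p}U_1\xi_1\right),$$ and for $f\in L^\infty(\mathbb{T})$ let $\pi_C(f):L^2(\mathbb{R})^p\to L^2(\mathbb{R})^p$, $$\pi_C(f)(\xi_1,\dots,\xi_p)=\left(\pi_1(\alpha_{z_1}(f))\xi_1,\dots,\pi_1(\alpha_{z_p}(f))\xi_p\right).$$ Then $\left(U_C,\pi_C,(\varphi_{1,m_0,C},\dots,\varphi_{p,m_0,C})\right)$ is the cyclic representation corresponding to $h_{m_0,C}$. (vii) The commutant of this representation is $$\left\{M_{f_1}\oplus\dots\oplus M_{f_p}\ :\ f_k\in L^\infty(\mathbb{R}),\ f_{k+1}(Nx)=f_k(x)\text{ a.e., for }k\in\{1,\dots,p\}\right\}.$$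
   Context: $\mathbb{T}=\{z\in\mathbb{C}:|z|=1\}$, with normalized Haar measure $\mu$; functions on $\mathbb{T}$ are identified with $2\pi$-periodic functions on $\mathbb{R}$ via $z=e^{ix}$. Non-singular means not vanishing on a set of positive measure. $R_{m_0,m_0}f(z)=\frac1N\sum_{w^N=z}|m_0(w)|^2f(w)$. For $\rho\in\mathbb{T}$, $\alpha_\rho(f)(z)=f(\rho z)$. $m_0^{(p)}(z)=m_0(z)m_0(z^N)\cdots m_0(z^{N^{p-1}})$. $\operatorname{Per}(f)(x)=\sum_{j\in\mathbb{Z}}f(x+2j\pi)$. $M_f$ is the operator of multiplication by $f$ on $L^2(\mathbb{R})$. An $m_0$-cycle is a set $\{z_1,\dots,z_p\}\subset\mathbb{T}$ (distinct points) with $z_i^N=z_{i+1}$ for $1\le i\le p-1$, $z_p^N=z_1$, and $|m_0(z_i)|=\sqrt N$ for all $i$. Inner products are linear in the second variable, and $L^2(\mathbb{R})$ carries $\langle\xi|\eta\rangle=\frac1{2\pi}\int_{\mathbb{R}}\overline\xi\eta\,dx$. On $L^2(\mathbb{R})$: $(U_1\xi)(x)=\sqrt N\xi(Nx)$ and $\pi_1(f)\xi=f\xi$ for $f\in L^\infty(\mathbb{T})$ (viewed as a $2\pi$-periodic function). Cyclic representation: for $h\in L^1(\mathbb{T})$, $h\ge0$, $R_{m_0,m_0}h=h$, the cyclic representation corresponding to $h$ is the triple (unique up to unitary equivalence) consisting of a unitary $U$ and a $*$-representation $\pi$ of $L^\infty(\mathbb{T})$ on a Hilbert space $\mathcal{H}$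 and a vector $\varphi\in\mathcal{H}$ such that $U\pi(f)=\pi(f(z^N))U$ for $f\in L^\infty(\mathbb{T})$, $U\varphi=\pi(m_0)\varphi$, $\langle\varphi|\pi(f)\varphi\rangle=\int_{\mathbb{T}}fh\,d\mu$ for $f\in L^\infty(\mathbb{T})$, and $\varphi$ is cyclic, i.e. the span of $\{U^{-n}\pi(f)\varphi:n\ge0,\ f\in L^\infty(\mathbb{T})\}$ is dense in $\mathcal{H}$. The commutant of such a representation is the set of bounded operators commuting with $U$, $U^*$ and all $\pi(f)$. *)

(* Defs.v *)
From HB Require Import structures.
From mathcomp Require Import all_boot all_order all_algebra ring lra.
From mathcomp Require Import all_classical all_reals all_analysis measurable_realfun.
From mathcomp Require Import complex.

Set Implicit Arguments.
Unset Strict Implicit.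
Unset Printing Implicit Defensive.

Import Order.TTheory GRing.Theory Num.Theory numFieldNormedType.Exports.

Local Open Scope classical_set_scope.
Local Open Scope ring_scope.
Local Open Scope complex_scope.

(** A function on the circle is represented by a function [R[i] -> R[i]] of
    which only the values on [circle] matter; a function on the real line has
    type [R -> R[i]].  [R[i]^o] is [R[i]] with its normed-space structure. *)

Section Circle.
Variable R : realType.
Local Notation C := (R[i]).
Local Notation cRe := (@complex.Re R).
Local Notation cIm := (@complex.Im R).
Local Notation leb := (@lebesgue_measure R).

(** Real-valued, whereas [`|w|] lives in [R[i]]. *)
Definition modulus (w : C) : R := ComplexField.Normc.normc w.

Definition circle : set C := [set w | `|w| = 1].

Definition expi (x : R) : C := cos x +i* sin x.

Definition argT (w : C) : R :=
  xget 0 [set x : R | 0 <= x < 2 * pi /\ expi x = w].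

Definition ofperiodic (V : Type) (F : R -> V) : C -> V := F \o argT.

(** Normalized Haar measure of a subset of the circle. *)
Definition haar (A : set C) : \bar R :=
  (((2 * pi)^-1)%:E * leb ([set x : R | 0 <= x < 2 * pi]%R `&` expi @^-1` A))%E.

Definition nonsingular (f : C -> C) : Prop :=
  haar (circle `&` [set w | f w = 0]) = 0%E.

Definition lipschitzT (f : C -> C) : Prop :=
  [lipschitz (f : C^o -> C^o) w | w in circle].

Definition continuousT (f : C -> C) : Prop :=
  {within (circle : set C^o), continuous (f : C^o -> C^o)}.

Definition trigpoly (f : C -> C) : Prop :=
  exists (n : nat) (a : nat -> C), forall w, circle w ->
    f w = \sum_(0 <= j < n.*2.+1) a j * w ^ (j%:Z - n%:Z).

Definition alpha (rho : C) (f : C -> C) : C -> C := fun w => f (rho * w).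

Definition ruelle (N : nat) (m0 f : C -> C) : C -> C := fun w =>
  N%:R^-1 * \sum_(v \in [set v : C | v ^+ N = w]) `|m0 v| ^+ 2 * f v.

Definition mpow (N : nat) (m0 : C -> C) (p : nat) : C -> C := fun w =>
  \prod_(0 <= j < p) m0 (w ^+ (N ^ j)).

(** The sum over the integers is the library's sum of a nonnegative family, so
    [Per f] is meant for [0 <= f]. *)
Definition Per (f : R -> R) : R -> \bar R := fun x =>
  (\esum_(j in [set: int]) (f (x + 2 * j%:~R * pi))%:E)%E.

Definition is_cycle (N : nat) (m0 : C -> C) (p : nat) (z : 'I_p -> C) : Prop :=
  [/\ (0 < p)%N, injective z, forall k, circle (z k),
      forall k, z k ^+ N = z (ordS k) &
      forall k, `|m0 (z k)| = (Num.sqrt N%:R)%:C].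

(** ** Measurability and integration of complex functions *)

(** Borel measurability; every Lebesgue-measurable function is a.e. equal to a
    Borel one, so the spaces of classes below are the usual ones. *)
Definition cmeasurable (f : R -> C) : Prop :=
  measurable_fun setT (cRe \o f) /\
  measurable_fun setT (cIm \o f).

Definition cintegral (D : set R) (f : R -> C) : C :=
  (\int[leb]_(x in D) cRe (f x)) +i*
  (\int[leb]_(x in D) cIm (f x)).

Definition L2fun : {pred R -> C} := fun f =>
  `[< cmeasurable f /\ (\int[leb]_x (modulus (f x) ^+ 2)%:E < +oo)%E >].

Definition Linf (f : R -> C) : Prop :=
  cmeasurable f /\
  exists M : R, {ae leb, forall x, modulus (f x) <= M}.

Definition LinfT (f : C -> C) : Prop := Linf (f \o expi).

Definition eqT (f g : C -> C) : Prop :=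
  {ae leb, forall x, f (expi x) = g (expi x)}.

Definition integralT (f : C -> C) : C :=
  ((2 * pi)^-1)%:C * cintegral `[0, 2 * pi] (f \o expi).

Definition L1T (f : C -> C) : Prop :=
  cmeasurable (f \o expi) /\
  (\int[leb]_(x in `[0%R, (2 * pi)%R]) (modulus (f (expi x)))%:E < +oo)%E.

End Circle.

(** ** The space L^2(R): square-integrable functions modulo null functions *)

Section L2fun_lmod.
Variable R : realType.
Local Notation C := (R[i]).
Local Notation cRe := (@complex.Re R).
Local Notation cIm := (@complex.Im R).
Local Notation leb := (@lebesgue_measure R).

#[local] Instance leb_ae_filter : Filter (nbhs (almost_everywhere leb)) :=
  ae_filter_ringOfSetsType leb.

Lemma modulus2 (w : C) :
  modulus w ^+ 2 = cRe w ^+ 2 + cIm w ^+ 2.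
Proof. by case: w => a b /=; rewrite sqr_sqrtr// addr_ge0// sqr_ge0. Qed.

Lemma modulus_ge0 (w : C) : 0 <= modulus w.
Proof. by case: w => a b; exact: sqrtr_ge0. Qed.

Lemma modulus2_linear (a u v : C) :
  modulus (a * u + v) ^+ 2 <=
  2 * modulus a ^+ 2 * modulus u ^+ 2 + 2 * modulus v ^+ 2.
Proof.
rewrite !modulus2; case: a u v => [a b] [c d] [e f] /=.
rewrite -subr_ge0 (_ : _ - _ =
  (a * c - b * d - e) ^+ 2 + (a * d + b * c - f) ^+ 2); last by ring.
by rewrite addr_ge0// sqr_ge0.
Qed.

Lemma cmeasurable_linear (a : C) (f g : R -> C) :
  cmeasurable f -> cmeasurable g -> cmeasurable (a *: f + g).
Proof.
move=> [fr fi] [gr gi]; split.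
- rewrite (_ : _ \o _ = (((cst (cRe a) \* (cRe \o f))
    \- (cst (cIm a) \* (cIm \o f))) \+ (cRe \o g))%R).
    by apply: measurable_funD => //; apply: measurable_funB;
      apply: measurable_funM.
  apply/funext => x /=; rewrite !fctE.
  by case: a (f x) (g x) => [a b] [c d] [u v].
- rewrite (_ : _ \o _ = (((cst (cRe a) \* (cIm \o f))
    \+ (cst (cIm a) \* (cRe \o f))) \+ (cIm \o g))%R).
    by apply: measurable_funD => //; apply: measurable_funD;
      apply: measurable_funM.
  apply/funext => x /=; rewrite !fctE.
  by case: a (f x) (g x) => [a b] [c d] [u v].
Qed.

Lemma cmeasurable_modulus2 (f : R -> C) : cmeasurable f ->
  measurable_fun setT (fun x => (modulus (f x) ^+ 2)%:E).
Proof.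
move=> [fr fi]; apply/measurable_EFinP.
rewrite (_ : (fun x => _) =
  (((cRe \o f) \* (cRe \o f)) \+
   ((cIm \o f) \* (cIm \o f)))%R).
  by apply: measurable_funD; apply: measurable_funM.
by apply/funext => x; rewrite modulus2 /= !expr2.
Qed.

Lemma L2fun_submod_closed : submod_closed (@L2fun R).
Proof.
split.
  apply/asboolP; split.
    by split; rewrite (_ : _ \o _ = cst 0)//; apply: measurable_cst.
  rewrite (_ : (fun x => _) = cst 0%E) ?integral0 ?ltry//.
  by apply/funext => x; rewrite modulus2 /= expr0n /= addr0.
move=> a f g /asboolP[mf fo] /asboolP[mg go]; apply/asboolP.
have mfg := cmeasurable_linear a mf mg; split => //.
have m2f := cmeasurable_modulus2 mf.
have m2g := cmeasurable_modulus2 mg.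
have h2 (c : R) (h : R -> C) : (0 <= c) -> forall x : R, [set: R] x ->
    (0 <= c%:E * (modulus (h x) ^+ 2)%:E)%E.
  by move=> c0 x _; rewrite mule_ge0// lee_fin// sqr_ge0.
have c0 : 0 <= 2 * modulus a ^+ 2 by rewrite mulr_ge0// sqr_ge0.
apply: (@le_lt_trans _ _ (\int[leb]_x
   ((2 * modulus a ^+ 2)%:E * (modulus (f x) ^+ 2)%:E
     + 2%:E * (modulus (g x) ^+ 2)%:E))%E).
  apply: ge0_le_integral => //.
  - by move=> x _; rewrite lee_fin sqr_ge0.
  - exact: cmeasurable_modulus2.
  - by apply: emeasurable_funD; apply: measurable_funeM.
  - by move=> x _; rewrite -!EFinM -EFinD lee_fin !fctE modulus2_linear.
rewrite ge0_integralD//; [|exact: h2|exact: measurable_funeM|exact: h2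
  |exact: measurable_funeM].
rewrite !ge0_integralZl//; first last.
- by move=> x _; rewrite lee_fin sqr_ge0.
- by move=> x _; rewrite lee_fin sqr_ge0.
by rewrite lte_add_pinfty// lte_mul_pinfty// ?lee_fin.
Qed.

HB.instance Definition _ :=
  GRing.isSubmodClosed.Build C (R -> C) (@L2fun R) L2fun_submod_closed.

Record L2pre : Type := MkL2pre { L2val :> R -> C; _ : L2val \in @L2fun R }.

HB.instance Definition _ := [isSub for L2val].
HB.instance Definition _ := [Choice of L2pre by <:].
HB.instance Definition _ := [SubChoice_isSubLmodule of L2pre by <:].

Definition L2null : {pred L2pre} := fun f => `[< {ae leb, forall x, f x = 0} >].

Lemma L2null_zmod_closed : zmod_closed L2null.
Proof.
split; first by apply/asboolP; apply: aeW => x.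
move=> f g /asboolP f0 /asboolP g0; apply/asboolP.
by apply: filterS2 f0 g0 => x /= fx gx; rewrite !fctE /= fx gx subr0.
Qed.

HB.instance Definition _ :=
  GRing.isZmodClosed.Build L2pre L2null L2null_zmod_closed.

Local Open Scope quotient_scope.

Definition L2 : Type := @Quotient.quot L2pre L2null.
HB.instance Definition _ := Choice.on L2.
HB.instance Definition _ := EqQuotient.on L2.
HB.instance Definition _ := GRing.Zmodule.on L2.

Definition L2scale (a : C) (f : L2) : L2 := \pi_L2 (a *: repr f).

Lemma L2piP (f g : L2pre) :
  (\pi_L2 f = \pi_L2 g) <-> {ae leb, forall x, f x = g x}.
Proof.
split=> [/eqP|fg].
  rewrite -(@Quotient.idealrBE _ L2null) => /asboolP.
  by apply: filterS => x /= /eqP; rewrite !fctE /= subr_eq0 => /eqP.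
apply/eqP; rewrite -(@Quotient.idealrBE _ L2null); apply/asboolP.
by apply: filterS fg => x /= fgx; rewrite !fctE /= fgx subrr.
Qed.

Lemma L2reprP (f : L2pre) : {ae leb, forall x, repr (\pi_L2 f) x = f x}.
Proof. by apply/L2piP; rewrite reprK. Qed.

Lemma L2scale_pi a (f : L2pre) : L2scale a (\pi_L2 f) = \pi_L2 (a *: f).
Proof.
apply/L2piP; apply: filterS (L2reprP f) => x /= e.
by rewrite !fctE /= e.
Qed.

Lemma L2pi_add (f g : L2pre) : \pi_L2 (f + g) = \pi_L2 f + \pi_L2 g.
Proof. exact: Quotient.pi_add. Qed.

Lemma L2scaleA a b f : L2scale a (L2scale b f) = L2scale (a * b) f.
Proof. by rewrite -[f](@reprK _ L2) !L2scale_pi scalerA. Qed.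

Lemma L2scale1 : left_id 1 L2scale.
Proof. by move=> f; rewrite -[f](@reprK _ L2) L2scale_pi scale1r. Qed.

Lemma L2scaleDr : right_distributive L2scale +%R.
Proof.
move=> a f g; rewrite -[f](@reprK _ L2) -[g](@reprK _ L2).
by rewrite -L2pi_add !L2scale_pi scalerDr L2pi_add.
Qed.

Lemma L2scaleDl f : {morph L2scale^~ f : a b / a + b}.
Proof.
by move=> a b; rewrite -[f](@reprK _ L2) !L2scale_pi scalerDl L2pi_add.
Qed.

HB.instance Definition _ := GRing.Zmodule_isLmodule.Build C L2
  L2scaleA L2scale1 L2scaleDr L2scaleDl.

Definition L2fun_of (f : L2) : R -> C := repr f.

(** The class of [f]; it is [0], by convention, if [f] is not in L^2. *)
Definition L2class (f : R -> C) : L2 := \pi_L2 (insubd (0 : L2pre) f).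

Lemma L2classE (f : R -> C) : f \in @L2fun R ->
  {ae leb, forall x, L2fun_of (L2class f) x = f x}.
Proof.
move=> fL; apply: filterS (L2reprP (insubd (0 : L2pre) f)) => x.
rewrite /L2fun_of /L2class => ->.
by rewrite -[L2val _]/(val _) insubdK.
Qed.

End L2fun_lmod.

(** ** Operators and cyclic representations *)

Section Representations.
Variables (R : realType) (H : lmodType R[i]) (dot : H -> H -> R[i]).
Local Notation C := (R[i]).
Local Notation leb := (@lebesgue_measure R).

Definition hnorm (x : H) : R := Num.sqrt (complex.Re (dot x x)).

(** [dot] makes [H] a Hilbert space; it is linear in the second variable. *)
Definition hilbert : Prop :=
  [/\ forall x, scalar (dot x),
      forall x y, dot y x = (dot x y)^*%C,
      forall x, 0 <= dot x x,
      forall x, dot x x = 0 -> x = 0 &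
      forall u : nat -> H,
        (forall e : R, 0 < e -> exists n0, forall m n,
          (n0 <= m)%N -> (n0 <= n)%N -> hnorm (u m - u n) < e) ->
        exists l : H, forall e : R, 0 < e -> exists n0, forall n,
          (n0 <= n)%N -> hnorm (u n - l) < e].

Definition bounded_op (T : H -> H) : Prop :=
  linear T /\ exists M : R, forall x, hnorm (T x) <= M * hnorm x.

Definition adjoint (T S : H -> H) : Prop :=
  forall x y, dot (T x) y = dot x (S y).

Definition unitary_op (U : H -> H) : Prop :=
  linear U /\ exists V, [/\ adjoint U V, cancel U V & cancel V U].

(** The first condition says that [pi] only depends on the class of [f] modulo
    null functions. *)
Definition star_rep (pi : (C -> C) -> H -> H) : Prop :=
  (forall f g, LinfT f -> LinfT g -> eqT f g -> pi f = pi g) /\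
  [/\ forall f, LinfT f -> bounded_op (pi f),
      forall (a : C) f g, LinfT f -> LinfT g ->
        forall x, pi (fun w => a * f w + g w) x = a *: pi f x + pi g x,
      forall f g, LinfT f -> LinfT g ->
        forall x, pi (fun w => f w * g w) x = pi f (pi g x),
      forall x, pi (fun=> 1) x = x &
      forall f, LinfT f -> adjoint (pi f) (pi (fun w => (f w)^*%C))].

Definition dense_span (G : set H) : Prop :=
  forall (v : H) (e : R), 0 < e ->
  exists (n : nat) (a : 'I_n -> C) (g : 'I_n -> H),
    (forall i, G (g i)) /\ hnorm (v - \sum_i a i *: g i) < e.

(** In the cyclicity condition, [iter n U x = pi f phi] means that [x] is the
    image of [pi f phi] under the [n]-th power of the inverse of [U]. *)
Definition cyclic_representation (N : nat) (m0 h : C -> C)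
    (U : H -> H) (pi : (C -> C) -> H -> H) (phi : H) : Prop :=
  [/\ L1T h, {ae leb, forall x, 0 <= h (expi x)} & eqT (ruelle N m0 h) h] /\
  [/\ hilbert, unitary_op U & star_rep pi] /\
  [/\ forall f, LinfT f -> forall x, U (pi f x) = pi (fun w => f (w ^+ N)) (U x),
      U phi = pi m0 phi,
      forall f, LinfT f ->
        dot phi (pi f phi) = integralT (fun w => f w * h w) &
      dense_span [set x | exists n f, LinfT f /\ iter n U x = pi f phi]].

Definition commutant (U : H -> H) (pi : (C -> C) -> H -> H) : set (H -> H) :=
  [set T | [/\ bounded_op T, T \o U = U \o T,
    forall V, adjoint U V -> T \o V = V \o T &
    forall f, LinfT f -> T \o pi f = pi f \o T]].

End Representations.

(** ** The representation on L^2(R)^p *)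

Section Concrete.
Variable R : realType.
Local Notation C := (R[i]).

Definition L2dot (xi eta : L2 R) : C := ((2 * pi)^-1)%:C *
  cintegral setT (fun x => (L2fun_of xi x)^*%C * L2fun_of eta x).

Definition L2mul (f : R -> C) (xi : L2 R) : L2 R :=
  L2class (fun x => f x * L2fun_of xi x).

Definition U1 (N : nat) (xi : L2 R) : L2 R :=
  L2class (fun x => (Num.sqrt N%:R)%:C * L2fun_of xi (N%:R * x)).

Definition pi1 (f : C -> C) (xi : L2 R) : L2 R := L2mul (f \o @expi R) xi.

Definition L2p (p : nat) : lmodType C := {ffun 'I_p -> L2 R}.

Definition L2pdot (p : nat) (xi eta : L2p p) : C :=
  \sum_k L2dot (xi k) (eta k).

Definition UC (N p : nat) (theta : 'I_p -> R) (xi : L2p p) : L2p p :=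
  [ffun k => expi (theta k) *: U1 N (xi (ordS k))].

Definition piC (p : nat) (z : 'I_p -> C) (f : C -> C) (xi : L2p p) : L2p p :=
  [ffun k => pi1 (alpha (z k) f) (xi k)].

Definition diag_op (p : nat) (f : 'I_p -> R -> C) (xi : L2p p) : L2p p :=
  [ffun k => L2mul (f k) (xi k)].

End Concrete.

(** ** The functions attached to a cycle *)

Section CycleFunctions.
Variables (R : realType) (N : nat) (m0 : R[i] -> R[i]) (p : nat).
Variables (z : 'I_p -> R[i]) (theta : 'I_p -> R).
Local Notation C := (R[i]).

Definition thetaC : R := \sum_k theta k.

Definition phi_partial (k : 'I_p) (x : R) : nat -> C^o := fun n =>
  \prod_(1 <= l < n.+1)
    (expi (- thetaC) * alpha (z k) (mpow N m0 p) (expi (x / N%:R ^+ (l * p)))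
       / (Num.sqrt (N%:R ^+ p))%:C).

Definition phi (k : 'I_p) (x : R) : C := limn (phi_partial k x).

Definition Per_phi (k : 'I_p) : R -> \bar R :=
  Per (fun x => modulus (phi k x) ^+ 2).

Definition g_ (k : 'I_p) : C -> C :=
  alpha (z k)^-1 (ofperiodic (fun x => (fine (Per_phi k x))%:C)).

Definition hC : C -> C := fun w => \sum_k g_ k w.

Definition phiC : L2p R p := [ffun k => L2class (phi k)].

Definition zero_on_disjoint_cycles (f : C -> C) : Prop :=
  forall (q : nat) (w : 'I_q -> C), is_cycle N m0 w ->
    (forall i j, w i <> z j) -> forall i, f (w i) = 0.

End CycleFunctions.

(* Main.v *)
Require Import Defs.
From HB Require Import structures.
From mathcomp Require Import all_boot all_order all_algebra ring lra.
From mathcomp Require Import all_classical all_reals all_analysis measurable_realfun.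
From mathcomp Require Import complex.
From mathcomp Require Import zify.

Set Implicit Arguments.
Unset Strict Implicit.
Unset Printing Implicit Defensive.

Import Order.TTheory GRing.Theory Num.Theory numFieldNormedType.Exports.

Local Open Scope classical_set_scope.
Local Open Scope complex_scope.
Local Open Scope ring_scope.

(** Write E(x) = e^(ix) and R for the Ruelle operator.  The condition R 1 = 1 says
    that the weights |m0|^2 / N at the N-th roots of a point have sum 1; so they
    are at most 1, and a cycle consists of points of weight 1, all other roots of
    its points having weight 0.

    The product phi_k converges because its factors are bounded by 1, Lipschitz
    and equal to 1 at 0.  It satisfies the two-scale relation [phi_refine],
    phi_(k+1)(N x) = e^(-i theta_k) m0(z_k E(x)) phi_k(x) / sqrt N, on which all
    the rest depends.

    The periodization of |phi_k|^2, rotated to z_k, is g_k.  It is at most 1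
    ([wave2_Per_le1]), so phi_k is in L^2, and the two-scale relation says that R
    maps g_k to g_(k+1) ([wave_sum_step]).  If g_k does not vanish at a point of a
    cycle, some backward orbit of this point tends to C through points of positive
    weight; it has to follow the cycle, so the point is z_k ([wave2_cycle]).  A
    nonnegative harmonic function close to lam around C dominates lam h, as one
    sees by iterating R on the part of h near C ([harmonic_ge]); this contains
    both minimality statements.  The iterates of R on powers of a bump at z_k
    converge to g_k ([bump_iter_cvg]); they keep bounded Lipschitz constants
    ([iter_rruelle_lip]) and, if m0 is a trigonometric polynomial, bounded
    degrees ([iter_trigdeg]), and both properties pass to the limit.

    The two-scale relation is also U_C Phi = pi_C(m0) Phi.  Folding the line onto
    a period gives the state f -> int f h ([Phi_state]).  For cyclicity, let xi be
    bounded with bounded support in the component k.  After n steps backwards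
    along the cycle, pi_C(f) Phi with f supported near z_k becomes a dilate by N^n
    of f(z_k E(.)) phi_k, and f can be chosen so that this is xi; since h is close
    to |phi_k|^2 near z_k, the norms show that nothing else is left in the limit
    ([single_spanned]).

    Finally let T be in the commutant.  As m0 is nonsingular, phi_k has almost no
    zeros, and T Phi = (f_1 phi_1, ..., f_p phi_p) defines functions f_k with
    f_(k+1)(N x) = f_k(x) ([quotient_refine]).  T multiplies by them on the
    vectors that span, hence everywhere, and boundedness of T bounds them
    ([T_diag]). *)

(** * The circle and its coordinate *)

Section Basics.
Variable R : realType.
Local Notation C := (R[i]).
Local Notation E := (@expi R).
Implicit Types (x y t u : R) (w v : C).

Lemma modulusE w : `|w| = (modulus w)%:C.
Proof. by rewrite normc_def; case: w. Qed.

Lemma modulusM : {morph @modulus R : w v / w * v}.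
Proof. exact: ComplexField.Normc.normcM. Qed.

Lemma modulusD w v : modulus (w + v) <= modulus w + modulus v.
Proof. exact: le_normcD. Qed.

Lemma modulusN w : modulus (- w) = modulus w.
Proof. exact: normcN. Qed.

Lemma modulusBC w v : modulus (w - v) = modulus (v - w).
Proof. by rewrite -modulusN opprB. Qed.

Lemma modulus0 : modulus (0 : C) = 0.
Proof. exact: ComplexField.Normc.normc0. Qed.

Lemma modulus1 : modulus (1 : C) = 1.
Proof. exact: ComplexField.Normc.normc1. Qed.

Lemma modulusV w : modulus w^-1 = (modulus w)^-1.
Proof. exact: ComplexField.Normc.normcV. Qed.

Lemma modulus0_eq0 w : modulus w = 0 -> w = 0.
Proof. exact: ComplexField.Normc.eq0_normc. Qed.

Lemma modulus_eq0 w : (modulus w == 0) = (w == 0).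
Proof. by apply/eqP/eqP => [/modulus0_eq0|->]; rewrite ?modulus0. Qed.

Lemma modulus_real x : modulus x%:C = `|x|.
Proof. by apply: complexI; rewrite -modulusE normc_def /= expr0n addr0 sqrtr_sqr. Qed.

Lemma modulusX w n : modulus (w ^+ n) = modulus w ^+ n.
Proof. by elim: n => [|n IH]; rewrite ?expr0 ?modulus1// !exprS modulusM IH. Qed.

Lemma modulus_conj w : modulus w^*%C = modulus w.
Proof. by case: w => a b; rewrite /modulus /= sqrrN. Qed.

Lemma modulus_prod (I : Type) (r : seq I) (P : pred I) (F : I -> C) :
  modulus (\prod_(i <- r | P i) F i) = \prod_(i <- r | P i) modulus (F i).
Proof. by apply: (big_morph _ modulusM modulus1). Qed.

Lemma modulus_sum (I : Type) (r : seq I) (P : pred I) (F : I -> C) :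
  modulus (\sum_(i <- r | P i) F i) <= \sum_(i <- r | P i) modulus (F i).
Proof.
elim/big_ind2: _ => [|a b c d ab cd|i _//]; first by rewrite modulus0.
by rewrite (le_trans (modulusD _ _))// lerD.
Qed.

Lemma modulus_triangle w v (t : C) : modulus (w - t) <= modulus (w - v) + modulus (v - t).
Proof. by rewrite (_ : w - t = (w - v) + (v - t)) ?modulusD// addrA subrK. Qed.

Lemma modulus_dist w v : `|modulus w - modulus v| <= modulus (w - v).
Proof.
rewrite ler_norml; apply/andP; split.
  by rewrite lerNl opprB lerBlDr -(modulusBC v) (le_trans _ (modulusD _ _))// subrK.
by rewrite lerBlDr (le_trans _ (modulusD _ _))// subrK.
Qed.

Lemma Re_le_modulus w : `|complex.Re w| <= modulus w.
Proof.
by rewrite -(@ler_pXn2r _ 2) ?nnegrE ?modulus_ge0// modulus2 real_normK ?num_real// lerDl sqr_ge0.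
Qed.

Lemma Im_le_modulus w : `|complex.Im w| <= modulus w.
Proof.
by rewrite -(@ler_pXn2r _ 2) ?nnegrE ?modulus_ge0// modulus2 real_normK ?num_real// lerDr sqr_ge0.
Qed.

Lemma modulus_le_ReIm w : modulus w <= `|complex.Re w| + `|complex.Im w|.
Proof.
rewrite -(@ler_pXn2r _ 2) ?nnegrE ?modulus_ge0 ?addr_ge0// modulus2.
rewrite -(real_normK (num_real (complex.Re w))) -(real_normK (num_real (complex.Im w))).
rewrite sqrrD -subr_ge0.
by rewrite (_ : _ - _ = (`|complex.Re w| * `|complex.Im w|) *+ 2) ?mulrn_wge0 ?mulr_ge0//; ring.
Qed.

Lemma mul_conj_modulus w : w^*%C * w = ((modulus w) ^+ 2)%:C.
Proof.
rewrite modulus2; case: w => a b /=; rewrite /real_complex_def /=.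
by apply/eqP; rewrite eq_complex /=; apply/andP; split; apply/eqP; ring.
Qed.

Lemma circleE w : circle w <-> modulus w = 1.
Proof. by rewrite /circle /= modulusE; split=> [[]|->]. Qed.

Lemma circleM w v : circle w -> circle v -> circle (w * v).
Proof. by rewrite !circleE modulusM => -> ->; rewrite mulr1. Qed.

Lemma circleV w : circle w -> circle w^-1.
Proof. by rewrite !circleE modulusV => ->; rewrite invr1. Qed.

Lemma circleX w n : circle w -> circle (w ^+ n).
Proof. by rewrite !circleE modulusX => ->; rewrite expr1n. Qed.

Lemma circle_neq0 w : circle w -> w != 0.
Proof. by rewrite circleE -modulus_eq0 => ->; rewrite oner_eq0. Qed.

Lemma modulus_expi x : modulus (E x) = 1.
Proof. by rewrite /modulus /= cos2Dsin2 sqrtr1. Qed.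

Lemma circle_expi x : circle (E x).
Proof. by rewrite circleE modulus_expi. Qed.

Lemma expi_neq0 x : E x != 0.
Proof. exact: circle_neq0 (circle_expi x). Qed.

Lemma expi0 : E 0 = 1.
Proof. by rewrite /expi cos0 sin0. Qed.

Lemma expiD x y : E (x + y) = E x * E y.
Proof.
rewrite /expi cosD sinD; apply/eqP; rewrite eq_complex /=.
by rewrite eqxx /= [X in _ == X]addrC eqxx.
Qed.

Lemma expiN x : E (- x) = (E x)^-1.
Proof.
by apply: (mulIf (expi_neq0 x)); rewrite mulVf ?expi_neq0// -expiD addNr expi0.
Qed.

Lemma expi_conj x : (E x)^*%C = (E x)^-1.
Proof. by rewrite -expiN /expi cosN sinN. Qed.

Lemma expiX x n : E x ^+ n = E (n%:R * x).
Proof.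
elim: n => [|n IH]; first by rewrite mul0r expi0.
by rewrite exprS IH -expiD -natr1; congr E; ring.
Qed.

Lemma expi_sum (I : Type) (r : seq I) (F : I -> R) :
  E (\sum_(i <- r) F i) = \prod_(i <- r) E (F i).
Proof. exact: (big_morph E expiD expi0). Qed.

Lemma expi2pi : E (2 * pi) = 1.
Proof. by rewrite /expi mulr_natl cos2pi sin2pi. Qed.

Lemma expi_2piz (j : int) : E (2 * j%:~R * pi) = 1.
Proof.
have nat_case (n : nat) : E (2 * n%:R * pi) = 1.
  have -> : 2 * n%:R * pi = n%:R * (2 * pi) :> R by ring.
  by rewrite -expiX expi2pi expr1n.
case: j => n; first by rewrite -pmulrn nat_case.
by rewrite NegzE mulrNz mulrN mulNr expiN -pmulrn nat_case invr1.
Qed.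

Lemma expi_period x (j : int) : E (x + 2 * j%:~R * pi) = E x.
Proof. by rewrite expiD expi_2piz mulr1. Qed.

Lemma mod2pi (a x : R) : exists j : int, a <= x + 2 * j%:~R * pi < a + 2 * pi.
Proof.
have p0 : 0 < 2 * pi :> R by rewrite mulr_gt0// pi_gt0.
exists (- Num.floor ((x - a) / (2 * pi))).
have /andP[] := floor_itv ((x - a) / (2 * pi)).
set f := Num.floor _; rewrite ler_pdivlMr// ltr_pdivrMr// => h1 h2.
rewrite mulrNz; apply/andP; split; first by lra.
move: h2; rewrite intrD mulrDl; lra.
Qed.

Lemma expi_surj w : circle w -> exists x, E x = w.
Proof.
rewrite circleE => w1.
have := modulus2 w; rewrite w1 expr1n; case: w w1 => a b /= w1 ab.
have a1 : -1 <= a <= 1.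
  by rewrite -ler_norml; rewrite -w1; exact: (Re_le_modulus (a +i* b)).
have ca : cos (acos a) = a by rewrite acosK// in_itv.
have sa : sin (acos a) = `|b|.
  by rewrite sin_acos// ab addrAC subrr add0r sqrtr_sqr.
have [b0|b0] := leP 0 b.
  by exists (acos a); rewrite /expi ca sa ger0_norm.
by exists (- acos a); rewrite /expi cosN sinN ca sa ltr0_norm// opprK.
Qed.

(** The cosine is injective on [0, pi]; the rest of the period is brought there
    by t -> - t and t -> 2 pi - t. *)
Lemma expi_eq1_small t : - (2 * pi) < t < 2 * pi -> E t = 1 -> t = 0.
Proof.
wlog t0 : t / 0 <= t => [hw|].
  have [t0|t0] := leP 0 t; first exact: hw.
  move=> tb et; apply/eqP; rewrite -oppr_eq0; apply/eqP.
  apply: hw; rewrite ?oppr_ge0 ?(ltW t0)//; first by move: tb => /andP[]; lra.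
  by rewrite expiN et invr1.
move=> /andP[_ t2] [ct st].
have pi0 : 0 < pi :> R by exact: pi_gt0.
have [tpi|tpi] := leP t pi.
  apply: (@cos_inj R); rewrite ?in_itv /= ?t0 ?tpi ?lexx ?ltW//.
  by rewrite ct cos0.
have : cos (2 * pi - t) = cos 0 by rewrite cosB mulr_natl cos2pi sin2pi ct st cos0; ring.
move/(@cos_inj R) => h; suff : 2 * pi - t = 0 by lra.
by apply: h; rewrite in_itv /=; apply/andP; split; lra.
Qed.

Lemma expi_eq1 t : E t = 1 -> exists j : int, t = 2 * j%:~R * pi.
Proof.
move=> et; have [j /andP[h1 h2]] := mod2pi 0 t.
exists (- j); apply/eqP; rewrite mulrNz mulrN mulNr -subr_eq0 opprK; apply/eqP.
by apply: expi_eq1_small; rewrite ?expi_period//; have := pi_gt0 R; lra.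
Qed.

Lemma expi_inj x y : E x = E y -> exists j : int, x = y + 2 * j%:~R * pi.
Proof.
move=> exy; have /expi_eq1[j xyj] : E (x - y) = 1.
  by rewrite expiD expiN exy mulfV// expi_neq0.
by exists j; rewrite -xyj addrC subrK.
Qed.

Lemma argT_spec w : circle w -> 0 <= argT w < 2 * pi /\ E (argT w) = w.
Proof.
move=> /expi_surj[x xw]; have [j jp] := mod2pi 0 x.
rewrite /argT; case: xgetP => [y -> //|/(_ (x + 2 * j%:~R * pi))].
by case; split; rewrite ?expi_period//; move: jp; rewrite add0r.
Qed.

Lemma expi_argT w : circle w -> E (argT w) = w.
Proof. by move=> /argT_spec[]. Qed.

Lemma MVT_bound (f f' : R -> R) (c : R) : (forall x, is_derive x 1 f (f' x)) ->
  (forall x, `|f' x| <= c) -> forall x y, `|f x - f y| <= c * `|x - y|.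
Proof.
move=> df f'c x y.
wlog xy : x y / y <= x => [hw|].
  by have [yx|/ltW xy] := leP y x; [exact: hw|rewrite distrC (distrC x) hw].
have cf : {within `[y, x], continuous f}.
  by apply: derivable_within_continuous => u _; have := df u => dfu; exact: ex_derive.
have [t _ ->] := @MVT_segment R f f' y x xy (fun u _ => df u) cf.
by rewrite normrM ler_wpM2r.
Qed.

Lemma sin_lip x y : `|sin x - sin y| <= `|x - y|.
Proof.
rewrite -[leRHS]mul1r; by apply: (MVT_bound (f' := cos)) => t; rewrite cos_max.
Qed.

Lemma cos_lip x y : `|cos x - cos y| <= `|x - y|.
Proof.
rewrite -[leRHS]mul1r; by apply: (MVT_bound (f' := fun t => - sin t)) => t; rewrite normrN sin_max.
Qed.

Lemma expi_lip x y : modulus (E x - E y) <= 2 * `|x - y|.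
Proof.
rewrite (le_trans (modulus_le_ReIm _))//= mulr_natl mulr2n lerD//.
  exact: cos_lip.
exact: sin_lip.
Qed.

(** Near 1 the chord controls the angle: there cos > 1/2, so that the mean value
    theorem gives |t| / 2 <= |sin t|.  Through this inequality a Lipschitz bound
    in the angle becomes one for the distance of the plane. *)
Lemma expi_near1 t : - pi <= t <= pi -> modulus (E t - 1) < 1 ->
  `|t| <= 2 * modulus (E t - 1).
Proof.
move=> tpi et1.
have c12 : 2^-1 < cos t.
  have h : modulus (E t - 1) ^+ 2 = (cos t - 1) ^+ 2 + sin t ^+ 2.
    by rewrite modulus2 /= oppr0 addr0.
  have : modulus (E t - 1) ^+ 2 < 1 by rewrite expr_lt1// modulus_ge0.
  by rewrite h; have := cos2Dsin2 t; rewrite !expr2; nra.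
rewrite (@le_trans _ _ (2 * `|sin t|))//; last first.
  rewrite ler_pM2l//; have := Im_le_modulus (E t - 1).
  by rewrite /= oppr0 addr0.
wlog t0 : t tpi {et1} c12 / 0 <= t => [hw|].
  have [t0|t0] := leP 0 t; first exact: hw.
  rewrite -(normrN t) -(normrN (sin t)) -sinN; apply: hw; rewrite ?cosN//; lra.
have cs : {within `[0, t], continuous (@sin R)}.
  by apply: derivable_within_continuous => u _; exact: derivable_sin.
have [c] := @MVT_segment R (@sin R) cos 0 t t0 (fun u _ => is_derive_sin u) cs.
rewrite in_itv /= sin0 !subr0 => /andP[c0 ct] ->.
have cc : 2^-1 < cos c.
  rewrite (lt_le_trans c12)// le_eqVlt; have [->|ne] := eqVneq c t; rewrite ?eqxx//.
  by rewrite ltr_cos ?in_itv /= ?lt_neqAle ?ne ?ct ?orbT//; move: tpi => /andP[]; lra.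
rewrite normrM (ger0_norm t0) (@ger0_norm _ (cos c)); [nra|lra].
Qed.

Lemma lip_continuous (f : R -> C) (L : R) : 0 <= L ->
  (forall x y, modulus (f x - f y) <= L * `|x - y|) -> continuous (f : R -> C^o).
Proof.
move=> L0 hL x; apply/cvgrPdist_lt => e e0.
have eE : e = (complex.Re e)%:C by rewrite RRe_real// ger0_real// ltW.
have re0 : 0 < complex.Re e by move: e0; rewrite eE ltcR.
have L1 : 0 < L + 1 by lra.
near=> y; rewrite /= modulusE eE ltcR (le_lt_trans (hL _ _))//.
apply: (@le_lt_trans _ _ ((L + 1) * `|x - y|)); first by rewrite ler_wpM2r// lerDl.
rewrite -ltr_pdivlMl//; near: y.
by apply: (@cvgr_dist_lt _ _ _ (nbhs x) _ idfun x) => //; rewrite mulr_gt0// invr_gt0.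
Unshelve. all: by end_near. Qed.

End Basics.

(** * The Ruelle operator on the inverse branches *)

Section LipT.
Variable R : realType.
Local Notation C := (R[i]).

(** The Lipschitz predicate asks for a bound by all large enough complex
    constants; one real constant says as much. *)
Lemma lipschitzTP (f : C -> C) : lipschitzT f <->
  exists2 L : R, 0 <= L & forall w v, circle w -> circle v ->
    modulus (f w - f v) <= L * modulus (w - v).
Proof.
split.
  case=> M [Mr /= hM]; exists (modulus M + 1).
    by rewrite addr_ge0// modulus_ge0.
  move=> w v cw cv.
  have MM : M < (modulus M + 1)%:C.
    rewrite (le_lt_trans (real_ler_norm Mr))// modulusE ltcR; lra.
  have := hM _ MM (w, v) (conj cw cv).
  by rewrite /= !modulusE -rmorphM /= lecR.
case=> L L0 hL.
apply: (@klipschitzW _ _ _ L%:C).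
  apply: (@globally_properfilter _ _ (1, 1)).
  by split; rewrite /= circleE modulus1.
move=> [w v] [/= cw cv]; rewrite !modulusE -rmorphM /= lecR; exact: hL.
Qed.

End LipT.

Section RuelleCoord.
Variables (R : realType) (N : nat) (m0 : R[i] -> R[i]).
Hypothesis hN : (2 <= N)%N.
Local Notation C := (R[i]).
Local Notation E := (@expi R).

Let N0 : (0 : R) < N%:R.
Proof. by rewrite ltr0n; lia. Qed.

(** The coefficient of the Ruelle operator at a root.  It is also the squared
    modulus of the factors of the infinite product. *)
Definition weight (w : C) : R := modulus (m0 w) ^+ 2 / N%:R.

Lemma weight_ge0 w : 0 <= weight w.
Proof. by rewrite divr_ge0 ?sqr_ge0// ltW. Qed.

Definition branch (x : R) (r : nat) : R := (x + 2 * r%:~R * pi) / N%:R.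

Lemma branchK x r : N%:R * branch x r = x + 2 * r%:~R * pi.
Proof. by rewrite /branch mulrC mulfVK// gt_eqF. Qed.

Lemma expi_branchX x r : E (branch x r) ^+ N = E x.
Proof. by rewrite expiX branchK expi_period. Qed.

Lemma expi_branch_inj (a : C) (x : R) : a != 0 ->
  set_inj [set: 'I_N] (fun r : 'I_N => a * E (branch x r)).
Proof.
move=> a0 r s _ _ /(mulfI a0) /expi_inj[j ej].
have pi0 := pi_gt0 R.
have e1 : (r%:R : R) = s%:R + N%:R * j%:~R.
  have : N%:R * branch x r = N%:R * branch x s + N%:R * (2 * j%:~R * pi) by rewrite ej mulrDr.
  rewrite !branchK -!pmulrn => e2.
  have e3 : (2 * pi) * (r%:R - (s%:R + N%:R * j%:~R)) = 0 :> R by move: e2; lra.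
  by apply/eqP; rewrite -subr_eq0; move/eqP: e3; rewrite mulf_eq0 gt_eqF ?mulr_gt0.
have e2 : (r : int) = s%:Z + N%:Z * j.
  by apply/eqP; rewrite -(eqr_int R) intrD intrM -!pmulrn; apply/eqP.
apply: val_inj => /=; have := ltn_ord r; have := ltn_ord s.
case: j ej e1 e2 => [[|j]|j] _ _ /= => h1 h2 h3; nia.
Qed.

(** Around a point a of the cycle the coordinate x -> a E(x) is used.  The N-th
    roots of a^N E(x), which lies near the next point of the cycle, are the
    a E(y) for the N inverse branches y of multiplication by N. *)
Lemma roots_branch (a : C) (x : R) : circle a ->
  [set v : C | v ^+ N = a ^+ N * E x] = (fun r : 'I_N => a * E (branch x r)) @` setT.
Proof.
move=> ca; have a0 := circle_neq0 ca.
apply/seteqP; split=> [v /= vN|_ [r _ <-] /=]; last by rewrite exprMn expi_branchX.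
have cva : circle (v / a).
  rewrite circleE modulusM modulusV (_ : modulus a = 1) -?circleE// invr1 mulr1.
  have : modulus v ^+ N = 1.
    rewrite -modulusX vN modulusM modulus_expi modulusX (_ : modulus a = 1) -?circleE//.
    by rewrite expr1n mulr1.
  by move=> h; apply/eqP; rewrite -(@pexpr_eq1 _ _ N) ?modulus_ge0 ?h//; lia.
have [y yE] := expi_surj cva.
have : E (N%:R * y) = E x.
  by rewrite -expiX yE expr_div_n vN mulrC mulKf// expf_neq0.
move=> /expi_inj[j ej].
have Nz : (N%:Z != 0)%R by lia.
pose r := (j %% N%:Z)%Z.
have r0 : (0 <= r)%R by rewrite modz_ge0.
have rN : (r < N%:Z)%R by rewrite ltz_pmod//; lia.
have rN' : (absz r < N)%N by lia.
exists (Ordinal rN') => //=.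
suff -> : E (branch x `|r|%N) = v / a by rewrite mulrC mulfVK.
rewrite -yE -(expi_period _ (j %/ N%:Z)%Z); congr E.
have rabs : (`|r|%N : int) = r by lia.
have jr : j%:~R = (j %/ N%:Z)%Z%:~R * N%:R + r%:~R :> R.
  by rewrite {1}(divz_eq j N%:Z) intrD intrM -pmulrn.
rewrite /branch rabs.
have -> : x = N%:R * y - 2 * j%:~R * pi by rewrite ej addrK.
by rewrite jr; field; rewrite gt_eqF.
Qed.

Lemma root_sum_branch (F : C -> C) (a : C) (x : R) : circle a ->
  \sum_(v \in [set v : C | v ^+ N = a ^+ N * E x]) F v =
  \sum_(r < N) F (a * E (branch x r)).
Proof.
move=> ca; rewrite roots_branch// fsbig_image; last first.
  exact: expi_branch_inj (circle_neq0 ca).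
rewrite (fsbigE (index_enum 'I_N)) ?index_enum_uniq//; last first.
  by move=> i _; rewrite mem_index_enum.
by rewrite big_mkcond /=; under eq_bigr do rewrite in_setT.
Qed.

Lemma ruelle_branch (f : C -> C) (a : C) (x : R) : circle a ->
  ruelle N m0 f (a ^+ N * E x) =
  \sum_(r < N) (weight (a * E (branch x r)))%:C * f (a * E (branch x r)).
Proof.
move=> ca; rewrite /ruelle root_sum_branch// mulr_sumr; apply: eq_bigr => r _.
rewrite /weight modulusE mulrA; congr (_ * _).
by rewrite rmorphM /= rmorphXn /= fmorphV /= rmorph_nat mulrC.
Qed.

End RuelleCoord.

(** * Limits and periodization *)

Section Limits.
Variable R : realType.
Local Notation C := (R[i]).

Lemma cvgCP (u : nat -> C) (l : C) :
  ((u : nat -> C^o) @ \oo --> (l : C^o)) <->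
  (forall e : R, 0 < e -> exists n0, forall n, (n0 <= n)%N -> modulus (u n - l) < e).
Proof.
split=> [/cvgrPdist_lt ul e e0|ul].
  have := ul e%:C; rewrite ltcR => /(_ e0)[n0 _ n0P]; exists n0 => n n0n.
  by have := n0P n n0n; rewrite /= modulusE ltcR modulusBC.
apply/cvgrPdist_lt => e e0.
have [e'0 ee] : 0 < complex.Re e /\ e = (complex.Re e)%:C.
  move: e0; case: e => a b; rewrite ltcE /= => /andP[/eqP b0 a0]; split => //.
  by rewrite b0.
have [n0 n0P] := ul _ e'0; exists n0 => // n n0n.
by rewrite /= modulusE ee ltcR modulusBC; exact: n0P.
Qed.

Lemma cvgRP (u : nat -> R) (l : R) :
  (u @ \oo --> l) <->
  (forall e : R, 0 < e -> exists n0, forall n, (n0 <= n)%N -> `|u n - l| < e).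
Proof.
split=> [/cvgrPdist_lt ul e e0|ul].
  by have [n0 _ n0P] := ul _ e0; exists n0 => n n0n; rewrite distrC; exact: n0P.
apply/cvgrPdist_lt => e e0; have [n0 n0P] := ul _ e0.
by exists n0 => // n n0n; rewrite /= distrC; exact: n0P.
Qed.

Lemma cauchyR (u : nat -> R) :
  (forall e : R, 0 < e -> exists n0, forall m n, (n0 <= m)%N -> (n0 <= n)%N ->
    `|u m - u n| < e) -> exists l : R, u @ \oo --> l.
Proof.
move=> uC; suff : cvg (u @ \oo) by move=> h; exists (lim (u @ \oo)).
apply/cauchy_cvgP/cauchy_ballP => e e0.
have [n0 n0P] := uC _ e0.
pose A := [set y | exists2 m, (n0 <= m)%N & u m = y].
have nA : (u @ \oo) A by exists n0 => // m /= n0m; exists m.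
exists (A, A); first by split.
by move=> [_ _] [[m n0m <-] [n n0n <-]]; exact: n0P.
Qed.

Lemma cauchyC (u : nat -> C) :
  (forall e : R, 0 < e -> exists n0, forall m n, (n0 <= m)%N -> (n0 <= n)%N ->
    modulus (u m - u n) < e) ->
  exists l : C, forall e : R, 0 < e -> exists n0, forall n, (n0 <= n)%N ->
    modulus (u n - l) < e.
Proof.
move=> uC.
have [a ua] : exists a : R, (fun n => complex.Re (u n)) @ \oo --> a.
  apply: cauchyR => e e0; have [n0 n0P] := uC _ e0; exists n0 => m n hm hn.
  by rewrite (le_lt_trans _ (n0P m n hm hn))// -raddfB Re_le_modulus.
have [b ub] : exists b : R, (fun n => complex.Im (u n)) @ \oo --> b.
  apply: cauchyR => e e0; have [n0 n0P] := uC _ e0; exists n0 => m n hm hn.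
  by rewrite (le_lt_trans _ (n0P m n hm hn))// -raddfB Im_le_modulus.
exists (a +i* b) => e e0; have e20 : 0 < e / 2 by rewrite divr_gt0.
have [n1 h1] := (cvgRP _ _).1 ua _ e20; have [n2 h2] := (cvgRP _ _).1 ub _ e20.
exists (maxn n1 n2) => n; rewrite geq_max => /andP[/h1 {}h1 /h2 {}h2].
rewrite (le_lt_trans (modulus_le_ReIm _))// (splitr e).
by move: (u n) h1 h2 => [c d] /= h1 h2; rewrite ltrD.
Qed.

Lemma le_half_pow (e c : R) : 0 < e -> exists n0, forall n, (n0 <= n)%N ->
  c / 2 ^+ n < e.
Proof.
move=> e0; pose K := (Num.truncn (`|c| / e)).+1.
have hK : `|c| / e < K%:R by exact: truncnS_gt.
exists K => n Kn.
rewrite ltr_pdivrMr ?exprn_gt0// (le_lt_trans (ler_norm c))//.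
rewrite -ltr_pdivrMl// mulrC (lt_le_trans hK)//.
rewrite -natrX ler_nat (leq_trans Kn)// ltnW// ltn_expl//.
Qed.

Lemma geom_cauchyC (u : nat -> C) (c : R) :
  (forall n, modulus (u n.+1 - u n) <= c / 2 ^+ n.+1) ->
  exists l : C, forall n, modulus (u n - l) <= c / 2 ^+ n.
Proof.
move=> uc.
have c0 : 0 <= c.
  have := le_trans (modulus_ge0 _) (uc 0); rewrite expr1 => h.
  by move: h; rewrite pmulr_lge0// invr_gt0.
have um n k : modulus (u (n + k)%N - u n) <= c / 2 ^+ n - c / 2 ^+ (n + k).
  elim: k => [|k IH]; first by rewrite addn0 !subrr modulus0.
  rewrite addnS (le_trans (modulus_triangle _ (u (n + k)%N) _))//.
  rewrite (le_trans (lerD (uc _) IH))//.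
  have -> : c / 2 ^+ (n + k).+1 = c / 2 ^+ (n + k) / 2.
    by rewrite exprS invfM [2^-1 * _]mulrC mulrA.
  lra.
have um' n m : (n <= m)%N -> modulus (u m - u n) <= c / 2 ^+ n.
  move=> nm; rewrite -(subnKC nm) (le_trans (um _ _))// gerBl.
  by rewrite divr_ge0// exprn_ge0.
have [l ul] : exists l : C, forall e : R, 0 < e -> exists n0, forall n,
    (n0 <= n)%N -> modulus (u n - l) < e.
  apply: cauchyC => e e0; have [n0 n0P] := le_half_pow (c + c) e0.
  exists n0 => m n hm hn; rewrite (le_lt_trans _ (n0P n0 _))//.
  rewrite (le_trans (modulus_triangle _ (u n0) _))// mulrDl lerD//.
    exact: um'.
  by rewrite modulusBC um'.
exists l => n; apply/ler_addgt0Pr => e e0.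
have [n0 n0P] := ul _ e0.
rewrite (le_trans (modulus_triangle _ (u (maxn n n0)) _))// lerD//.
  by rewrite modulusBC um'// leq_maxl.
by rewrite ltW// n0P// leq_maxr.
Qed.

(** The factors are exchanged one at a time, the others having modulus at most
    1. *)
Lemma prod_dist (n : nat) (a b : nat -> C) :
  (forall i, modulus (a i) <= 1) -> (forall i, modulus (b i) <= 1) ->
  modulus (\prod_(i < n) a i - \prod_(i < n) b i) <=
  \sum_(i < n) modulus (a i - b i).
Proof.
move=> a1 b1; elim: n => [|n IH]; first by rewrite !big_ord0 subrr modulus0.
rewrite !big_ord_recr /=.
set A := \prod_(i < n) a i; set B := \prod_(i < n) b i.
have -> : A * a n - B * b n = (A - B) * a n + B * (a n - b n) by ring.
rewrite (le_trans (modulusD _ _))// !modulusM lerD//.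
  by rewrite (le_trans _ IH)// ler_piMr// modulus_ge0.
rewrite ler_piMl ?modulus_ge0// modulus_prod.
by apply: prodr_ile1 => i _; rewrite modulus_ge0 b1.
Qed.

Lemma prod_modulus_le1 (n : nat) (a : nat -> C) :
  (forall i, modulus (a i) <= 1) -> modulus (\prod_(i < n) a i) <= 1.
Proof.
by move=> a1; rewrite modulus_prod; apply: prodr_ile1 => i _; rewrite modulus_ge0 a1.
Qed.

End Limits.

Section Periodization.
Variable R : realType.
Local Notation C := (R[i]).
Local Notation E := (@expi R).
Implicit Types (B V : R -> R) (x : R).

Lemma Per_ge B x (s : seq int) : (forall y, 0 <= B y) -> uniq s ->
  ((\sum_(j <- s) B (x + 2 * j%:~R * pi))%:E <= Per B x)%E.
Proof.
move=> B0 us; rewrite /Per -sumEFin fsbig_seq//.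
apply: esum_ge; exists [set` s] => //; split => //; exact: finite_seq.
Qed.

Lemma Per_le B x (c : R) :
  (forall s : seq int, uniq s -> \sum_(j <- s) B (x + 2 * j%:~R * pi) <= c) ->
  (Per B x <= c%:E)%E.
Proof.
move=> Bc; apply: ge_ereal_sup => _ [F [finF _] <-].
rewrite fsumEFin//.
rewrite fsbig_finite//.
by rewrite lee_fin; apply: Bc; exact: finmap.fset_uniq.
Qed.

Lemma Per_ge0 B x : (forall y, 0 <= B y) -> (0 <= Per B x)%E.
Proof. by move=> B0; apply: esum_ge0 => j _; rewrite lee_fin. Qed.

Lemma eq_Per B B' x : B =1 B' -> Per B x = Per B' x.
Proof. by move=> e; apply: eq_esum => j _; rewrite e. Qed.

Lemma le_Per B B' x : (forall y, B y <= B' y) -> (Per B x <= Per B' x)%E.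
Proof. by move=> e; apply: le_esum => j _; rewrite lee_fin. Qed.

Lemma PerZ (c : R) B x : 0 <= c ->
  Per (fun y => c * B y) x = (c%:E * Per B x)%E.
Proof.
move=> c0; rewrite /Per /esum -ereal_supZl//; last first.
  apply/set0P; exists 0%E; exists set0; first exact: fsets_set0.
  by rewrite fsbig_set0.
congr ereal_sup; apply/seteqP; split => [_ [F [finF _] <-]|_ [_ [F [finF _] <-] <-]].
  exists (\sum_(j \in F) (B (x + 2 * j%:~R * pi))%:E)%E; first by exists F.
  by rewrite !fsumEFin// -EFinM mulr_fsumr.
by exists F => //; rewrite !fsumEFin// -EFinM mulr_fsumr.
Qed.

Lemma Per_shift B x (i : int) : Per B (x + 2 * i%:~R * pi) = Per B x.
Proof.
rewrite [in RHS]/Per (@reindex_esum _ _ _ [set: int] [set: int] (fun j => i + j))//.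
  by apply: eq_esum => j _; congr (B _)%:E; rewrite intrD; ring.
Qed.

Lemma Per_eq_expi B x y : E x = E y -> Per B x = Per B y.
Proof. by move=> /expi_inj[j ->]; rewrite Per_shift. Qed.

(** The integers split into their N residue classes: the branch r collects the
    translates of x by the j congruent to r modulo N. *)
Lemma Per_step (N : nat) V B x : (2 <= N)%N ->
  (forall y, 0 <= V y) -> (forall y, 0 <= B y) ->
  (forall y (j : int), V (y + 2 * j%:~R * pi) = V y) ->
  (\sum_(r < N) (V (branch N x r))%:E * Per B (branch N x r))%E =
  Per (fun y => V (y / N%:R) * B (y / N%:R)) x.
Proof.
move=> hN V0 B0 Vp.
have N0 : (0 : R) < N%:R by rewrite ltr0n; lia.
transitivity (\sum_(r < N) \esum_(j in [set: int])
   (V (branch N x r) * B (branch N x r + 2 * j%:~R * pi))%:E)%E.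
  apply: eq_bigr => r _; rewrite -PerZ//.
rewrite (fsbig_ord _ _ (fun r : nat => \esum_(j in [set: int])
   (V (branch N x r) * B (branch N x r + 2 * j%:~R * pi))%:E)%E).
rewrite -esum_fset; [|exact: finite_II|by move=> r _; apply: esum_ge0 => j _;
  rewrite lee_fin mulr_ge0].
rewrite esum_esum; last by move=> r j _ _; rewrite lee_fin mulr_ge0.
rewrite /Per (@reindex_esum _ _ _ (`I_N `*`` (fun=> [set: int])) [set: int]
   (fun k => k.1%:Z + N%:Z * k.2)).
  apply: eq_esum => -[r j] _ /=.
  have -> : (x + 2 * (r%:Z + N%:Z * j)%:~R * pi) / N%:R =
     branch N x r + 2 * j%:~R * pi.
    by rewrite /branch intrD intrM -!pmulrn; field; rewrite gt_eqF.
  by rewrite Vp.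
split => // [[r j] [r' j'] /set_mem[/= h _] /set_mem[/= h' _] /= e|j _].
  have jj : j = j' by nia.
  by move: e; rewrite jj => /addIr[->].
have Nz : (N%:Z != 0)%R by lia.
have r0 : (0 <= (j %% N%:Z)%Z)%R by rewrite modz_ge0.
have rN : ((j %% N%:Z)%Z < N%:Z)%R by rewrite ltz_pmod//; lia.
exists (`|(j %% N%:Z)%Z|%N, (j %/ N%:Z)%Z); first by split=> //=; lia.
by rewrite /= [RHS](divz_eq j N%:Z); lia.
Qed.

Definition window (y : R) : R := ((- pi <= y) && (y < pi))%:R.

Lemma Per_window x : Per window x = 1%E.
Proof.
have [j0 /andP[h1 h2]] := mod2pi (- pi) x.
have pi0 := pi_gt0 R.
have w0 y : 0 <= window y by rewrite ler0n.
apply/eqP; rewrite eq_le; apply/andP; split; last first.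
  apply: le_trans (@Per_ge window x [:: j0] w0 isT).
  by rewrite big_seq1 lee_fin /window h1 (_ : _ < pi)//; lra.
apply: Per_le => s us; rewrite (bigID (pred1 j0))/= [X in _ + X]big1 ?addr0.
  rewrite -big_filter; have [js|js] := boolP (j0 \in s).
    by rewrite filter_pred1_uniq// big_seq1 /window; case: (_ && _).
  rewrite (_ : [seq _ <- s | _] = [::]) ?big_nil//; apply/eqP.
  by rewrite -[_ == _]negbK -has_filter; apply/negP => /hasP[j + /eqP jj]; rewrite jj; exact/negP.
move=> j jj0; rewrite /window; apply/eqP; rewrite pnatr_eq0 eqb0; apply/negP.
move=> /andP[h3 h4]; move/eqP: jj0; apply.
have : -1 < (j - j0)%:~R :> R /\ (j - j0)%:~R < 1 :> R.
  by rewrite intrB; split; rewrite -(ltr_pM2r pi0); lra.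
rewrite -(intrN R 1) -[1]/(1%:~R) !ltr_int; lia.
Qed.

End Periodization.

(** * Affine changes of variables and periodized integrals *)

#[local] Instance lebesgue_ae_filter (R : realType) :
  Filter (nbhs (almost_everywhere (@lebesgue_measure R))) :=
  ae_filter_ringOfSetsType _.

Section Affine.
Variable R : realType.
Local Notation leb := (@lebesgue_measure R).
Local Open Scope ereal_scope.

Definition aff (a b x : R) : R := (a * x + b)%R.

Lemma measurable_aff a b : measurable_fun setT (aff a b).
Proof.
apply: measurable_funD => //; apply: measurable_funM => //.
Qed.

Lemma aff_preimage_itv (a b u v : R) : (0 < a)%R ->
  aff a b @^-1` `]u, v]%classic = `]((u - b) / a)%R, ((v - b) / a)%R]%classic.
Proof.
move=> a0; apply/seteqP; split => x /=; rewrite !in_itv /= /aff.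
  by rewrite ltr_pdivrMr// ler_pdivlMr// ltrBlDr lerBrDr [(x * a)%R]mulrC.
by rewrite ltr_pdivrMr// ler_pdivlMr// ltrBlDr lerBrDr [(x * a)%R]mulrC.
Qed.

(** Both sides are measures which agree on half-open intervals. *)
Lemma leb_aff (a b : R) (A : set R) : (0 < a)%R -> measurable A ->
  leb A = a%:E * leb (aff a b @^-1` A).
Proof.
move=> a0 mA.
have maff : measurable_fun [set: measurableTypeR R] (aff a b : _ -> measurableTypeR R).
  exact: measurable_aff.
pose mu := mscale (NngNum (ltW a0))
  (pushforward leb (aff a b : measurableTypeR R -> measurableTypeR R)).
have -> : a%:E * leb (aff a b @^-1` A) = mu maff A by [].
apply: lebesgue_measure_unique => // _ [[u v]] _ <-.
transitivity (a%:E * leb (aff a b @^-1` `]u, v]%classic)); last by [].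
rewrite aff_preimage_itv//.
rewrite !lebesgue_measure_itv /= !lte_fin.
rewrite ltr_pM2r ?invr_gt0// ltrD2r; case: ifP => _; last by rewrite mule0.
rewrite -!EFinB -EFinM; congr (_%:E); field; exact: lt0r_neq0.
Qed.

Lemma leb_affV (a b : R) (A : set R) : (0 < a)%R -> measurable A ->
  leb (aff a b @^-1` A) = (a^-1)%:E * leb A.
Proof.
by move=> a0 mA; rewrite (leb_aff b a0 mA) muleA -EFinM mulVf ?mul1e// gt_eqF.
Qed.

Lemma integral_aff (a b : R) (D : set R) (f : R -> \bar R) : (0 < a)%R -> measurable D ->
  measurable_fun D f -> (forall x, D x -> 0 <= f x) ->
  \int[leb]_(x in aff a b @^-1` D) f (aff a b x) = (a^-1)%:E * \int[leb]_(x in D) f x.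
Proof.
move=> a0 mD mf f0.
have maff : measurable_fun [set: measurableTypeR R] (aff a b : _ -> measurableTypeR R).
  exact: measurable_aff.
have f0' : {in D, forall y, 0 <= f y} by move=> y /set_mem; exact: f0.
rewrite -(@ge0_integral_pushforward _ _ (measurableTypeR R) (measurableTypeR R) R _ maff leb D f mD mf f0').
have ai0 : (0 <= a^-1)%R by rewrite invr_ge0 ltW.
rewrite -[RHS](ge0_integral_mscale leb mD (NngNum ai0) mf f0).
apply: eq_measure_integral => A mA _; exact: leb_affV.
Qed.

Lemma integral_affT (a b : R) (f : R -> \bar R) : (0 < a)%R ->
  measurable_fun setT f -> (forall x, 0 <= f x) ->
  \int[leb]_x f (aff a b x) = (a^-1)%:E * \int[leb]_x f x.
Proof.
by move=> a0 mf f0; rewrite -(integral_aff b)// preimage_setT.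
Qed.

Lemma ae_aff (a b : R) (P : R -> Prop) : (0 < a)%R ->
  {ae leb, forall x, P x} -> {ae leb, forall x, P (aff a b x)}.
Proof.
move=> a0 [A [mA A0 PA]]; exists (aff a b @^-1` A); split.
- by rewrite -[X in measurable X]setTI; apply: measurable_aff.
- by apply: etrans (leb_affV b a0 mA) _; rewrite A0 mule0.
- by move=> x /= nP; exact: PA.
Qed.

End Affine.

Section PeriodIntegral.
Variable R : realType.
Local Notation leb := (@lebesgue_measure R).
Local Open Scope ereal_scope.

Definition int_of_nat (n : nat) : int := if odd n then Negz n./2 else Posz n./2.

Lemma int_of_nat_bij : set_bij [set: nat] [set: int] int_of_nat.
Proof.
split => // [m n _ _|j _].
  rewrite /int_of_nat; case: ifP => om; case: ifP => on // [e].
    by rewrite -(odd_double_half m) -(odd_double_half n) om on e.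
  by rewrite -(odd_double_half m) -(odd_double_half n) om on e.
case: j => n.
  by exists n.*2 => //; rewrite /int_of_nat odd_double half_double.
by exists n.*2.+1 => //; rewrite /int_of_nat /= odd_double /= uphalf_double.
Qed.

Lemma Per_series (B : R -> R) x : (forall y, 0 <= B y)%R ->
  Per B x = \sum_(n <oo) (B (x + 2 * (int_of_nat n)%:~R * pi)%R)%:E.
Proof.
move=> B0; rewrite /Per (reindex_esum _ _ _ _ int_of_nat_bij) nneseries_esumT//.
by move=> n; rewrite lee_fin.
Qed.

Let cell (j : int) : set R := `[(2 * j%:~R * pi)%R, (2 * j%:~R * pi + 2 * pi)%R[.

Lemma measurable_Per (B : R -> R) : (forall y, 0 <= B y)%R -> measurable_fun setT B ->
  measurable_fun setT (Per B).
Proof.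
move=> B0 mB; rewrite (_ : Per B = fun x =>
   \sum_(n <oo | n \in xpredT) (B (x + 2 * (int_of_nat n)%:~R * pi)%R)%:E); last first.
  by apply/funext => x; rewrite Per_series.
apply: ge0_emeasurable_sum => [n x _ _|n _]; first by rewrite lee_fin.
apply/measurable_EFinP.
have := measurableT_comp mB (measurable_aff 1 (2 * (int_of_nat n)%:~R * pi)).
by congr measurable_fun; apply/funext => x /=; rewrite /aff mul1r.
Qed.

(** The line is the disjoint union of the cells [2 pi j, 2 pi (j + 1)[, and each
    of them is a translate of the first. *)
Lemma integral_Per (B : R -> R) : (forall y, 0 <= B y)%R -> measurable_fun setT B ->
  \int[leb]_x (B x)%:E = \int[leb]_(x in `[0%R, (2 * pi)%R]) Per B x.
Proof.
move=> B0 mB; have pi0 := pi_gt0 R.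
have cells : [set: R] = \bigcup_n cell (int_of_nat n).
  apply/esym; rewrite -subTset => x _.
  have [j /andP[h1 h2]] := mod2pi 0%R x.
  have [_ _ /(_ (- j)%R I)[n _ nj]] := int_of_nat_bij.
  by exists n => //; rewrite /cell nj /= in_itv /= mulrNz; apply/andP; split; lra.
have mcell j : measurable (cell j) by exact: measurable_itv.
rewrite cells ge0_integral_bigcup//; last 3 first.
- by rewrite -cells; apply/measurable_EFinP.
- by move=> x _; rewrite lee_fin.
- move=> m n _ _ [x [/=]]; rewrite /cell /= !in_itv /= => /andP[h1 h2] /andP[h3 h4].
  have [_ inj _] := int_of_nat_bij; apply: inj; rewrite ?in_setT//.
  have : (-1 < (int_of_nat m - int_of_nat n)%:~R :> R)%R /\ ((int_of_nat m - int_of_nat n)%:~R < 1 :> R)%R.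
    by rewrite intrB; split; rewrite -(ltr_pM2r pi0); lra.
  rewrite -(intrN R 1) -[1%R]/(1%:~R) !ltr_int; lia.
rewrite -(integral_itv_bndo_bndc (r := (2 * pi)%R)).
  transitivity (\int[leb]_(x in `[0%R, (2 * pi)%R[)
      \sum_(n <oo) (B (x + 2 * (int_of_nat n)%:~R * pi)%R)%:E); last first.
    by apply: eq_integral => x _; rewrite Per_series.
  rewrite integral_nneseries//; last 2 first.
  - move=> n; apply/measurable_EFinP/measurable_funTS.
    have := measurableT_comp mB (measurable_aff 1 (2 * (int_of_nat n)%:~R * pi)).
    by congr measurable_fun; apply/funext => x /=; rewrite /aff mul1r.
  - by move=> n x _; rewrite lee_fin.
  apply: eq_eseriesr => n _.
  set c := (2 * (int_of_nat n)%:~R * pi)%R.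
  have := @integral_aff R 1%R c (cell (int_of_nat n)) (EFin \o B) ltr01 (mcell _).
  rewrite invr1 mul1e /= => <-.
  - rewrite (_ : aff 1 c @^-1` _ = `[0%R, (2 * pi)%R[%classic).
      by apply: eq_integral => x _; rewrite /aff mul1r.
    rewrite /cell -/c.
    apply/seteqP; split => x /=; rewrite !in_itv /= /aff mul1r; move=> /andP[];
      by move=> ? ?; apply/andP; split; lra.
  - by apply/measurable_EFinP/measurable_funTS.
  - by move=> x _; rewrite lee_fin.
  exact: measurable_funTS (measurable_Per B0 mB).
by move=> k; exact: mcell.
Qed.

(** A periodic function F is the periodization of F times the window; so both
    sides are integrals over the line, where the Lebesgue measure is invariant
    under translation. *)
Lemma integral_period_shift (F : R -> R) (c : R) :
  measurable_fun setT F -> (forall x, 0 <= F x)%R ->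
  (forall x (j : int), F (x + 2 * j%:~R * pi) = F x)%R ->
  \int[leb]_(x in `[0%R, (2 * pi)%R]) (F (x + c)%R)%:E =
  \int[leb]_(x in `[0%R, (2 * pi)%R]) (F x)%:E.
Proof.
move=> mF F0 Fp.
pose B (d : R) (x : R) := (F (x + d) * window (x + d))%R.
have PerB d x : Per (B d) x = (F (x + d)%R)%:E.
  rewrite -[RHS]mule1 -(Per_window (x + d)%R) -PerZ//.
  by apply: eq_esum => j _; rewrite /B addrAC Fp.
have mw : measurable_fun setT (@window R).
  rewrite (_ : @window R = \1_(`[(- pi)%R, pi[%classic)); first exact: measurable_indic.
  by apply/funext => x; rewrite /window indicE mem_setE in_itv.
have B0 d y : (0 <= B d y)%R by rewrite mulr_ge0// /window ler0n.
have mB d : measurable_fun setT (B d).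
  have h := measurable_aff 1%R d.
  have := measurable_funM (measurableT_comp mF h) (measurableT_comp mw h).
  by congr measurable_fun; apply/funext => x; rewrite /B /= /aff mul1r.
have intB d : \int[leb]_(x in `[0%R, (2 * pi)%R]) (F (x + d)%R)%:E = \int[leb]_x (B d x)%:E.
  by rewrite integral_Per//; apply: eq_integral => x _; rewrite PerB.
transitivity (\int[leb]_(x in `[0%R, (2 * pi)%R]) (F (x + 0)%R)%:E); last first.
  by apply: eq_integral => x _; rewrite addr0.
rewrite !intB.
have := @integral_affT R 1%R c (EFin \o B 0%R) ltr01 _ _; rewrite invr1 mul1e => <-.
- by apply: eq_integral => x _ /=; rewrite /B /aff mul1r !addr0.
- exact/measurable_EFinP.
- by move=> x; rewrite lee_fin.
Qed.

End PeriodIntegral.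

(** * Complex integrals and square-integrable functions *)

Section CIntegral.
Variable R : realType.
Local Notation C := (R[i]).
Local Notation cRe := (@complex.Re R).
Local Notation cIm := (@complex.Im R).
Local Notation leb := (@lebesgue_measure R).
Implicit Types (f g : R -> C) (D : set R).

Definition cintegrable D f : Prop :=
  leb.-integrable D (EFin \o (cRe \o f)) /\ leb.-integrable D (EFin \o (cIm \o f)).

Lemma cmeasurable_cst (c : C) : cmeasurable (fun=> c).
Proof. by split; exact: measurable_cst. Qed.

Lemma cmeasurableD f g : cmeasurable f -> cmeasurable g ->
  cmeasurable (fun x => f x + g x).
Proof.
move=> mf mg; have := cmeasurable_linear 1 mf mg; congr cmeasurable.
by apply/funext => x; rewrite !fctE scale1r.
Qed.

Lemma cmeasurableN f : cmeasurable f -> cmeasurable (fun x => - f x).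
Proof.
move=> mf; have := cmeasurable_linear (-1) mf (cmeasurable_cst 0); congr cmeasurable.
by apply/funext => x; rewrite !fctE scaleN1r addr0.
Qed.

Lemma cmeasurableB f g : cmeasurable f -> cmeasurable g ->
  cmeasurable (fun x => f x - g x).
Proof. by move=> mf mg; apply: cmeasurableD => //; exact: cmeasurableN. Qed.

Lemma cmeasurableM f g : cmeasurable f -> cmeasurable g ->
  cmeasurable (fun x => f x * g x).
Proof.
move=> [fr fi] [gr gi]; split.
- rewrite (_ : _ \o _ = ((cRe \o f) \* (cRe \o g)) \- ((cIm \o f) \* (cIm \o g)))%R.
    by apply: measurable_funB; apply: measurable_funM.
  by apply/funext => x /=; case: (f x) (g x) => [a b] [c d].
- rewrite (_ : _ \o _ = ((cRe \o f) \* (cIm \o g)) \+ ((cIm \o f) \* (cRe \o g)))%R.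
    by apply: measurable_funD; apply: measurable_funM.
  by apply/funext => x /=; case: (f x) (g x) => [a b] [c d].
Qed.

Lemma cmeasurable_conj f : cmeasurable f -> cmeasurable (fun x => (f x)^*%C).
Proof.
move=> [fr fi]; split.
  by congr measurable_fun: fr; apply/funext => x /=; case: (f x).
rewrite (_ : _ \o _ = \- (cIm \o f))%R; first exact: measurable_funN.
by apply/funext => x /=; case: (f x).
Qed.

Lemma cmeasurable_real (F : R -> R) : measurable_fun setT F ->
  cmeasurable (fun x => (F x)%:C).
Proof. by move=> mF; split => //; exact: measurable_cst. Qed.

Lemma cmeasurable_comp (f : R -> C) (a : R -> R) : cmeasurable f ->
  measurable_fun setT a -> cmeasurable (fun x => f (a x)).
Proof.
by move=> [fr fi] ma; split; [exact: measurableT_comp fr ma|exact: measurableT_comp fi ma].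
Qed.

Lemma cmeasurable_aff (a b : R) f : cmeasurable f ->
  cmeasurable (fun x => f (aff a b x)).
Proof. by move=> mf; apply: (cmeasurable_comp mf); exact: measurable_aff. Qed.

Lemma measurable_modulus2 f : cmeasurable f ->
  measurable_fun setT (fun x => modulus (f x) ^+ 2).
Proof. by move=> mf; apply/measurable_EFinP; exact: cmeasurable_modulus2. Qed.

Lemma measurable_modulus f : cmeasurable f ->
  measurable_fun setT (fun x => modulus (f x)).
Proof.
move=> mf; have ms : measurable_fun setT (@Num.sqrt R).
  exact: continuous_measurable_fun (@sqrt_continuous R).
have := measurableT_comp ms (measurable_modulus2 mf).
by congr measurable_fun; apply/funext => x /=; rewrite sqrtr_sqr ger0_norm ?modulus_ge0.
Qed.

Lemma cmeasurable_continuous f : continuous (f : R -> C^o) -> cmeasurable f.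
Proof.
move=> cf; split; apply: continuous_measurable_fun => x.
- apply/cvgrPdist_lt => e e0.
  have /cvgrPdist_lt/(_ e%:C) := cf x; rewrite ltcR => /(_ e0).
  apply: filterS => y; rewrite /= modulusE ltcR; apply: le_lt_trans.
  by rewrite -raddfB Re_le_modulus.
- apply/cvgrPdist_lt => e e0.
  have /cvgrPdist_lt/(_ e%:C) := cf x; rewrite ltcR => /(_ e0).
  apply: filterS => y; rewrite /= modulusE ltcR; apply: le_lt_trans.
  by rewrite -raddfB Im_le_modulus.
Qed.

Lemma cmeasurable_inv f : cmeasurable f -> cmeasurable (fun x => (f x)^-1).
Proof.
move=> mf.
have mi : measurable_fun setT (fun x => (modulus (f x) ^+ 2)^-1).
  have := measurableT_comp (measurable_powR (R := R) (-1)) (measurable_modulus2 mf).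
  by congr measurable_fun; apply/funext => x /=; rewrite powR_inv1// sqr_ge0.
have := cmeasurableM (cmeasurable_conj mf) (cmeasurable_real mi).
congr cmeasurable; apply/funext => x.
have [->|fx0] := eqVneq (f x) 0; first by rewrite conjc0 mul0r invr0.
apply: (mulIf fx0); rewrite mulVf// mulrAC mul_conj_modulus fmorphV mulfV//.
by rewrite fmorph_eq0 sqrf_eq0 modulus_eq0.
Qed.

Lemma cintegral_linear D a f g : measurable D ->
  cintegrable D f -> cintegrable D g ->
  cintegral D (fun x => a * f x + g x) = a * cintegral D f + cintegral D g.
Proof.
move=> mD [fr fi] [gr gi]; case: a => a b.
have Zr c (h : R -> R) : leb.-integrable D (EFin \o h) ->
    leb.-integrable D (EFin \o (fun x => c * h x)).
  by move=> ih; apply: (integrableZl _ c ih).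
rewrite /cintegral; apply/eqP; rewrite eq_complex /=; apply/andP; split; apply/eqP.
- transitivity (\int[leb]_(x in D) ((a * cRe (f x) + (- b) * cIm (f x)) + cRe (g x))).
    apply: eq_Rintegral => x _; case: (f x) (g x) => [u v] [s t] /=; ring.
  rewrite RintegralD// ?RintegralD//.
  + by rewrite !RintegralZl// mulNr.
  + exact: Zr.
  + exact: Zr.
  + by apply: (integrableD _ (Zr a _ fr) (Zr (- b) _ fi)).
- transitivity (\int[leb]_(x in D) ((a * cIm (f x) + b * cRe (f x)) + cIm (g x))).
    apply: eq_Rintegral => x _; case: (f x) (g x) => [u v] [s t] /=; ring.
  rewrite RintegralD// ?RintegralD//.
  + by rewrite !RintegralZl//.
  + exact: Zr.
  + exact: Zr.
  + by apply: (integrableD _ (Zr a _ fi) (Zr b _ fr)).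
Qed.

Lemma Rintegral_ae (h k : R -> R) : measurable_fun setT h -> measurable_fun setT k ->
  {ae leb, forall x, h x = k x} -> \int[leb]_x h x = \int[leb]_x k x.
Proof.
move=> mh mk hk; congr fine; apply: ae_eq_integral => //; try exact/measurable_EFinP.
by apply: filterS hk => x /= -> _.
Qed.

Lemma cintegral_ae f g : cmeasurable f -> cmeasurable g ->
  {ae leb, forall x, f x = g x} -> cintegral setT f = cintegral setT g.
Proof.
move=> [fr fi] [gr gi] fg; rewrite /cintegral; congr (_ +i* _).
  by apply: (Rintegral_ae fr gr); apply: filterS fg => x /= ->.
by apply: (Rintegral_ae fi gi); apply: filterS fg => x /= ->.
Qed.

Lemma cintegral_conj f : cintegrable setT f ->
  cintegral setT (fun x => (f x)^*%C) = (cintegral setT f)^*%C.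
Proof.
move=> [fr fi]; rewrite /cintegral /=; congr (_ +i* _).
  by apply: eq_Rintegral => x _; case: (f x).
rewrite -mulN1r -RintegralZl//; apply: eq_Rintegral => x _.
by case: (f x) => a b /=; rewrite mulN1r.
Qed.

Lemma cintegral_real (F : R -> R) :
  cintegral setT (fun x => (F x)%:C) = (\int[leb]_x F x)%:C.
Proof.
rewrite /cintegral /real_complex_def; congr (_ +i* _).
by rewrite (@eq_Rintegral _ _ _ leb setT (cst 0)) ?Rintegral_cst ?mul0r.
Qed.

Lemma cintegrableP (D : set R) (f : R -> C) : measurable D -> cmeasurable f ->
  (\int[leb]_(x in D) (modulus (f x))%:E < +oo)%E -> cintegrable D f.
Proof.
move=> mD mf fo; have [mr mi] := mf.
have hm : leb.-integrable D (EFin \o (fun x => modulus (f x))).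
  apply/integrableP; split.
    by apply/measurable_EFinP; apply: measurable_funTS; exact: measurable_modulus.
  by move: fo; congr (_ < _)%E; apply: eq_integral => x _; rewrite [RHS]gee0_abs// lee_fin modulus_ge0.
split; apply: le_integrable hm => //; try by apply/measurable_EFinP; exact: measurable_funTS.
- by move=> x _ /=; rewrite lee_fin (ger0_norm (modulus_ge0 _)) Re_le_modulus.
- by move=> x _ /=; rewrite lee_fin (ger0_norm (modulus_ge0 _)) Im_le_modulus.
Qed.

Lemma cintegrable_linear (D : set R) (a : C) (f g : R -> C) : measurable D ->
  cintegrable D f -> cintegrable D g -> cintegrable D (fun x => a * f x + g x).
Proof.
move=> mD [fr fi] [gr gi]; case: a => a b.
have Zr c (h : R -> R) : leb.-integrable D (EFin \o h) ->
    leb.-integrable D (EFin \o (fun x => c * h x)).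
  by move=> ih; apply: (integrableZl _ c ih).
have Dr (h k : R -> R) : leb.-integrable D (EFin \o h) -> leb.-integrable D (EFin \o k) ->
    leb.-integrable D (EFin \o (fun x => h x + k x)).
  by move=> ih ik; apply: (integrableD _ ih ik).
split.
  have := Dr _ _ (Dr _ _ (Zr a _ fr) (Zr (- b) _ fi)) gr.
  apply: eq_integrable => // x _; rewrite /=; congr EFin.
  by case: (f x) (g x) => [u v] [s t] /=; ring.
have := Dr _ _ (Dr _ _ (Zr a _ fi) (Zr b _ fr)) gi.
apply: eq_integrable => // x _; rewrite /=; congr EFin.
by case: (f x) (g x) => [u v] [s t] /=; ring.
Qed.

Lemma cintegrable_cst0 (D : set R) : cintegrable D (fun=> 0).
Proof. by split; exact: integrable0. Qed.

Lemma cintegral_sum (D : set R) (I : finType) (a : I -> C) (F : I -> R -> C) : measurable D ->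
  (forall i, cintegrable D (F i)) ->
  cintegral D (fun x => \sum_i a i * F i x) = \sum_i a i * cintegral D (F i).
Proof.
move=> mD hF; suff h (r : seq I) : cintegrable D (fun x => \sum_(i <- r) a i * F i x) /\
    cintegral D (fun x => \sum_(i <- r) a i * F i x) = \sum_(i <- r) a i * cintegral D (F i).
  exact: (h (index_enum I)).2.
elim: r => [|i r [IH1 IH2]].
  under eq_fun do rewrite big_nil.
  rewrite big_nil; split; first exact: cintegrable_cst0.
  have z0 : \int[leb]_(x in D) (cst 0 x : R) = 0 by rewrite /Rintegral integral0.
  by apply/eqP; rewrite eq_complex; apply/andP; split; apply/eqP; exact: z0.
under eq_fun do rewrite big_cons.
by rewrite big_cons -IH2 -cintegral_linear//; split => //; exact: cintegrable_linear.
Qed.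

(** The positive and negative parts of the real and imaginary parts, indexed by
    the choice of Im or Re and by a sign: they reduce a linear statement on
    complex functions to nonnegative ones. *)
Definition part (i : bool * bool) (w : C) : R :=
  Num.max ((-1) ^+ i.2 * (if i.1 then complex.Im w else complex.Re w)) 0.

Definition part_coef (i : bool * bool) : C := (-1) ^+ i.2 * 'i ^+ i.1.

Lemma partE w : w = \sum_i part_coef i * (part i w)%:C.
Proof.
rewrite -(pair_big xpredT xpredT (fun a b => part_coef (a, b) * (part (a, b) w)%:C)) /=.
rewrite !big_bool /part_coef /part /= !expr1 !expr0 ?mulN1r ?mul1r ?mulr1.
have posE (a : R) : a = Num.max a 0 - Num.max (- a) 0.
  by rewrite /Num.max; case: ltP => h1; case: ltP => h2; lra.
case: w => a b /=; rewrite {1}(posE a) {1}(posE b).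
by apply/eqP; rewrite eq_complex /=; apply/andP; split; apply/eqP; ring.
Qed.

Lemma part_ge0 i w : 0 <= part i w.
Proof. by rewrite le_max lexx orbT. Qed.

Lemma part_le i w : `|part i w| <= modulus w.
Proof.
rewrite ger0_norm ?part_ge0// /part ge_max modulus_ge0 andbT.
rewrite (le_trans (ler_norm _))// normrM normrX normrN1 expr1n mul1r.
by case: ifP => _; rewrite ?Re_le_modulus ?Im_le_modulus.
Qed.

Lemma measurable_part i (f : R -> C) : cmeasurable f ->
  measurable_fun setT (fun x => part i (f x)).
Proof.
move=> [fr fi]; apply: measurable_maxr => //; apply: measurable_funM => //.
by case: (i.1).
Qed.

End CIntegral.

Section L2theory.
Variable R : realType.
Local Notation C := (R[i]).
Local Notation cRe := (@complex.Re R).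
Local Notation cIm := (@complex.Im R).
Local Notation leb := (@lebesgue_measure R).
Local Notation L2fun := (@L2fun R).
Implicit Types (f g : R -> C) (xi eta : L2 R).

Definition normsq f : \bar R := (\int[leb]_x (modulus (f x) ^+ 2)%:E)%E.

Lemma L2funP f : f \in L2fun <-> cmeasurable f /\ (normsq f < +oo)%E.
Proof. by split=> [/asboolP//|?]; apply/asboolP. Qed.

Lemma normsq_ge0 f : (0 <= normsq f)%E.
Proof. by apply: integral_ge0 => x _; rewrite lee_fin sqr_ge0. Qed.

Lemma normsq_ae f g : cmeasurable f -> cmeasurable g ->
  {ae leb, forall x, f x = g x} -> normsq f = normsq g.
Proof.
move=> mf mg fg; apply: ge0_ae_eq_integral => //.
- exact: cmeasurable_modulus2.
- exact: cmeasurable_modulus2.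
- by move=> x _; rewrite lee_fin sqr_ge0.
- by move=> x _; rewrite lee_fin sqr_ge0.
- by apply: filterS fg => x /= -> _.
Qed.

Lemma le_normsq f g : cmeasurable f -> cmeasurable g ->
  (forall x, modulus (f x) <= modulus (g x)) -> (normsq f <= normsq g)%E.
Proof.
move=> mf mg fg; apply: ge0_le_integral => //.
- by move=> x _; rewrite lee_fin sqr_ge0.
- exact: cmeasurable_modulus2.
- exact: cmeasurable_modulus2.
- by move=> x _; rewrite lee_fin lerXn2r ?nnegrE ?modulus_ge0.
Qed.

Lemma normsqD f g : cmeasurable f -> cmeasurable g ->
  (normsq (fun x => f x + g x)%R <= 2%:E * normsq f + 2%:E * normsq g)%E.
Proof.
move=> mf mg.
have m2 (c : R) (h : R -> C) : cmeasurable h ->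
    measurable_fun setT (fun x => c%:E * (modulus (h x) ^+ 2)%:E)%E.
  by move=> mh; apply: measurable_funeM; exact: cmeasurable_modulus2.
rewrite /normsq -!ge0_integralZl//; try exact: cmeasurable_modulus2;
  try by move=> x _; rewrite lee_fin sqr_ge0.
rewrite -ge0_integralD//; try exact: m2;
  try by move=> x _; rewrite -EFinM lee_fin mulr_ge0// sqr_ge0.
apply: ge0_le_integral => //.
- by move=> x _; rewrite lee_fin sqr_ge0.
- by apply: cmeasurable_modulus2; exact: cmeasurableD.
- by apply: emeasurable_funD; exact: m2.
- move=> x _; rewrite -!EFinM -EFinD lee_fin.
  by have := modulus2_linear 1 (f x) (g x); rewrite mul1r modulus1 expr1n mulr1.
Qed.

Lemma L2fun_meas f : f \in L2fun -> cmeasurable f.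
Proof. by move=> /L2funP[]. Qed.

Lemma L2fun_fin f : f \in L2fun -> normsq f \is a fin_num.
Proof. by move=> /L2funP[_ fo]; rewrite ge0_fin_numE ?normsq_ge0. Qed.

Lemma L2funD f g : f \in L2fun -> g \in L2fun -> (fun x => f x + g x) \in L2fun.
Proof.
move=> hf hg; apply/L2funP; split.
  by apply: cmeasurableD; exact: L2fun_meas.
rewrite (le_lt_trans (normsqD (L2fun_meas hf) (L2fun_meas hg)))//.
have /L2funP[_ ?] := hf; have /L2funP[_ ?] := hg.
by rewrite lte_add_pinfty// lte_mul_pinfty// ?lee_fin.
Qed.

Lemma normsqZ (c : C) f : cmeasurable f ->
  normsq (fun x => c * f x) = ((modulus c ^+ 2)%:E * normsq f)%E.
Proof.
move=> mf; rewrite /normsq -ge0_integralZl//.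
- by apply: eq_integral => x _; rewrite modulusM exprMn EFinM.
- exact: cmeasurable_modulus2.
- by move=> x _; rewrite lee_fin sqr_ge0.
- by rewrite lee_fin sqr_ge0.
Qed.

Lemma L2funZ (c : C) f : f \in L2fun -> (fun x => c * f x) \in L2fun.
Proof.
move=> hf; have mf := L2fun_meas hf; apply/L2funP; split.
  by apply: cmeasurableM => //; exact: cmeasurable_cst.
have /L2funP[_ ?] := hf.
by rewrite normsqZ// lte_mul_pinfty// ?lee_fin ?sqr_ge0.
Qed.

Lemma L2funB f g : f \in L2fun -> g \in L2fun -> (fun x => f x - g x) \in L2fun.
Proof.
move=> hf hg; have := L2funD hf (L2funZ (-1) hg).
rewrite (_ : (fun x => f x + _) = (fun x => f x - g x))//.
by apply/funext => x; rewrite mulN1r.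
Qed.

Lemma normsq_mul_le (F : R -> C) f (M : R) : cmeasurable F -> cmeasurable f ->
  {ae leb, forall x, modulus (F x) <= M} ->
  (normsq (fun x => F x * f x)%R <= (M ^+ 2)%:E * normsq f)%E.
Proof.
move=> mF mf FM; rewrite /normsq -ge0_integralZl//; first last.
- by rewrite lee_fin sqr_ge0.
- by move=> x _; rewrite lee_fin sqr_ge0.
- exact: cmeasurable_modulus2.
apply: ae_ge0_le_integral => //.
- by move=> x _; rewrite lee_fin sqr_ge0.
- by apply: cmeasurable_modulus2; exact: cmeasurableM.
- by move=> x _; rewrite -EFinM lee_fin mulr_ge0// sqr_ge0.
- by apply: measurable_funeM; exact: cmeasurable_modulus2.
apply: filterS FM => x FM _; rewrite -EFinM lee_fin modulusM exprMn.
rewrite ler_wpM2r ?sqr_ge0// lerXn2r ?nnegrE ?modulus_ge0//.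
exact: le_trans (modulus_ge0 _) FM.
Qed.

Lemma L2fun_mul (F : R -> C) f : Linf F -> f \in L2fun -> (fun x => F x * f x) \in L2fun.
Proof.
move=> [mF [M FM]] hf; have mf := L2fun_meas hf; apply/L2funP; split.
  exact: cmeasurableM.
rewrite (le_lt_trans (normsq_mul_le mF mf FM))//; have /L2funP[_ ?] := hf.
by rewrite lte_mul_pinfty// ?lee_fin ?sqr_ge0.
Qed.

Lemma L2fun_of_in xi : L2fun_of xi \in L2fun.
Proof. exact: (valP (repr xi)). Qed.

Lemma L2P xi eta : xi = eta <-> {ae leb, forall x, L2fun_of xi x = L2fun_of eta x}.
Proof. by rewrite -{1}[xi](@reprK _ (L2 R)) -{1}[eta](@reprK _ (L2 R)); exact: L2piP. Qed.

Lemma L2class_eqP f xi : f \in L2fun ->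
  {ae leb, forall x, f x = L2fun_of xi x} -> L2class f = xi.
Proof.
move=> hf fx; apply/L2P; apply: filterS2 (L2classE hf) fx => x /= ->; exact.
Qed.

Lemma L2fun_of_linear (a : C) xi eta : {ae leb, forall x,
  L2fun_of (a *: xi + eta) x = a * L2fun_of xi x + L2fun_of eta x}.
Proof.
have -> : a *: xi + eta = (\pi_(L2 R) (a *: repr xi + repr eta))%qT.
  rewrite L2pi_add -L2scale_pi !reprK //.
by apply: filterS (L2reprP (a *: repr xi + repr eta)) => x; rewrite /L2fun_of => ->.
Qed.

Lemma L2fun_ofD xi eta : {ae leb, forall x,
  L2fun_of (xi + eta) x = L2fun_of xi x + L2fun_of eta x}.
Proof.
by apply: filterS (L2fun_of_linear 1 xi eta) => x; rewrite scale1r mul1r.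
Qed.

Lemma L2fun_of0 : {ae leb, forall x, L2fun_of (0 : L2 R) x = 0}.
Proof.
have := L2fun_ofD 0 0; rewrite addr0; apply: filterS => x /eqP.
by rewrite -subr_eq0 opprD addrA subrr sub0r oppr_eq0 => /eqP.
Qed.

Lemma L2fun_ofZ (a : C) xi : {ae leb, forall x,
  L2fun_of (a *: xi) x = a * L2fun_of xi x}.
Proof.
have := L2fun_of_linear a xi 0; rewrite addr0.
by apply: filterS2 L2fun_of0 => x /= ->; rewrite addr0.
Qed.

Lemma L2fun_ofB xi eta : {ae leb, forall x,
  L2fun_of (xi - eta) x = L2fun_of xi x - L2fun_of eta x}.
Proof.
rewrite addrC -scaleN1r; apply: filterS (L2fun_of_linear (-1) eta xi) => x /= ->.
by rewrite mulN1r addrC.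
Qed.

Lemma cintegrable_dot f g : f \in L2fun -> g \in L2fun ->
  cintegrable setT (fun x => (f x)^*%C * g x).
Proof.
move=> hf hg; have mf := L2fun_meas hf; have mg := L2fun_meas hg.
have [mr mi] := cmeasurableM (cmeasurable_conj mf) mg.
have dom (h : R -> C) : h \in L2fun ->
    leb.-integrable setT (EFin \o (fun x => modulus (h x) ^+ 2)).
  move=> hh; apply/integrableP; split.
    exact: cmeasurable_modulus2 (L2fun_meas hh).
  have /L2funP[_] := hh; congr (_ < _)%E.
  by apply: eq_integral => x _; rewrite [RHS]gee0_abs// lee_fin sqr_ge0.
have hd := integrableD measurableT (dom _ hf) (dom _ hg).
have le x : modulus ((f x)^*%C * g x) <= `|modulus (f x) ^+ 2 + modulus (g x) ^+ 2|.
  rewrite ger0_norm ?addr_ge0 ?sqr_ge0// modulusM modulus_conj.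
  have := modulus_ge0 (f x); have := modulus_ge0 (g x); nra.
split; apply: le_integrable hd => //; try exact/measurable_EFinP.
- by move=> x _ /=; rewrite lee_fin (le_trans _ (le x))// Re_le_modulus.
- by move=> x _ /=; rewrite lee_fin (le_trans _ (le x))// Im_le_modulus.
Qed.

Definition dotf f g : C := ((2 * pi)^-1)%:C * cintegral setT (fun x => (f x)^*%C * g x).

Lemma dotf_ae f f' g g' : f \in L2fun -> f' \in L2fun -> g \in L2fun -> g' \in L2fun ->
  {ae leb, forall x, f x = f' x} -> {ae leb, forall x, g x = g' x} ->
  dotf f g = dotf f' g'.
Proof.
move=> /L2fun_meas mf /L2fun_meas mf' /L2fun_meas mg /L2fun_meas mg' ff gg.
congr (_ * _); apply: cintegral_ae; try by apply: cmeasurableM => //; exact: cmeasurable_conj.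
by apply: filterS2 ff gg => x /= -> ->.
Qed.

Lemma L2dotE xi eta f g : f \in L2fun -> g \in L2fun ->
  {ae leb, forall x, L2fun_of xi x = f x} -> {ae leb, forall x, L2fun_of eta x = g x} ->
  L2dot xi eta = dotf f g.
Proof. by move=> hf hg; apply: dotf_ae => //; exact: L2fun_of_in. Qed.

Lemma dotf_normsq f : f \in L2fun ->
  dotf f f = ((2 * pi)^-1 * fine (normsq f))%:C.
Proof.
move=> hf; rewrite /dotf rmorphM /=; congr (_ * _).
rewrite (_ : (fun x => _) = (fun x => (modulus (f x) ^+ 2)%:C)).
  exact: cintegral_real.
by apply/funext => x; rewrite mul_conj_modulus.
Qed.

Lemma L2dot_normsq xi : L2dot xi xi = ((2 * pi)^-1 * fine (normsq (L2fun_of xi)))%:C.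
Proof. exact: dotf_normsq (L2fun_of_in xi). Qed.

Lemma L2dot_linear xi : scalar (L2dot xi).
Proof.
move=> a eta zeta.
have hx := L2fun_of_in xi; have he := L2fun_of_in eta; have hz := L2fun_of_in zeta.
rewrite (L2dotE (f := L2fun_of xi) (g := fun x => a * L2fun_of eta x + L2fun_of zeta x))//.
- rewrite /L2dot /dotf mulrCA -mulrDr; congr (_ * _).
  rewrite -cintegral_linear//; try exact: cintegrable_dot.
  by congr cintegral; apply/funext => x; rewrite mulrDr mulrCA.
- exact: L2funD (L2funZ a he) hz.
- exact: aeW.
- exact: L2fun_of_linear.
Qed.

Lemma L2dot_conj xi eta : L2dot eta xi = (L2dot xi eta)^*%C.
Proof.
have cM (u v : C) : (u * v)^*%C = u^*%C * v^*%C by exact: rmorphM.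
rewrite /L2dot cM conjc_real -cintegral_conj; last first.
  by apply: cintegrable_dot; exact: L2fun_of_in.
by congr (_ * cintegral _ _); apply/funext => x; rewrite rmorphM /= conjcK mulrC.
Qed.

Lemma twopiV_gt0 : 0 < (2 * pi)^-1 :> R.
Proof. by rewrite invr_gt0 mulr_gt0// pi_gt0. Qed.

Lemma L2dot_ge0 xi : 0 <= L2dot xi xi.
Proof.
rewrite L2dot_normsq ler0c mulr_ge0 ?(ltW twopiV_gt0)// fine_ge0// normsq_ge0//.
Qed.

Lemma normsq_eq0 f : cmeasurable f -> normsq f = 0%E -> {ae leb, forall x, f x = 0}.
Proof.
move=> mf f0.
have : (\int[leb]_x `|(modulus (f x) ^+ 2)%:E| = 0)%E.
  rewrite -[RHS]f0; apply: eq_integral => x _; rewrite gee0_abs// lee_fin sqr_ge0//.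
move=> /ae_eq_integral_abs-/(_ measurableT (cmeasurable_modulus2 mf)).
apply: filterS => x /(_ I) /= [] /eqP; rewrite sqrf_eq0 modulus_eq0 => /eqP//.
Qed.

Lemma L2dot_eq0 xi : L2dot xi xi = 0 -> xi = 0.
Proof.
rewrite L2dot_normsq => /complexI/eqP; rewrite mulf_eq0 gt_eqF ?twopiV_gt0//=.
rewrite fine_eq0 ?L2fun_fin ?L2fun_of_in// => /eqP/normsq_eq0 h; apply/L2P.
have mx := L2fun_meas (L2fun_of_in xi).
by apply: filterS2 (h mx) L2fun_of0 => x /= -> ->.
Qed.

End L2theory.

(** * Completeness of L^2(R) *)

Section L2complete.
Variable R : realType.
Local Notation C := (R[i]).
Local Notation cRe := (@complex.Re R).
Local Notation cIm := (@complex.Im R).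
Local Notation leb := (@lebesgue_measure R).
Local Notation L2fun := (@L2fun R).

Lemma cvgC_modulus2 (u : nat -> C) (l : C) :
  (forall e : R, 0 < e -> exists n0, forall n, (n0 <= n)%N -> modulus (u n - l) < e) ->
  forall a : C, (fun n => (modulus (a - u n) ^+ 2)) @ \oo --> modulus (a - l) ^+ 2.
Proof.
move=> ul a.
have h : (fun n => modulus (a - u n)) @ \oo --> modulus (a - l).
  apply/cvgRP => e e0; have [n0 hn0] := ul e e0; exists n0 => n n0n.
  rewrite (le_lt_trans (modulus_dist _ _))//.
  rewrite (_ : _ - (a - l) = - (u n - l)); first by rewrite modulusN hn0.
  by rewrite !opprB addrC addrA subrK.
rewrite (_ : (fun n => _ ^+ 2) = (fun n => modulus (a - u n) * modulus (a - u n))).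
  by rewrite expr2; exact: cvgM.
by apply/funext => n; rewrite expr2.
Qed.

(** The Riesz--Fischer argument.  Along a subsequence whose increments d_k have
    squared norm at most 8^-k, the sum of the 4^k |d_k|^2 is integrable, so that
    it is finite almost everywhere and the increments decrease geometrically
    there.  The pointwise limit g is the limit in the norm by Fatou's lemma. *)
Lemma L2fun_complete (f : nat -> R -> C) : (forall n, f n \in L2fun) ->
  (forall e : R, 0 < e -> exists n0, forall m n, (n0 <= m)%N -> (n0 <= n)%N ->
     (normsq (fun x => f m x - f n x)%R <= e%:E)%E) ->
  exists2 g, g \in L2fun & forall e : R, 0 < e -> exists n0, forall n, (n0 <= n)%N ->
     (normsq (fun x => f n x - g x)%R <= e%:E)%E.
Proof.
move=> fL fC.
have mf n : cmeasurable (f n) := L2fun_meas (fL n).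
have /choice[N0 hN0] : forall k : nat, exists n0, forall m n, (n0 <= m)%N -> (n0 <= n)%N ->
     (normsq (fun x => f m x - f n x)%R <= ((8 ^+ k)^-1)%:E)%E.
  by move=> k; apply: fC; rewrite invr_gt0 exprn_gt0.
pose nk (k : nat) := (\sum_(i < k.+1) N0 i + k)%N.
have N0nk k : (N0 k <= nk k)%N by rewrite /nk big_ord_recr /=; lia.
have nkS k : (nk k <= nk k.+1)%N by rewrite /nk (big_ord_recr k.+1) /=; lia.
pose d k x := f (nk k.+1) x - f (nk k) x.
have md k : cmeasurable (d k) by apply: cmeasurableB.
have dle k : (normsq (d k) <= ((8 ^+ k)^-1)%:E)%E.
  by apply: hN0; rewrite ?(leq_trans (N0nk k))//.
pose S x := (\sum_(k <oo) ((4 ^+ k)%:E * (modulus (d k x) ^+ 2)%:E))%E.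
have term0 k x : (0 <= (4 ^+ k)%:E * (modulus (d k x) ^+ 2)%:E)%E.
  by apply: mule_ge0; rewrite lee_fin ?sqr_ge0// exprn_ge0.
have mterm k : measurable_fun setT (fun x => (4 ^+ k)%:E * (modulus (d k x) ^+ 2)%:E)%E.
  by apply: measurable_funeM; exact: cmeasurable_modulus2.
have mS : measurable_fun setT S.
  by apply: (@ge0_emeasurable_sum _ _ _ setT _ xpredT).
have intS : (\int[leb]_x S x < +oo)%E.
  rewrite integral_nneseries//.
  apply: (@le_lt_trans _ _ (\sum_(k <oo) ((2^-1) ^+ k)%:E)%E).
    apply: lee_nneseries => k _.
      by move=> _; apply: integral_ge0 => x _; exact: term0.
    rewrite ge0_integralZl ?lee_fin ?exprn_ge0//; last 2 first.
    - exact: cmeasurable_modulus2.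
    - by move=> x _; rewrite lee_fin sqr_ge0.
    apply: (@le_trans _ _ ((4 ^+ k)%:E * ((8 ^+ k)^-1)%:E)%E).
      by apply: lee_wpmul2l; [rewrite lee_fin exprn_ge0|exact: dle].
    rewrite -EFinM lee_fin -exprVn -exprMn.
    by rewrite (_ : 4 / 8 = 2^-1 :> R)//; field.
  have geo n : (\sum_(0 <= k < n) ((2^-1) ^+ k)%:E <= 2%:E :> \bar R)%E.
    rewrite sumEFin lee_fin.
    have -> : \sum_(0 <= k < n) (2^-1) ^+ k = 2 - 2 * (2^-1) ^+ n :> R.
      elim: n => [|n IH]; first by rewrite big_geq// expr0 mulr1 subrr.
      by rewrite big_nat_recr//= IH exprS; field.
    by rewrite gerBl mulr_ge0// exprn_ge0.
  apply: (@le_lt_trans _ _ 2%:E); last exact: ltry.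
  apply: lime_le; last exact: nearW.
  by apply: is_cvg_nneseries => k _ _; rewrite lee_fin exprn_ge0.
have S0 x : (0 <= S x)%E by apply: nneseries_ge0 => k _ _; exact: term0.
pose A := [set x | (S x < +oo)%E].
have mA : measurable A.
  have := emeasurable_fun_infty_o measurableT mS +oo%E.
  by rewrite setTI.
have aeA : {ae leb, forall x, A x}.
  have iS : leb.-integrable setT S.
    apply/integrableP; split => //.
    by under eq_integral do rewrite gee0_abs//.
  have := integrable_ae measurableT iS; apply: filterS => x /(_ I).
  by rewrite /A /= ge0_fin_numE.
(* Setting the terms to 0 off A makes the subsequence converge everywhere. *)
pose v k x := (\1_A x)%:C * f (nk k) x.
have mv k : cmeasurable (v k).
  apply: cmeasurableM => //; apply: cmeasurable_real; exact: measurable_indic.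
have /choice[g hg] : forall x, exists l : C, forall e : R, 0 < e -> exists n0, forall n,
    (n0 <= n)%N -> modulus (v n x - l) < e.
  move=> x; have [xA|xA] := pselect (A x); last first.
    by exists 0 => e e0; exists 0%N => n _; rewrite /v indicE memNset// mul0r subrr modulus0.
  have vE k : v k x = f (nk k) x by rewrite /v indicE mem_set// mul1r.
  pose s := fine (S x).
  have sE : S x = s%:E by rewrite fineK// ge0_fin_numE.
  have s0 : 0 <= s by rewrite fine_ge0.
  have dk k : modulus (v k.+1 x - v k x) <= (2 * Num.sqrt s) / 2 ^+ k.+1.
    rewrite !vE -/(d k x) exprS invfM mulrACA divff// mul1r.
    rewrite ler_pdivlMr ?exprn_gt0// -(@ler_pXn2r _ 2) ?nnegrE ?sqrtr_ge0 ?mulr_ge0 ?modulus_ge0 ?exprn_ge0//.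
    rewrite sqr_sqrtr// exprMn -exprM mulnC exprM (_ : 2 ^+ 2 = 4 :> R); last by rewrite expr2; ring.
    rewrite mulrC -lee_fin -sE EFinM.
    have := @nneseries_lim_ge _ (fun k => (4 ^+ k)%:E * (modulus (d k x) ^+ 2)%:E)%E xpredT 0 k.+1.
    move=> /(_ (fun k _ _ => term0 k x)); apply: le_trans.
    rewrite big_nat_recr//= leeDr// sume_ge0//.
  have [l hl] := geom_cauchyC dk; exists l => e e0.
  have [n0 hn0] := le_half_pow (2 * Num.sqrt s) e0.
  by exists n0 => n n0n; rewrite (le_lt_trans (hl n))// hn0.
have mg : cmeasurable g.
  split.
  - apply: (measurable_fun_cvg (h := fun k x => cRe (v k x))).
      by move=> k; have [] := mv k.
    move=> x _; apply/cvgRP => e e0; have [n0 hn0] := hg x e e0; exists n0 => n n0n.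
    by rewrite (le_lt_trans _ (hn0 n n0n))// -raddfB Re_le_modulus.
  - apply: (measurable_fun_cvg (h := fun k x => cIm (v k x))).
      by move=> k; have [] := mv k.
    move=> x _; apply/cvgRP => e e0; have [n0 hn0] := hg x e e0; exists n0 => n n0n.
    by rewrite (le_lt_trans _ (hn0 n n0n))// -raddfB Im_le_modulus.
have fatou_bound e m : (exists n0, forall n, (n0 <= n)%N ->
    (normsq (fun x => f m x - f n x)%R <= e%:E)%E) ->
    (normsq (fun x => f m x - g x)%R <= e%:E)%E.
  move=> [n0 hn0].
  have mh k : measurable_fun setT (fun x => (modulus (f m x - v (k + n0)%N x) ^+ 2)%:E).
    by apply: cmeasurable_modulus2; exact: cmeasurableB.
  have h0 k x : setT x -> (0 <= (modulus (f m x - v (k + n0)%N x) ^+ 2)%:E)%E.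
    by move=> _; rewrite lee_fin sqr_ge0.
  have := fatou leb measurableT mh h0.
  rewrite (_ : (\int[leb]_(x in setT) _)%E = normsq (fun x => f m x - g x)); last first.
    apply: eq_integral => x _.
    have hgx : forall e : R, 0 < e -> exists n1, forall n, (n1 <= n)%N ->
        modulus (v (n + n0)%N x - g x) < e.
      move=> e' e'0; have [n1 hn1] := hg x e' e'0; exists n1 => n n1n.
      by apply: hn1; lia.
    have hc : ((modulus (f m x - v (k + n0)%N x) ^+ 2)%:E @[k --> \oo] -->
        (modulus (f m x - g x) ^+ 2)%:E).
      by apply: cvg_EFin; [exact: nearW|exact: (cvgC_modulus2 hgx)].
    by have [] := cvg_limn_einf_sup hc.
  move=> /le_trans; apply; rewrite limn_einf_lim.
  apply: lime_le; first exact: is_cvg_einfs.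
  apply: nearW => k.
  apply: (@le_trans _ _ (normsq (fun x => f m x - v (k + n0)%N x))).
    by apply: ereal_inf_lbound; exists k => //=.
  rewrite (@normsq_ae _ _ (fun x => f m x - f (nk (k + n0)%N) x)).
  - by apply: hn0; rewrite /nk; lia.
  - exact: cmeasurableB.
  - exact: cmeasurableB.
  - by apply: filterS aeA => x xA; rewrite /v indicE mem_set// mul1r.
have hlim (e : R) : 0 < e -> exists n0, forall n, (n0 <= n)%N ->
     (normsq (fun x => f n x - g x)%R <= e%:E)%E.
  move=> e0; have [n0 hn0] := fC e e0; exists n0 => m n0m.
  by apply: fatou_bound; exists n0 => n n0n; exact: hn0.
exists g => //; have [n0 hn0] := hlim 1 ltr01.
have fgL : (fun x => f n0 x - g x) \in L2fun.
  apply/L2funP; split; first exact: cmeasurableB.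
  by rewrite (le_lt_trans (hn0 n0 (leqnn _)))// ltry.
have := L2funB (fL n0) fgL.
rewrite (_ : (fun x => _) = g)//; apply/funext => x.
by rewrite opprB addrC subrK.
Qed.

End L2complete.

(** * The Hilbert space L^2(R)^p *)

Section Hilbert.
Variables (R : realType) (p : nat).
Local Notation C := (R[i]).
Local Notation leb := (@lebesgue_measure R).
Local Notation dot := (@L2pdot R p).
Local Notation norm := (hnorm dot).
Implicit Types xi eta : L2p R p.

Definition nsq xi : R := \sum_k fine (normsq (L2fun_of (xi k))).

Lemma fine_normsq_ge0 (f : R -> C) : 0 <= fine (normsq f).
Proof. by rewrite fine_ge0// normsq_ge0. Qed.

Lemma nsq_ge0 xi : 0 <= nsq xi.
Proof. by apply: sumr_ge0 => k _; exact: fine_normsq_ge0. Qed.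

Lemma le_nsq k xi : fine (normsq (L2fun_of (xi k))) <= nsq xi.
Proof.
rewrite /nsq (bigD1 k)//= lerDl; apply: sumr_ge0 => j _; exact: fine_normsq_ge0.
Qed.

Lemma L2pdot_nsq xi : dot xi xi = ((2 * pi)^-1 * nsq xi)%:C.
Proof.
rewrite /nsq mulr_sumr rmorph_sum; apply: eq_bigr => k _; exact: L2dot_normsq.
Qed.

Lemma hnorm_sq xi : norm xi ^+ 2 = (2 * pi)^-1 * nsq xi.
Proof.
by rewrite /hnorm sqr_sqrtr L2pdot_nsq//= mulr_ge0 ?nsq_ge0// ltW// twopiV_gt0.
Qed.

Lemma hnorm_ge0 xi : 0 <= norm xi.
Proof. exact: sqrtr_ge0. Qed.

Lemma nsq_hnorm xi : nsq xi = 2 * pi * norm xi ^+ 2.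
Proof.
rewrite hnorm_sq mulrA divff ?mul1r//.
by rewrite mulf_neq0// gt_eqF// pi_gt0.
Qed.

Lemma hnorm_lt xi (e : R) : 0 < e -> (norm xi < e) = (nsq xi < 2 * pi * e ^+ 2).
Proof.
move=> e0; rewrite nsq_hnorm ltr_pM2l ?mulr_gt0 ?pi_gt0//.
by rewrite ltr_pXn2r ?nnegrE ?hnorm_ge0// ltW.
Qed.

Lemma L2pdot_linear xi : scalar (dot xi).
Proof.
move=> a eta zeta; rewrite /L2pdot mulr_sumr -big_split /=; apply: eq_bigr => k _.
by rewrite !ffunE L2dot_linear.
Qed.

Lemma L2pdot_conj xi eta : dot eta xi = (dot xi eta)^*%C.
Proof. rewrite /L2pdot rmorph_sum; apply: eq_bigr => k _; exact: L2dot_conj. Qed.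

Lemma L2pdot_ge0 xi : 0 <= dot xi xi.
Proof. by apply: sumr_ge0 => k _; exact: L2dot_ge0. Qed.

Lemma nsq_eq0 xi : nsq xi = 0 -> xi = 0.
Proof.
move=> /eqP; rewrite psumr_eq0; last by move=> *; exact: fine_normsq_ge0.
move=> /allP h; apply/ffunP => k; rewrite ffunE; apply: L2dot_eq0.
have /eqP := h k (mem_index_enum k); rewrite L2dot_normsq => ->.
by rewrite mulr0.
Qed.

Lemma L2pdot_eq0 xi : dot xi xi = 0 -> xi = 0.
Proof.
rewrite L2pdot_nsq => /complexI/eqP.
by rewrite mulf_eq0 gt_eqF ?twopiV_gt0//= => /eqP/nsq_eq0.
Qed.

Lemma normsqB_of (xi eta : L2 R) : normsq (L2fun_of (xi - eta)) =
  normsq (fun x => L2fun_of xi x - L2fun_of eta x).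
Proof.
apply: normsq_ae; last exact: L2fun_ofB.
  exact: L2fun_meas (L2fun_of_in _).
by apply: cmeasurableB; exact: L2fun_meas (L2fun_of_in _).
Qed.

Lemma normsq_class (f : R -> C) : f \in @L2fun R -> normsq (L2fun_of (L2class f)) = normsq f.
Proof.
move=> hf; apply: normsq_ae; last exact: L2classE.
  exact: L2fun_meas (L2fun_of_in _).
exact: L2fun_meas.
Qed.

Lemma normsqB_class (xi : L2 R) (f : R -> C) : f \in @L2fun R ->
  normsq (L2fun_of (xi - L2class f)) = normsq (fun x => L2fun_of xi x - f x).
Proof.
move=> hf; rewrite normsqB_of; apply: normsq_ae; last first.
- by apply: filterS (L2classE hf) => x ->.
- by apply: cmeasurableB; apply: L2fun_meas => //; exact: L2fun_of_in.
- by apply: cmeasurableB; exact: L2fun_meas (L2fun_of_in _).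
Qed.

Lemma L2p_complete (u : nat -> L2p R p) :
  (forall e : R, 0 < e -> exists n0, forall m n,
    (n0 <= m)%N -> (n0 <= n)%N -> norm (u m - u n) < e) ->
  exists l, forall e : R, 0 < e -> exists n0, forall n,
    (n0 <= n)%N -> norm (u n - l) < e.
Proof.
move=> hu.
have /choice[g hg] : forall k : 'I_p, exists g, g \in @L2fun R /\
    forall e : R, 0 < e -> exists n0, forall n, (n0 <= n)%N ->
     (normsq (fun x => L2fun_of (u n k) x - g x)%R <= e%:E)%E.
  move=> k; have [||g gL gP] := @L2fun_complete R (fun n => L2fun_of (u n k)).
  - by move=> n; exact: L2fun_of_in.
  - move=> e e0; have e1 : 0 < Num.sqrt (e / (2 * pi)).
      by rewrite sqrtr_gt0 divr_gt0// mulr_gt0// pi_gt0.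
    have [n0 hn0] := hu _ e1; exists n0 => m n n0m n0n.
    have := hn0 m n n0m n0n; rewrite hnorm_lt// sqr_sqrtr; last first.
      by rewrite divr_ge0 ?mulr_ge0 ?pi_ge0// ltW.
    rewrite mulrC divfK; last by rewrite mulf_neq0// gt_eqF// pi_gt0.
    move=> /ltW/(le_trans (le_nsq k _)); rewrite -lee_fin fineK ?L2fun_fin ?L2fun_of_in//.
    by rewrite !ffunE normsqB_of.
  - by exists g.
exists [ffun k => L2class (g k)] => e e0.
have pi0 := pi_gt0 R.
pose d := pi * e ^+ 2 / p.+1%:R.
have d0 : 0 < d by rewrite divr_gt0// mulr_gt0// exprn_gt0.
have /choice[n0 hn0] := fun k => (hg k).2 d d0.
exists (\max_k n0 k)%N => n hn; rewrite hnorm_lt//.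
apply: (@le_lt_trans _ _ (\sum_(k < p) d)).
  apply: ler_sum => k _; rewrite -lee_fin fineK ?L2fun_fin ?L2fun_of_in//.
  rewrite !ffunE normsqB_class; last exact: (hg k).1.
  by apply: hn0; rewrite (leq_trans _ hn)// leq_bigmax.
have -> : \sum_(k < p) d = d * p%:R by rewrite sumr_const card_ord mulr_natr.
rewrite /d mulrAC ltr_pdivrMr//.
have : p%:R < 2 * p.+1%:R :> R by rewrite -natrM ltr_nat; lia.
have : 0 < pi * e ^+ 2 by rewrite mulr_gt0// exprn_gt0.
rewrite -(mulrA 2 pi); move: (pi * _) (p%:R : R) (p.+1%:R : R) => a b c a0 bc; nra.
Qed.

Lemma L2p_hilbert : hilbert dot.
Proof.
split.
- exact: L2pdot_linear.
- exact: L2pdot_conj.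
- exact: L2pdot_ge0.
- exact: L2pdot_eq0.
- exact: L2p_complete.
Qed.

Lemma L2pdot_injr xi eta : (forall zeta, dot zeta xi = dot zeta eta) -> xi = eta.
Proof.
move=> h; apply/eqP; rewrite -subr_eq0; apply/eqP/L2pdot_eq0.
have := L2pdot_linear (xi - eta) (-1) eta xi.
by rewrite scaleN1r (addrC (- eta)) h mulN1r addNr.
Qed.

Lemma adjoint_uniq (U V V' : L2p R p -> L2p R p) :
  adjoint dot U V -> adjoint dot U V' -> V =1 V'.
Proof. by move=> h h' x; apply: L2pdot_injr => y; rewrite -h -h'. Qed.

Lemma nsqZ (a : C) xi : nsq (a *: xi) = modulus a ^+ 2 * nsq xi.
Proof.
rewrite /nsq mulr_sumr; apply: eq_bigr => k _; rewrite ffunE.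
rewrite (@normsq_ae _ _ (fun x => a * L2fun_of (xi k) x)).
- rewrite normsqZ; last exact: L2fun_meas (L2fun_of_in _).
  by rewrite fineM// L2fun_fin// L2fun_of_in.
- exact: L2fun_meas (L2fun_of_in _).
- by apply: cmeasurableM; [exact: cmeasurable_cst|exact: L2fun_meas (L2fun_of_in _)].
- exact: L2fun_ofZ.
Qed.

Lemma nsqBC xi eta : nsq (xi - eta) = nsq (eta - xi).
Proof.
have -> : xi - eta = -1 *: (eta - xi) by rewrite scaleN1r opprB.
by rewrite nsqZ modulusN modulus1 expr1n mul1r.
Qed.

Lemma nsqD xi eta : nsq (xi + eta) <= 2 * nsq xi + 2 * nsq eta.
Proof.
rewrite /nsq !mulr_sumr -big_split /=; apply: ler_sum => k _; rewrite ffunE.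
have [hx he] := (L2fun_of_in (xi k), L2fun_of_in (eta k)).
rewrite -lee_fin EFinD !EFinM !fineK ?L2fun_fin ?L2fun_of_in//.
rewrite (@normsq_ae _ _ (fun x => L2fun_of (xi k) x + L2fun_of (eta k) x)).
- by apply: normsqD; exact: L2fun_meas.
- exact: L2fun_meas (L2fun_of_in _).
- by apply: cmeasurableD; exact: L2fun_meas.
- exact: L2fun_ofD.
Qed.

End Hilbert.

(** * Multiplication operators and the unitary U_C *)

Section Operators.
Variables (R : realType) (p : nat).
Local Notation C := (R[i]).
Local Notation leb := (@lebesgue_measure R).
Local Notation L2fun := (@L2fun R).
Local Notation dot := (@L2pdot R p).
Local Notation norm := (hnorm dot).
Implicit Types (xi eta : L2p R p) (F G : 'I_p -> R -> C).

Lemma normsq_aff (a b : R) (f : R -> C) : 0 < a -> cmeasurable f ->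
  normsq (fun x => f (aff a b x)) = ((a^-1)%:E * normsq f)%E.
Proof.
move=> a0 mf; rewrite /normsq.
rewrite -(integral_affT (f := fun x => (modulus (f x) ^+ 2)%:E) b a0)//.
- exact: cmeasurable_modulus2.
- by move=> x; rewrite lee_fin sqr_ge0.
Qed.

Lemma L2fun_aff (a b : R) (f : R -> C) : 0 < a -> f \in L2fun ->
  (fun x => f (aff a b x)) \in L2fun.
Proof.
move=> a0 hf; have mf := L2fun_meas hf; apply/L2funP; split.
  exact: cmeasurable_aff.
have /L2funP[_ ?] := hf.
by rewrite normsq_aff// lte_mul_pinfty// ?lee_fin ?invr_ge0 ?ltW.
Qed.

Lemma L2p_ext xi eta : (forall k, {ae leb, forall x,
  L2fun_of (xi k) x = L2fun_of (eta k) x}) -> xi = eta.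
Proof. by move=> h; apply/ffunP => k; apply/L2P. Qed.

Lemma L2p_linear_ae (a : C) xi eta k : {ae leb, forall x,
  L2fun_of ((a *: xi + eta) k) x = a * L2fun_of (xi k) x + L2fun_of (eta k) x}.
Proof. by rewrite !ffunE; exact: L2fun_of_linear. Qed.

(** ** Diagonal multiplication operators *)

Lemma diag_opE F xi k : (forall k, Linf (F k)) ->
  {ae leb, forall x, L2fun_of (diag_op F xi k) x = F k x * L2fun_of (xi k) x}.
Proof.
move=> hF; rewrite ffunE; apply: L2classE.
by apply: L2fun_mul => //; exact: L2fun_of_in.
Qed.

Lemma diag_op_eq F G xi : (forall k, Linf (F k)) -> (forall k, Linf (G k)) ->
  (forall k, {ae leb, forall x, F k x = G k x}) -> diag_op F xi = diag_op G xi.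
Proof.
move=> hF hG FG; apply: L2p_ext => k.
by apply: filterS3 (diag_opE xi k hF) (diag_opE xi k hG) (FG k) => x -> -> ->.
Qed.

Lemma diag_op_linear F : (forall k, Linf (F k)) -> linear (diag_op F).
Proof.
move=> hF a xi eta; apply: L2p_ext => k.
have h1 := diag_opE (a *: xi + eta) k hF.
have h2 := L2p_linear_ae a xi eta k.
have h3 := L2p_linear_ae a (diag_op F xi) (diag_op F eta) k.
have h4 := diag_opE xi k hF; have h5 := diag_opE eta k hF.
apply: filterS3 h1 h2 (filterI h3 (filterI h4 h5)) => x -> -> [-> [-> ->]].
by rewrite mulrDr mulrCA.
Qed.

Lemma LinfM (f g : R -> C) : Linf f -> Linf g -> Linf (fun x => f x * g x).
Proof.
move=> [mf [M hM]] [mg [K hK]]; split; first exact: cmeasurableM.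
exists (M * K); apply: filterS2 hM hK => x hM hK.
by rewrite modulusM ler_pM ?modulus_ge0.
Qed.

Lemma LinfD (f g : R -> C) : Linf f -> Linf g -> Linf (fun x => f x + g x).
Proof.
move=> [mf [M hM]] [mg [K hK]]; split; first exact: cmeasurableD.
exists (M + K); apply: filterS2 hM hK => x hM hK.
by rewrite (le_trans (modulusD _ _))// lerD.
Qed.

Lemma Linf_cst (c : C) : Linf (fun=> c : C).
Proof. by split; [exact: cmeasurable_cst|exists (modulus c); exact: aeW]. Qed.

Lemma Linf_conj (f : R -> C) : Linf f -> Linf (fun x => (f x)^*%C).
Proof.
move=> [mf [M hM]]; split; first exact: cmeasurable_conj.
by exists M; apply: filterS hM => x; rewrite modulus_conj.
Qed.

Lemma Linf_aff (a b : R) (f : R -> C) : 0 < a -> Linf f -> Linf (fun x => f (aff a b x)).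
Proof.
move=> a0 [mf [M hM]]; split; first exact: cmeasurable_aff.
by exists M; exact: ae_aff hM.
Qed.

Lemma Linf_common F : (forall k, Linf (F k)) -> exists2 M : R, 0 <= M &
  forall k, {ae leb, forall x, modulus (F k x) <= M}.
Proof.
move=> hF; have /choice[M hM] : forall k, exists M : R, {ae leb, forall x, modulus (F k x) <= M}.
  by move=> k; have [_] := hF k.
exists (\sum_k `|M k|); first exact: sumr_ge0.
move=> k; apply: filterS (hM k) => x /le_trans; apply.
by rewrite (le_trans (ler_norm _))// (bigD1 k)//= lerDl sumr_ge0.
Qed.

Lemma nsq_diag_op F (M : R) xi : (forall k, Linf (F k)) ->
  (forall k, {ae leb, forall x, modulus (F k x) <= M}) ->
  nsq (diag_op F xi) <= M ^+ 2 * nsq xi.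
Proof.
move=> hF hM; rewrite /nsq mulr_sumr; apply: ler_sum => k _.
have mx := L2fun_meas (L2fun_of_in (xi k)).
rewrite -lee_fin EFinM !fineK ?L2fun_fin ?L2fun_of_in//.
have [mF _] := hF k.
rewrite (normsq_ae _ _ (diag_opE xi k hF)).
- exact: normsq_mul_le.
- exact: L2fun_meas (L2fun_of_in _).
- exact: cmeasurableM.
Qed.

Lemma bounded_nsq (T : L2p R p -> L2p R p) (M : R) : 0 <= M -> linear T ->
  (forall xi, nsq (T xi) <= M ^+ 2 * nsq xi) -> bounded_op dot T.
Proof.
move=> M0 lT hT; split => //; exists M => xi.
rewrite -(@ler_pXn2r _ 2) ?nnegrE ?hnorm_ge0 ?mulr_ge0 ?hnorm_ge0// exprMn !hnorm_sq.
by rewrite mulrCA ler_wpM2l// ltW// twopiV_gt0.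
Qed.

Lemma nsq_bounded (T : L2p R p -> L2p R p) : bounded_op dot T ->
  exists2 M : R, 0 <= M & forall xi, nsq (T xi) <= M ^+ 2 * nsq xi.
Proof.
move=> [lT [M hM]]; exists `|M| => // xi.
rewrite !nsq_hnorm [leRHS]mulrCA; apply: ler_wpM2l; first by rewrite mulr_ge0// pi_ge0.
rewrite -exprMn.
rewrite lerXn2r ?nnegrE ?hnorm_ge0 ?mulr_ge0 ?hnorm_ge0//.
by rewrite (le_trans (hM xi))// ler_wpM2r ?hnorm_ge0// ler_norm.
Qed.

Lemma diag_op_bounded F : (forall k, Linf (F k)) -> bounded_op dot (diag_op F).
Proof.
move=> hF; have [M M0 hM] := Linf_common hF.
apply: (bounded_nsq M0); first exact: diag_op_linear.
by move=> xi; exact: nsq_diag_op.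
Qed.

Lemma diag_opM F G xi : (forall k, Linf (F k)) -> (forall k, Linf (G k)) ->
  diag_op (fun k x => F k x * G k x) xi = diag_op F (diag_op G xi).
Proof.
move=> hF hG; apply: L2p_ext => k.
have h1 := diag_opE xi k (fun k => LinfM (hF k) (hG k)).
have h2 := diag_opE (diag_op G xi) k hF; have h3 := diag_opE xi k hG.
by apply: filterS3 h1 h2 h3 => x -> -> ->; rewrite mulrA.
Qed.

Lemma diag_op_lin F G (a : C) xi : (forall k, Linf (F k)) -> (forall k, Linf (G k)) ->
  diag_op (fun k x => a * F k x + G k x) xi = a *: diag_op F xi + diag_op G xi.
Proof.
move=> hF hG; apply: L2p_ext => k.
have h1 := diag_opE xi k (fun k => LinfD (LinfM (Linf_cst a) (hF k)) (hG k)).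
have h2 := L2p_linear_ae a (diag_op F xi) (diag_op G xi) k.
have h3 := diag_opE xi k hF; have h4 := diag_opE xi k hG.
apply: filterS3 h1 h2 (filterI h3 h4) => x -> -> [-> ->].
by rewrite mulrDl mulrA.
Qed.

Lemma diag_op1 xi : diag_op (fun _ _ => 1) xi = xi.
Proof.
apply: L2p_ext => k.
by apply: filterS (diag_opE xi k (fun _ => Linf_cst 1)) => x ->; rewrite mul1r.
Qed.

Lemma diag_op_adjoint F : (forall k, Linf (F k)) ->
  adjoint dot (diag_op F) (diag_op (fun k x => (F k x)^*%C)).
Proof.
move=> hF xi eta; apply: eq_bigr => k _.
have hx := L2fun_of_in (xi k); have he := L2fun_of_in (eta k).
rewrite (L2dotE _ _ (diag_opE xi k hF) (aeW _ (fun=> erefl)))//; last exact: L2fun_mul.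
have hc k' := Linf_conj (hF k').
rewrite (L2dotE _ _ (aeW _ (fun=> erefl)) (diag_opE eta k hc))//; last exact: L2fun_mul (hc k) he.
congr (_ * cintegral _ _); apply/funext => x.
by rewrite rmorphM /= mulrCA mulrA.
Qed.

(** ** The unitary U_C *)

Variables (N : nat) (hN : (0 < N)%N) (theta : 'I_p -> R).
Local Notation E := (@expi R).
Local Notation sN := (Num.sqrt N%:R : R).
Local Notation U := (UC N theta).

Let N0 : 0 < N%:R :> R. Proof. by rewrite ltr0n. Qed.

Let affN x : aff N%:R 0 x = N%:R * x :> R. Proof. by rewrite /aff addr0. Qed.

Let affV x : aff N%:R^-1 0 x = x / N%:R :> R. Proof. by rewrite /aff addr0 mulrC. Qed.

Lemma L2fun_dilate (f : R -> C) : f \in L2fun -> (fun x => f (N%:R * x)) \in L2fun.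
Proof.
move=> hf; rewrite (_ : (fun x => _) = (fun x => f (aff N%:R 0 x))).
  exact: L2fun_aff.
by apply/funext => x; rewrite affN.
Qed.

Lemma L2fun_contract (f : R -> C) : f \in L2fun -> (fun x => f (x / N%:R)) \in L2fun.
Proof.
move=> hf; rewrite (_ : (fun x => _) = (fun x => f (aff N%:R^-1 0 x))).
  by apply: L2fun_aff => //; rewrite invr_gt0.
by apply/funext => x; rewrite affV.
Qed.

Lemma ae_dilate (P : R -> Prop) : {ae leb, forall x, P x} -> {ae leb, forall x, P (N%:R * x)}.
Proof. by move=> /(ae_aff 0 N0); apply: filterS => x; rewrite affN. Qed.

Lemma ae_contract (P : R -> Prop) : {ae leb, forall x, P x} -> {ae leb, forall x, P (x / N%:R)}.
Proof.
have NV : 0 < N%:R^-1 :> R by rewrite invr_gt0.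
by move=> /(ae_aff 0 NV); apply: filterS => x; rewrite affV.
Qed.

Lemma UCE xi k : {ae leb, forall x,
  L2fun_of (U xi k) x = E (theta k) * sN%:C * L2fun_of (xi (ordS k)) (N%:R * x)}.
Proof.
rewrite ffunE.
have h1 := L2fun_ofZ (E (theta k)) (U1 N (xi (ordS k))).
have h2 : {ae leb, forall x, L2fun_of (U1 N (xi (ordS k))) x =
    sN%:C * L2fun_of (xi (ordS k)) (N%:R * x)}.
  by apply: L2classE; apply: L2funZ; apply: L2fun_dilate; exact: L2fun_of_in.
by apply: filterS2 h1 h2 => x -> ->; rewrite mulrA.
Qed.

Definition UCinv xi : L2p R p := [ffun k => L2class (fun x =>
  E (- theta (ord_pred k)) * (sN^-1)%:C * L2fun_of (xi (ord_pred k)) (x / N%:R))].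

Lemma UCinvE xi k : {ae leb, forall x, L2fun_of (UCinv xi k) x =
  E (- theta (ord_pred k)) * (sN^-1)%:C * L2fun_of (xi (ord_pred k)) (x / N%:R)}.
Proof.
rewrite ffunE; apply: L2classE; apply: L2funZ; apply: L2fun_contract; exact: L2fun_of_in.
Qed.

Let phase k : (E (theta k) * sN%:C) * (E (- theta k) * (sN^-1)%:C) = 1.
Proof.
rewrite mulrACA -expiD subrr expi0 mul1r fmorphV mulfV//.
by rewrite fmorph_eq0 gt_eqF// sqrtr_gt0.
Qed.

Lemma UCK : cancel U UCinv.
Proof.
move=> xi; apply: L2p_ext => k; have h1 := UCinvE (U xi) k.
have h2 := ae_contract (UCE xi (ord_pred k)).
apply: filterS2 h1 h2 => x -> ->; rewrite ord_predK.
by rewrite mulrA [X in X * _]mulrC phase mul1r mulrC mulfVK// gt_eqF.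
Qed.

Lemma UCinvK : cancel UCinv U.
Proof.
move=> xi; apply: L2p_ext => k; have h1 := UCE (UCinv xi) k.
have h2 := ae_dilate (UCinvE xi (ordS k)).
apply: filterS2 h1 h2 => x -> ->; rewrite ordSK.
by rewrite mulrA phase mul1r mulrC mulKf// gt_eqF.
Qed.

Lemma UC_linear : linear U.
Proof.
move=> a xi eta; apply: L2p_ext => k.
have h1 := UCE (a *: xi + eta) k.
have h2 := ae_dilate (L2p_linear_ae a xi eta (ordS k)).
have h3 := L2p_linear_ae a (U xi) (U eta) k.
have h4 := UCE xi k; have h5 := UCE eta k.
apply: filterS3 h1 h2 (filterI h3 (filterI h4 h5)) => x e1 e2 [e3 [e4 e5]].
apply: (etrans e1); rewrite e2 mulrDr; apply: esym; apply: (etrans e3).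
by rewrite e4 e5 mulrCA.
Qed.

Lemma nsq_UC xi : nsq (U xi) = nsq xi.
Proof.
rewrite /nsq [RHS](reindex_inj (can_inj (@ordSK p))) /=; apply: eq_bigr => k _.
have hx := L2fun_of_in (xi (ordS k)); have mx := L2fun_meas hx.
rewrite (normsq_ae _ _ (UCE xi k)).
- rewrite normsqZ; last exact: L2fun_meas (L2fun_dilate hx).
  rewrite (_ : (fun x => _) = (fun x => L2fun_of (xi (ordS k)) (aff N%:R 0 x))); last first.
    by apply/funext => x; rewrite affN.
  rewrite normsq_aff// muleA -EFinM modulusM modulus_expi mul1r modulus_real.
  by rewrite ger0_norm ?sqrtr_ge0// sqr_sqrtr ?ltW// divff ?mul1e// gt_eqF.
- exact: L2fun_meas (L2fun_of_in _).
- by apply: cmeasurableM; [exact: cmeasurable_cst|exact: L2fun_meas (L2fun_dilate hx)].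
Qed.

Lemma L2pdotDZ (a : C) xi eta : dot (a *: xi + eta) (a *: xi + eta) =
  (a^*%C * a) * dot xi xi + a^*%C * dot xi eta + a * (dot xi eta)^*%C + dot eta eta.
Proof.
have l1 x : dot x (a *: xi + eta) = a * dot x xi + dot x eta := L2pdot_linear x a xi eta.
have cj x : dot (a *: xi + eta) x = a^*%C * dot xi x + dot eta x.
  by rewrite L2pdot_conj L2pdot_linear raddfD /= rmorphM /= -!L2pdot_conj.
rewrite l1 !cj (L2pdot_conj xi eta).
by move: (dot xi xi) (dot xi eta) (dot eta eta) (_^*%C) (_^*%C) => b c d e f; ring.
Qed.

Lemma nsq_isometry (T : L2p R p -> L2p R p) : linear T -> (forall xi, nsq (T xi) = nsq xi) ->
  forall xi eta, dot (T xi) (T eta) = dot xi eta.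
Proof.
move=> lT hT xi eta.
have dT x : dot (T x) (T x) = dot x x by rewrite !L2pdot_nsq hT.
have key a : a^*%C * dot (T xi) (T eta) + a * (dot (T xi) (T eta))^*%C =
    a^*%C * dot xi eta + a * (dot xi eta)^*%C.
  have := dT (a *: xi + eta); rewrite lT !L2pdotDZ !dT => /addIr.
  by rewrite -!addrA => /addrI.
move: (key 1) (key 'i); move: (dot (T xi) (T eta)) (dot xi eta) => [a b] [c d] /=.
move=> [h1 _] [h3 _]; apply/eqP; rewrite eq_complex /=; apply/andP; split; apply/eqP; lra.
Qed.

Lemma UC_adjoint : adjoint dot U UCinv.
Proof.
move=> xi eta; rewrite -{1}(UCinvK eta); apply: nsq_isometry.
  exact: UC_linear.
exact: nsq_UC.
Qed.

Lemma UC_unitary : unitary_op dot U.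
Proof.
split; first exact: UC_linear.
by exists UCinv; split; [exact: UC_adjoint|exact: UCK|exact: UCinvK].
Qed.

Lemma UC_diag_op F G xi : (forall k, Linf (F k)) -> (forall k, Linf (G k)) ->
  (forall k, {ae leb, forall x, F (ordS k) (N%:R * x) = G k x}) ->
  U (diag_op F xi) = diag_op G (U xi).
Proof.
move=> hF hG FG; apply: L2p_ext => k.
have h1 := UCE (diag_op F xi) k; have h2 := ae_dilate (diag_opE xi (ordS k) hF).
have h3 := diag_opE (U xi) k hG; have h4 := UCE xi k.
apply: filterS3 h1 h2 (filterI (FG k) (filterI h3 h4)) => x -> -> [-> [-> ->]].
by rewrite mulrCA.
Qed.

(** ** The representation of bounded functions *)

Variables (z : 'I_p -> C) (hz : forall k, circle (z k)).

Lemma expi_coord k : exists a, forall x, z k * E x = E (aff 1 a x).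
Proof.
have [a az] := expi_surj (hz k); exists a => x.
by rewrite /aff mul1r addrC expiD az.
Qed.

Lemma ae_rotate k (P : C -> Prop) : {ae leb, forall x, P (E x)} ->
  {ae leb, forall x, P (z k * E x)}.
Proof.
have [a ha] := expi_coord k; move=> /(ae_aff a ltr01); apply: filterS => x.
by rewrite ha.
Qed.

Lemma Linf_rotate k (f : C -> C) : LinfT f -> Linf (alpha (z k) f \o E).
Proof.
have [a ha] := expi_coord k; move=> /(Linf_aff a ltr01).
by congr Linf; apply/funext => x; rewrite /= /alpha ha.
Qed.

Lemma piCE f : piC z f = diag_op (fun k => alpha (z k) f \o E).
Proof. by []. Qed.

Lemma piC_star_rep : star_rep dot (piC z).
Proof.
split.
  move=> f g hf hg fg; apply/funext => xi; rewrite !piCE.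
  by apply: diag_op_eq => k; try exact: Linf_rotate; exact: ae_rotate k (fun w => f w = g w) fg.
have hr f (hf : LinfT f) k := Linf_rotate k hf.
split.
- by move=> f hf; apply: diag_op_bounded => k; exact: hr.
- by move=> a f g hf hg xi; apply: (diag_op_lin a xi (hr f hf) (hr g hg)).
- by move=> f g hf hg xi; apply: (diag_opM xi (hr f hf) (hr g hg)).
- exact: diag_op1.
- by move=> f hf; exact: (diag_op_adjoint (hr f hf)).
Qed.

End Operators.

(** * Truncation and approximation *)

Section Cut.
Variable R : realType.
Local Notation C := (R[i]).
Local Notation leb := (@lebesgue_measure R).
Local Notation L2fun := (@L2fun R).

Definition cutoff (b : R -> bool) (f : R -> C) (x : R) : C := if b x then f x else 0.

Lemma cmeasurable_if (b : R -> bool) (f g : R -> C) : measurable_fun setT b ->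
  cmeasurable f -> cmeasurable g -> cmeasurable (fun x => if b x then f x else g x).
Proof.
move=> mb [fr fi] [gr gi]; split.
  rewrite (_ : _ \o _ = fun x => if b x then complex.Re (f x) else complex.Re (g x)).
    exact: measurable_fun_ifT.
  by apply/funext => x /=; case: ifP.
rewrite (_ : _ \o _ = fun x => if b x then complex.Im (f x) else complex.Im (g x)).
  exact: measurable_fun_ifT.
by apply/funext => x /=; case: ifP.
Qed.

Lemma cmeasurable_cut b f : measurable_fun setT b -> cmeasurable f -> cmeasurable (cutoff b f).
Proof. by move=> mb mf; apply: cmeasurable_if => //; exact: cmeasurable_cst. Qed.

Lemma modulus_cut b f x : modulus (cutoff b f x) <= modulus (f x).
Proof. by rewrite /cutoff; case: ifP; rewrite ?modulus0 ?modulus_ge0. Qed.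

Lemma L2fun_cut b f : measurable_fun setT b -> f \in L2fun -> cutoff b f \in L2fun.
Proof.
move=> mb hf; have mf := L2fun_meas hf; have mc := cmeasurable_cut mb mf.
apply/L2funP; split => //; have /L2funP[_] := hf; apply: le_lt_trans.
by apply: le_normsq => // x; exact: modulus_cut.
Qed.

Lemma Linf_indic (b : R -> bool) : measurable_fun setT b -> Linf (cutoff b (fun=> 1)).
Proof.
move=> mb; split; first by apply: cmeasurable_cut => //; exact: cmeasurable_cst.
by exists 1; apply: aeW => x; rewrite (le_trans (modulus_cut _ _ _))// modulus1.
Qed.

(** By dominated convergence, the squares of the differences being at most |f|^2. *)
Lemma normsq_cut (b : nat -> R -> bool) (f : R -> C) (e : R) :
  (forall n, measurable_fun setT (b n)) -> f \in L2fun ->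
  (forall x, exists n0, forall n, (n0 <= n)%N -> b n x) -> 0 < e ->
  exists n, (normsq (fun x => f x - cutoff (b n) f x)%R < e%:E)%E.
Proof.
move=> mb hf hb e0; have mf := L2fun_meas hf.
pose d n x := (modulus (f x - cutoff (b n) f x) ^+ 2)%:E.
have dle n x : (d n x <= (modulus (f x) ^+ 2)%:E)%E.
  rewrite lee_fin /cutoff; case: ifP => _; rewrite ?subr0// subrr modulus0 expr0n.
  exact: sqr_ge0.
have := @dominated_cvg _ _ _ leb setT measurableT d (cst 0%E)
  (fun x => (modulus (f x) ^+ 2)%:E).
move=> /(_ _ _ _ _ _)/wrap[].
- by move=> n; apply: cmeasurable_modulus2; apply: cmeasurableB => //; exact: cmeasurable_cut.
- move=> x _; apply: cvg_near_cst; have [n0 hn0] := hb x.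
  exists n0 => // n /= n0n.
  by rewrite /d /cutoff hn0// subrr modulus0 expr0n.
- by [].
- apply/integrableP; split; first exact: cmeasurable_modulus2.
  have /L2funP[_] := hf; congr (_ < _)%E.
  by apply: eq_integral => x _; rewrite [RHS]gee0_abs// lee_fin sqr_ge0.
- by move=> n x _; rewrite gee0_abs// lee_fin sqr_ge0.
rewrite integral_cst// mul0e => h.
have fin n : (\int[leb]_x d n x)%E \is a fin_num.
  have : (fun x => f x - cutoff (b n) f x) \in L2fun.
    by apply: L2funB => //; exact: L2fun_cut.
  exact: L2fun_fin.
have /cvgRP/(_ e e0)[n0 hn] : (fun n => fine (\int[leb]_x d n x)%E) @ \oo --> (0 : R).
  by apply: fine_cvg; exact: h.
exists n0; have := hn n0 (leqnn _); rewrite subr0 => hlt.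
rewrite -[normsq _]fineK; last exact: fin.
by rewrite lte_fin (le_lt_trans (ler_norm _)).
Qed.

Definition bounded_by (f : R -> C) (n : nat) (x : R) : bool :=
  (`|x| <= n%:R) && (modulus (f x) <= n%:R).

Lemma measurable_bounded_by f n : cmeasurable f -> measurable_fun setT (bounded_by f n).
Proof.
move=> mf; apply: measurable_and; apply: measurable_fun_ler => //.
exact: measurable_modulus.
Qed.

Lemma bounded_by_ev f x : exists n0, forall n, (n0 <= n)%N -> bounded_by f n x.
Proof.
exists (Num.truncn (`|x| + modulus (f x))).+1 => n hn.
have h : `|x| + modulus (f x) <= n%:R.
  by rewrite (le_trans (ltW (truncnS_gt _)))// ler_nat.
have := modulus_ge0 (f x); have := normr_ge0 x => h1 h2.
by apply/andP; split; lra.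
Qed.

End Cut.

Section Approximation.
Variables (R : realType) (p : nat) (G : set (L2p R p)).
Local Notation C := (R[i]).
Local Notation leb := (@lebesgue_measure R).
Local Notation L2fun := (@L2fun R).
Local Notation dot := (@L2pdot R p).
Implicit Types (xi eta : L2p R p).

(** The approximation is measured by the squared norm, which is a sum over the
    components. *)
Definition spanned xi := forall e : R, 0 < e -> exists (n : nat) (a : 'I_n -> C) (g : 'I_n -> L2p R p),
  (forall i, G (g i)) /\ nsq (xi - \sum_i a i *: g i) < e.

Lemma nsqD_lt xi eta (e : R) : nsq xi < e / 4 -> nsq eta < e / 4 -> nsq (xi + eta) < e.
Proof.
move=> h1 h2; apply: le_lt_trans (nsqD _ _) _.
by move: (nsq xi) (nsq eta) h1 h2 => a b; lra.
Qed.

Lemma spanned_dense : (forall xi, spanned xi) -> dense_span dot G.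
Proof.
move=> h v e e0; have e1 : 0 < 2 * pi * e ^+ 2 by rewrite !mulr_gt0 ?pi_gt0// exprn_gt0.
by have [n [a [g [hg hn]]]] := h v _ e1; exists n, a, g; split => //; rewrite hnorm_lt.
Qed.

Lemma spanned0 : spanned 0.
Proof.
move=> e e0; exists 0%N, (fun=> 0), (fun=> 0); split => [[]//|].
rewrite big_ord0 subr0; have := nsqZ 0 (0 : L2p R p).
by rewrite scaler0 modulus0 expr0n mul0r => ->.
Qed.

Lemma spannedD xi eta : spanned xi -> spanned eta -> spanned (xi + eta).
Proof.
move=> hx he e e0; have e4 : 0 < e / 4 by lra.
have [n [a [g [gG hn]]]] := hx _ e4; have [m [b [h [hG hm]]]] := he _ e4.
exists (n + m)%N, (fun i => match fintype.split i with inl j => a j | inr j => b j end),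
  (fun i => match fintype.split i with inl j => g j | inr j => h j end); split.
  by move=> i; case: (fintype.split i).
rewrite big_split_ord /=.
under eq_bigr do rewrite (unsplitK (inl _)).
under [X in _ - (_ + X)]eq_bigr do rewrite (unsplitK (inr _)).
move: hn hm; move: (\sum_i a i *: g i) (\sum_i b i *: h i) => s t hs ht.
by rewrite opprD addrACA; exact: (nsqD_lt hs ht).
Qed.

Lemma spanned_lim xi : (forall e : R, 0 < e -> exists2 eta, spanned eta & nsq (xi - eta) < e) ->
  spanned xi.
Proof.
move=> h e e0; have e4 : 0 < e / 4 by lra.
have [eta he hx] := h _ e4; have [n [a [g [gG hn]]]] := he _ e4.
exists n, a, g; split => //.
have -> : xi - \sum_i a i *: g i = (xi - eta) + (eta - \sum_i a i *: g i).
  by rewrite addrA subrK.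
exact: nsqD_lt.
Qed.

Lemma vanish_spanned (Q : L2p R p -> L2p R p) (K : R) : linear Q ->
  0 <= K -> (forall xi, nsq (Q xi) <= K * nsq xi) -> (forall xi, G xi -> Q xi = 0) ->
  forall xi, spanned xi -> Q xi = 0.
Proof.
move=> lQ K0 hQ QG xi hxi; apply: nsq_eq0; apply/eqP; rewrite eq_le nsq_ge0 andbT.
apply/ler_addgt0Pr => e e0; rewrite add0r.
have K1 : 0 < K + 1 by rewrite ltr_wpDl.
have [n [a [g [gG hn]]]] := hxi _ (divr_gt0 e0 K1).
pose QL : {linear L2p R p -> L2p R p} := HB.pack Q (GRing.isLinear.Build _ _ _ _ Q lQ).
have Q0 : Q (\sum_i a i *: g i) = 0.
  rewrite -[Q]/(QL : _ -> _) linear_sum big1// => i _.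
  by rewrite linearZ /= [X in _ *: X](QG _ (gG i)) scaler0.
have -> : Q xi = Q (xi - \sum_i a i *: g i).
  by rewrite -[Q]/(QL : _ -> _) linearB /= [X in _ - X]Q0 subr0.
rewrite (le_trans (hQ _))// (le_trans (ler_wpM2l K0 (ltW hn)))//.
by rewrite mulrCA ler_piMr ?(ltW e0)// ler_pdivrMr// mul1r lerDl.
Qed.

Lemma spanned_in xi : G xi -> spanned xi.
Proof.
move=> hx e e0; exists 1%N, (fun=> 1), (fun=> xi); split => //.
rewrite big_ord1 scale1r subrr; have := nsqZ 0 (0 : L2p R p).
by rewrite scaler0 modulus0 expr0n mul0r => ->.
Qed.

Definition single (k : 'I_p) (f : R -> C) : L2p R p :=
  [ffun j => if j == k then L2class f else 0].

Lemma normsq_of0 : normsq (L2fun_of (0 : L2 R)) = 0%E.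
Proof.
rewrite (@normsq_ae _ _ (cst 0)).
- by rewrite /normsq integral0_eq// => x _; rewrite modulus0 expr0n.
- exact: L2fun_meas (L2fun_of_in _).
- exact: cmeasurable_cst.
- exact: L2fun_of0.
Qed.

Lemma nsq_single k f : f \in L2fun -> nsq (single k f) = fine (normsq f).
Proof.
move=> hf; rewrite /nsq (bigD1 k)//= big1 ?addr0.
  by rewrite ffunE eqxx normsq_class.
by move=> j jk; rewrite ffunE (negPf jk) normsq_of0.
Qed.

Lemma nsqB_single k xi f : f \in L2fun -> (forall j, j != k -> xi j = 0) ->
  nsq (xi - single k f) = fine (normsq (fun x => L2fun_of (xi k) x - f x)).
Proof.
move=> hf x0; rewrite /nsq (bigD1 k)//= big1 ?addr0.
  by rewrite !ffunE eqxx normsqB_class.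
by move=> j jk; rewrite !ffunE (negPf jk) x0// subrr normsq_of0.
Qed.

Lemma sum_single xi : xi = \sum_k single k (L2fun_of (xi k)).
Proof.
apply/ffunP => j; rewrite sum_ffunE (bigD1 j)//= ffunE eqxx big1 ?addr0.
  by apply/esym/L2class_eqP; [exact: L2fun_of_in|exact: aeW].
by move=> k kj; rewrite ffunE eq_sym (negPf kj).
Qed.

(** Each component of a vector is a limit of its truncations, which are bounded
    functions with bounded support. *)
Lemma spanned_all : (forall k (f : R -> C) (n : nat), f \in L2fun ->
    (forall x, modulus (f x) <= n%:R) -> (forall x, n%:R < `|x| -> f x = 0) ->
    spanned (single k f)) -> forall xi, spanned xi.
Proof.
move=> h xi; rewrite [xi]sum_single.
apply: (big_ind spanned) => [||k _]; [exact: spanned0|exact: spannedD|].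
apply: spanned_lim => e e0; set f := L2fun_of _.
have hf : f \in L2fun := L2fun_of_in _; have mf := L2fun_meas hf.
have [n hn] := normsq_cut (fun n => measurable_bounded_by n mf) hf (bounded_by_ev f) e0.
have hc : cutoff (bounded_by f n) f \in L2fun.
  by apply: L2fun_cut => //; exact: measurable_bounded_by.
exists (single k (cutoff (bounded_by f n) f)).
  apply: (h k _ n) => // x.
    by rewrite /cutoff /bounded_by; case: ifP => [/andP[]//|]; rewrite modulus0.
  by rewrite /cutoff /bounded_by => xn; rewrite leNgt xn.
rewrite nsqB_single//; last by move=> j jk; rewrite ffunE (negPf jk).
rewrite ffunE eqxx -lte_fin fineK.
  apply: le_lt_trans hn; rewrite le_eqVlt; apply/orP; left; apply/eqP.
  apply: normsq_ae.
  - by apply: cmeasurableB; apply: L2fun_meas => //; exact: L2fun_of_in.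
  - by apply: cmeasurableB; exact: L2fun_meas.
  - by apply: filterS (L2classE hf) => x ->.
by apply: L2fun_fin; apply: L2funB => //; exact: L2fun_of_in.
Qed.

End Approximation.

(** * The infinite products phi_k *)

Section CyclicOrdinals.
Variable p : nat.

Lemma iter_ord_pred (n : nat) (k : 'I_p) :
  (iter n (@ord_pred p) k + n = k %[mod p])%N.
Proof.
elim: n k => [|n IH] k; first by rewrite addn0.
rewrite iterSr -[n.+1]addn1 addnA -modnDml IH /=.
have kp := ltn_ord k; have p0 : (0 < p)%N by exact: leq_ltn_trans kp.
case: (ltnP 0 k) => k0.
  rewrite (_ : (k + p).-1 = k.-1 + p)%N; last by lia.
  by rewrite modnDr modn_mod modnDml addn1 prednK.
have -> : (k : nat) = 0%N by lia.
by rewrite add0n modn_mod modnDml addn1 prednK// modnn mod0n.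
Qed.

Lemma iter_ord_pred_period (k : 'I_p) : iter p (@ord_pred p) k = k.
Proof.
apply: val_inj; have := iter_ord_pred p k; rewrite modnDr !modn_small//.
Qed.

Lemma iter_ord_pred_periodM m (k : 'I_p) : iter (m * p) (@ord_pred p) k = k.
Proof. by elim: m => [//|m IH]; rewrite mulSn iterD IH iter_ord_pred_period. Qed.

Lemma iter_ordSK n : cancel (iter n (@ord_pred p)) (iter n (@ordS p)).
Proof. by elim: n => [//|n IH] k; rewrite iterSr iterS ord_predK IH. Qed.

Lemma iter_ordS_period (k : 'I_p) : iter p (@ordS p) k = k.
Proof. by rewrite -{1}(iter_ord_pred_period k) iter_ordSK. Qed.

Lemma iter_ordS_periodM m (k : 'I_p) : iter (m * p) (@ordS p) k = k.
Proof. by rewrite -{1}(iter_ord_pred_periodM m k) iter_ordSK. Qed.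

Lemma iter_ordS_val j (k : 'I_p) : val (iter j (@ordS p) k) = ((k + j) %% p)%N.
Proof.
elim: j => [|j IH] /=; first by rewrite addn0 modn_small.
by rewrite IH -[in LHS]addn1 modnDml -addnA addn1.
Qed.

End CyclicOrdinals.

Section CycleWave.
Variables (R : realType) (N : nat) (hN : (2 <= N)%N).
Variables (m0 : R[i] -> R[i]) (m0_lip : lipschitzT m0).
Hypothesis m0_qmf : forall w, circle w -> ruelle N m0 (fun=> 1) w = 1.
Variables (p : nat) (z : 'I_p -> R[i]) (hz : is_cycle N m0 z).
Variable theta : 'I_p -> R.
Hypothesis htheta : forall k, m0 (z k) = (Num.sqrt N%:R)%:C * expi (theta k).
Local Notation C := (R[i]).
Local Notation E := (@expi R).
Local Notation sN := (Num.sqrt N%:R : R).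
Local Notation W := (weight N m0).

Lemma N_gt0 : (0 : R) < N%:R.
Proof. by rewrite ltr0n; lia. Qed.
Local Hint Resolve N_gt0 : core.

Lemma sqrtN_gt0 : (0 : R) < sN.
Proof. by rewrite sqrtr_gt0. Qed.

Lemma circle_z k : circle (z k).
Proof. by case: hz. Qed.

Lemma z_neq0 k : z k != 0.
Proof. exact: circle_neq0 (circle_z k). Qed.

Lemma zX k : z k ^+ N = z (ordS k).
Proof. by case: hz. Qed.

Lemma z_inj : injective z.
Proof. by case: hz. Qed.

Lemma p_gt0 : (0 < p)%N.
Proof. by case: hz. Qed.

Lemma weight_sum (a : C) (x : R) : circle a ->
  \sum_(r < N) W (a * E (branch N x r)) = 1.
Proof.
move=> ca; apply: complexI; rewrite rmorph_sum /=.
have := m0_qmf (circleM (circleX N ca) (circle_expi x)).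
by rewrite ruelle_branch// => h; rewrite -[RHS]h; apply: eq_bigr => r _; rewrite mulr1.
Qed.

Lemma weight_le1 w : circle w -> W w <= 1.
Proof.
move=> cw; rewrite -(weight_sum 0 cw).
have lt0N : (0 < N)%N by lia.
rewrite (bigD1 (Ordinal lt0N))//= /branch !mulr0 mul0r addr0 mul0r expi0 mulr1.
by rewrite lerDl sumr_ge0// => r _; exact: weight_ge0.
Qed.

Lemma modulus_m0_le w : circle w -> modulus (m0 w) <= sN.
Proof.
move=> cw; have := weight_le1 cw; rewrite /weight ler_pdivrMr// mul1r => h1.
by rewrite -(@ler_pXn2r _ 2) ?nnegrE ?modulus_ge0 ?sqrtr_ge0// sqr_sqrtr// ltW.
Qed.

Lemma modulus_coordB k u v : modulus (z k * E u - z k * E v) = modulus (E u - E v).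
Proof. by rewrite -mulrBr modulusM; have /circleE -> := circle_z k; rewrite mul1r. Qed.

Lemma modulus_coord k u : modulus (z k * E u - z k) = modulus (E u - 1).
Proof. by have := modulus_coordB k u 0; rewrite expi0 mulr1. Qed.

(** The factor of the infinite product: m0 near the cycle, normalized to be 1
    at 0.  The phases of the p points of the cycle add up to theta_C over one
    turn. *)
Definition lowpass (k : 'I_p) (u : R) : C :=
  E (- theta k) * m0 (z k * E u) / sN%:C.

Lemma modulus_lowpass k u : modulus (lowpass k u) ^+ 2 = W (z k * E u).
Proof.
rewrite /lowpass !modulusM modulusV modulus_expi mul1r modulus_real exprMn.
by rewrite exprVn ger0_norm ?(ltW sqrtN_gt0)// sqr_sqrtr// ltW.
Qed.

Lemma lowpass_le1 k u : modulus (lowpass k u) <= 1.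
Proof.
rewrite -(@ler_pXn2r _ 2) ?nnegrE ?modulus_ge0// expr1n modulus_lowpass.
by apply: weight_le1; apply: circleM; [exact: circle_z|exact: circle_expi].
Qed.

Lemma lowpass0 k : lowpass k 0 = 1.
Proof.
rewrite /lowpass expi0 mulr1 htheta mulrCA -expiD addNr expi0 mulr1 mulfV//.
by rewrite -modulus_eq0 modulus_real normr_eq0 gt_eqF// sqrtN_gt0.
Qed.

Lemma lowpass_lip : exists2 L : R, 0 <= L &
  forall k u v, modulus (lowpass k u - lowpass k v) <= L * `|u - v|.
Proof.
have [L L0 hL] := (lipschitzTP _).1 m0_lip.
exists (L * 2 / sN); first by rewrite divr_ge0 ?mulr_ge0// ltW// sqrtN_gt0.
move=> k u v.
rewrite /lowpass -mulrBl -mulrBr !modulusM modulus_expi mul1r modulusV modulus_real.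
rewrite (ger0_norm (ltW sqrtN_gt0)) mulrAC ler_pM2r ?invr_gt0 ?sqrtN_gt0//.
rewrite (le_trans (hL _ _ _ _))//.
- exact: circleM (circle_z k) (circle_expi u).
- exact: circleM (circle_z k) (circle_expi v).
by rewrite -mulrA ler_wpM2l// modulus_coordB expi_lip.
Qed.

(** One factor at a time, going backwards along the cycle; p factors make up
    one factor of the product that defines phi_k (lemma [phi_partialE]).  With this
    finer product the p functions phi_k are linked by a two-scale relation. *)
Definition partial_wave (n : nat) (k : 'I_p) (x : R) : C :=
  \prod_(s < n) lowpass (iter s.+1 (@ord_pred p) k) (x / N%:R ^+ s.+1).

Lemma partial_waveSr n k x : partial_wave n.+1 k x =
  partial_wave n k x * lowpass (iter n.+1 (@ord_pred p) k) (x / N%:R ^+ n.+1).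
Proof. by rewrite /partial_wave big_ord_recr. Qed.

Lemma partial_waveD m n k x : partial_wave (m + n) k x =
  partial_wave m k x * partial_wave n (iter m (@ord_pred p) k) (x / N%:R ^+ m).
Proof.
rewrite /partial_wave big_split_ord /=; congr (_ * _).
apply: eq_bigr => i _; rewrite -mulrA -invfM -exprD addnS -iterS.
by rewrite -addnS addnC iterD.
Qed.

Lemma zX_iter j k : z k ^+ (N ^ j) = z (iter j (@ordS p) k).
Proof.
by elim: j => [|j IH]; rewrite ?expr1// expnSr exprM IH zX.
Qed.

Lemma sum_cycle (F : 'I_p -> R) (k : 'I_p) :
  \sum_(0 <= j < p) F (iter j (@ordS p) k) = \sum_j F j.
Proof.
rewrite big_mkord; symmetry; apply: (reindex_inj (h := fun j : 'I_p => iter j (@ordS p) k)).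
move=> i j /(congr1 val); rewrite !iter_ordS_val => /eqP.
by rewrite eqn_modDl !modn_small// => /eqP/val_inj.
Qed.

Lemma partial_wave_period k x : partial_wave p k x =
  E (- thetaC theta) * alpha (z k) (mpow N m0 p) (E (x / N%:R ^+ p))
       / (Num.sqrt (N%:R ^+ p))%:C.
Proof.
rewrite /partial_wave /alpha /mpow.
rewrite -(big_mkord xpredT (fun s => lowpass (iter s.+1 (@ord_pred p) k) (x / N%:R ^+ s.+1))).
rewrite big_nat_rev /= add0n.
transitivity (\prod_(0 <= j < p) lowpass (iter j (@ordS p) k) (x / N%:R ^+ p * N%:R ^+ j)).
  apply: eq_big_nat => j /andP[_ jp].
  have jpE : ((p - j.+1).+1 + j = p)%N by lia.
  congr (lowpass _ _).
    rewrite -[in RHS](iter_ord_pred_period k).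
    have e : iter p (@ord_pred p) k = iter j (@ord_pred p) (iter (p - j.+1).+1 (@ord_pred p) k).
      by rewrite -iterD addnC jpE.
    by rewrite e iter_ordSK.
  rewrite -mulrA; congr (_ * _).
  rewrite -{2}jpE exprD invfM -mulrA mulVf ?mulr1//.
  by rewrite expf_neq0// gt_eqF.
rewrite /lowpass !big_split /=; congr (_ * _ * _).
- by rewrite -expi_sum sumrN sum_cycle.
- apply: eq_bigr => j _; congr m0; rewrite exprMn zX_iter expiX.
  by congr (_ * E _); rewrite natrX mulrC.
- rewrite prodr_const_nat subn0 exprVn -rmorphXn /=; congr (_%:C^-1).
  rewrite -[LHS]ger0_norm ?exprn_ge0 ?sqrtr_ge0// -sqrtr_sqr -exprM mulnC exprM.
  by rewrite sqr_sqrtr// ltW.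
Qed.

Lemma phi_partialE k x n : phi_partial N m0 z theta k x n = partial_wave (n * p) k x.
Proof.
elim: n x => [|n IH] x.
  by rewrite /phi_partial big_geq// mul0n /partial_wave big_ord0.
rewrite mulSn partial_waveD iter_ord_pred_period -IH partial_wave_period.
rewrite /phi_partial big_ltn// mul1n; congr (_ * _).
rewrite big_add1 /=; apply: eq_bigr => l _.
by rewrite -[(x / _) / _]mulrA -invfM -exprD mulSn.
Qed.

Lemma partial_wave_le1 n k x : modulus (partial_wave n k x) <= 1.
Proof.
apply: (prod_modulus_le1 n (a := fun s =>
  lowpass (iter s.+1 (@ord_pred p) k) (x / N%:R ^+ s.+1))) => s.
exact: lowpass_le1.
Qed.

Lemma invN_half n : (N%:R ^+ n)^-1 <= (2 ^+ n)^-1 :> R.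
Proof.
by rewrite lef_pV2 ?posrE ?exprn_gt0// lerXn2r ?nnegrE// ler_nat.
Qed.

(** Consecutive partial products differ by O(N^-n): the factors have modulus at
    most 1 and, being Lipschitz and 1 at 0, approach 1 geometrically. *)
Lemma wave_cvg : exists2 L : R, 0 <= L & forall k x, exists l : C,
  forall n, modulus (partial_wave n k x - l) <= L * `|x| / 2 ^+ n.
Proof.
have [L L0 hL] := lowpass_lip; exists L => // k x.
apply: geom_cauchyC => n.
rewrite partial_waveSr -[X in _ - X]mulr1 -mulrBr modulusM.
rewrite -[leRHS]mul1r ler_pM ?modulus_ge0 ?partial_wave_le1//.
rewrite -(lowpass0 (iter n.+1 (@ord_pred p) k)) (le_trans (hL _ _ _))// subr0.
by rewrite -mulrA ler_wpM2l// normrM ler_wpM2l// ger0_norm ?invN_half.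
Qed.

Local Notation phi_ := (phi N m0 z theta).

Lemma phi_partial_cvg k x (l : C) (L : R) :
  (forall n, modulus (partial_wave n k x - l) <= L / 2 ^+ n) ->
  (phi_partial N m0 z theta k x @ \oo --> (l : C^o)).
Proof.
move=> hl; apply/cvgCP => e e0; have [n0 n0P] := le_half_pow L e0.
exists n0 => n n0n; rewrite phi_partialE (le_lt_trans (hl _))// n0P//.
by rewrite (leq_trans n0n)// leq_pmulr// p_gt0.
Qed.

Lemma phi_limit : exists2 L : R, 0 <= L &
  forall k x n, modulus (partial_wave n k x - phi_ k x) <= L * `|x| / 2 ^+ n.
Proof.
have [L L0 hL] := wave_cvg; exists L => // k x n.
have [l hl] := hL k x; suff -> : phi_ k x = l by exact: hl.
by apply: (cvg_lim (@norm_hausdorff _ C^o) (phi_partial_cvg hl)).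
Qed.

Lemma phi_partial_cvgn k x : cvgn (phi_partial N m0 z theta k x).
Proof.
have [L L0 hL] := wave_cvg; have [l hl] := hL k x.
by apply/cvg_ex; exists l; exact: phi_partial_cvg hl.
Qed.

Lemma phi_approx k x y (e : R) : 0 < e -> exists n,
  modulus (partial_wave n k x - phi_ k x) <= e /\
  modulus (partial_wave n k y - phi_ k y) <= e.
Proof.
move=> e0; have [L L0 hL] := phi_limit.
have [n1 h1] := le_half_pow (L * `|x|) e0.
have [n2 h2] := le_half_pow (L * `|y|) e0.
exists (maxn n1 n2); rewrite !(le_trans (hL _ _ _))//.
- by rewrite ltW// h2// leq_maxr.
- by rewrite ltW// h1// leq_maxl.
Qed.

Lemma phi_le1 k x : modulus (phi_ k x) <= 1.
Proof.
apply/ler_addgt0Pr => e e0; have [n [h _]] := phi_approx k x x e0.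
have -> : phi_ k x = partial_wave n k x - (partial_wave n k x - phi_ k x) by ring.
by rewrite (le_trans (modulusD _ _))// modulusN lerD// partial_wave_le1.
Qed.

Lemma phi_lip : exists2 L : R, 0 <= L &
  forall k x y, modulus (phi_ k x - phi_ k y) <= L * `|x - y|.
Proof.
have [L L0 hL] := lowpass_lip; exists L => // k x y.
apply/ler_addgt0Pr => e e0; have e20 : 0 < e / 2 by rewrite divr_gt0.
have [n [h1 h2]] := phi_approx k x y e20.
have h3 : modulus (partial_wave n k x - partial_wave n k y) <= L * `|x - y|.
  rewrite (le_trans (prod_dist n
     (a := fun s => lowpass (iter s.+1 (@ord_pred p) k) (x / N%:R ^+ s.+1))
     (b := fun s => lowpass (iter s.+1 (@ord_pred p) k) (y / N%:R ^+ s.+1)) _ _))//;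
    try by move=> ?; exact: lowpass_le1.
  have geo : \sum_(s < n) (2 ^+ s.+1)^-1 <= 1 - (2 ^+ n)^-1 :> R.
    elim: (n) => [|m IH]; first by rewrite big_ord0 expr0 invr1 subrr.
    rewrite big_ord_recr /= (le_trans (lerD IH (lexx _)))// exprS invfM; lra.
  apply: (@le_trans _ _ (\sum_(s < n) L * `|x - y| / 2 ^+ s.+1)).
    apply: ler_sum => s _; rewrite (le_trans (hL _ _ _))// -mulrBl normrM -mulrA.
    by rewrite ler_wpM2l// ler_wpM2l// ger0_norm ?invN_half.
  rewrite -mulr_sumr ler_piMr ?mulr_ge0// (le_trans geo)// gerBl invr_ge0 exprn_ge0//.
rewrite (splitr e) (le_trans (modulus_triangle _ (partial_wave n k x) _))//.
rewrite addrCA modulusBC lerD// (le_trans (modulus_triangle _ (partial_wave n k y) _))//.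
by rewrite lerD.
Qed.

Lemma phi0 k : phi_ k 0 = 1.
Proof.
have [L L0 hL] := phi_limit; have := hL k 0 0%N.
rewrite /partial_wave big_ord0 normr0 mulr0 mul0r => h.
apply/esym/eqP; rewrite -subr_eq0 -modulus_eq0 eq_le h modulus_ge0//.
Qed.

(** The two-scale relation, the source of all that follows: it makes
    (phi_1, ..., phi_p) the vector fixed by U_C up to the symbol m0, and the
    periodizations of |phi_k|^2 permuted by the Ruelle operator. *)
Lemma phi_refine k x : phi_ (ordS k) (N%:R * x) = lowpass k x * phi_ k x.
Proof.
have [L L0 hL] := phi_limit.
apply/eqP; rewrite -subr_eq0 -modulus_eq0 eq_le modulus_ge0 andbT.
apply/ler_addgt0Pr => e e0; rewrite add0r.
have [n0 n0P] := le_half_pow (L * `|N%:R * x| + L * `|x|) e0.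
have h1 := hL (ordS k) (N%:R * x) (1 + n0)%N.
have h2 := hL k x n0.
have e1 : partial_wave (1 + n0) (ordS k) (N%:R * x) = lowpass k x * partial_wave n0 k x.
  rewrite partial_waveD /= ordSK expr1 [_ * x]mulrC mulfK ?gt_eqF//; congr (_ * _).
  by rewrite /partial_wave big_ord1 /= ordSK expr1 mulfK// gt_eqF.
rewrite (le_trans (modulus_triangle _ (lowpass k x * partial_wave n0 k x) _))//.
have h3 : modulus (lowpass k x * partial_wave n0 k x - lowpass k x * phi_ k x) <=
    L * `|x| / 2 ^+ n0.
  rewrite -mulrBr modulusM (le_trans _ h2)//.
  by rewrite ler_piMl ?modulus_ge0 ?lowpass_le1.
rewrite -e1 in h3 *; rewrite modulusBC (le_trans (lerD h1 h3))//.
rewrite (le_trans _ (ltW (n0P n0 (leqnn _))))// mulrDl lerD2r.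
rewrite ler_wpM2l ?mulr_ge0// lef_pV2 ?posrE ?exprn_gt0// ler_eXn2l ?ltr1n//; lia.
Qed.

Lemma continuous_phi k : continuous (phi_ k : R -> C^o).
Proof. by have [L L0 hL] := phi_lip; exact: (lip_continuous L0 (hL k)). Qed.

Definition wave2 (k : 'I_p) (x : R) : R := modulus (phi_ k x) ^+ 2.

Lemma wave2_ge0 k x : 0 <= wave2 k x.
Proof. exact: sqr_ge0. Qed.

Lemma wave2_le1 k x : wave2 k x <= 1.
Proof. by rewrite expr_le1 ?modulus_ge0 ?phi_le1. Qed.

Lemma wave20 k : wave2 k 0 = 1.
Proof. by rewrite /wave2 phi0 modulus1 expr1n. Qed.

Lemma wave2_refine k x : wave2 (ordS k) (N%:R * x) = W (z k * E x) * wave2 k x.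
Proof. by rewrite /wave2 phi_refine modulusM exprMn modulus_lowpass. Qed.

Lemma wave2_refineV k x :
  wave2 (ordS k) x = W (z k * E (x / N%:R)) * wave2 k (x / N%:R).
Proof. by rewrite -wave2_refine mulrC mulfVK// gt_eqF. Qed.

Lemma wave2_near1 (e : R) : 0 < e -> exists2 d : R, 0 < d &
  forall k x, `|x| <= d -> 1 - e <= wave2 k x.
Proof.
move=> e0; have [L L0 hL] := phi_lip.
have L1 : 0 < 2 * (L + 1) by lra.
exists (e / (2 * (L + 1))); first by rewrite divr_gt0.
move=> k x; rewrite ler_pdivlMr// => hx.
have := hL k x 0; rewrite phi0 subr0 => h.
have h1 : 1 - modulus (phi_ k x) <= L * `|x|.
  by rewrite (le_trans _ h)// -modulus1 (le_trans (ler_norm _))// distrC modulus_dist.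
have := normr_ge0 x; have := modulus_ge0 (phi_ k x); rewrite /wave2; nra.
Qed.

(** * The periodizations g_k *)

(** The window of length 2 pi has periodization 1.  Applying to it the relation
    satisfied by |phi|^2 preserves this, by the condition on m0, and after n
    steps gives a function above |phi|^2 on [-pi N^n, pi N^n[, hence on any
    finite set of translates of x. *)
Lemma wave2_Per_le1 k x : (Per (wave2 k) x <= 1%:E)%E.
Proof.
pose B := fix B n (k : 'I_p) (y : R) := if n is n'.+1 then
  W (z (ord_pred k) * E (y / N%:R)) * B n' (ord_pred k) (y / N%:R) else window y.
have B0 n : forall k y, 0 <= B n k y.
  elim: n => [|n IH] j y /=; first by rewrite /window ler0n.
  by rewrite mulr_ge0// weight_ge0.
have B1 n : forall k y, Per (B n k) y = 1%E.
  elim: n => [|n IH] j y; first exact: Per_window.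
  rewrite /= -(@Per_step R N (fun u => W (z (ord_pred j) * E u)) (B n (ord_pred j)))//; last 2 first.
  - by move=> u; exact: weight_ge0.
  - by move=> u i; rewrite expi_period.
  under eq_bigr do rewrite IH mule1.
  by rewrite sumEFin weight_sum//; exact: circle_z.
have Bw n : forall k y, - pi <= y / N%:R ^+ n < pi -> wave2 k y <= B n k y.
  elim: n => [|n IH] j y hy /=.
    by move: hy; rewrite expr0 divr1 /window => ->; exact: wave2_le1.
  rewrite -{1}(ord_predK j) wave2_refineV ler_wpM2l ?weight_ge0//.
  by apply: IH; rewrite -mulrA -invfM -exprS.
apply: Per_le => s us.
have [n hn] : exists n, forall j, j \in s -> - pi <= (x + 2 * j%:~R * pi) / N%:R ^+ n < pi.
  pose c := \sum_(j <- s) `|x + 2 * j%:~R * pi|.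
  have [n hn] := le_half_pow c (pi_gt0 R).
  exists n => j js.
  have : `|(x + 2 * j%:~R * pi) / N%:R ^+ n| < pi.
    rewrite normrM (@ger0_norm _ (_ ^-1)) ?invr_ge0 ?exprn_ge0//.
    rewrite (le_lt_trans _ (hn n (leqnn _)))//.
    rewrite ler_pM// ?invr_ge0 ?exprn_ge0 ?invN_half//.
    by rewrite /c (big_rem j)//= lerDl sumr_ge0.
  by rewrite ltr_norml => /andP[/ltW -> ->].
rewrite -lee_fin -(B1 n k x) (le_trans _ (Per_ge _ (B0 n k) us))// lee_fin.
by rewrite big_seq [leRHS]big_seq ler_sum// => j js; apply: Bw; exact: hn.
Qed.

Lemma Per_wave2A (k : 'I_p) (A : R -> R) c x : 0 <= c ->
  (forall y, 0 <= A y <= c) ->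
  (Per (fun y => wave2 k y * A y)%R x \is a fin_num).
Proof.
move=> c0 hA; rewrite ge0_fin_numE; last first.
  by apply: Per_ge0 => y; rewrite mulr_ge0 ?wave2_ge0//; have /andP[] := hA y.
apply: (@le_lt_trans _ _ (c%:E)); last exact: ltry.
apply: (@le_trans _ _ (Per (fun y => c * wave2 k y) x)).
  apply: le_Per => y; rewrite mulrC ler_wpM2r ?wave2_ge0//; by have /andP[] := hA y.
by rewrite PerZ// -[leRHS]mule1 lee_wpmul2l// wave2_Per_le1.
Qed.

Lemma Per_wave2_fin k x : Per (wave2 k) x \is a fin_num.
Proof.
rewrite (_ : Per _ _ = Per (fun y => wave2 k y * 1) x); last first.
  by apply: eq_Per => y; rewrite mulr1.
by apply: (@Per_wave2A k (fun=> 1) 1) => // y; rewrite ler01 lexx.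
Qed.

Definition rruelle (f : C -> R) (w : C) : R :=
  complex.Re (ruelle N m0 (fun v => (f v)%:C) w).

Lemma rruelle_branch f a x : circle a -> rruelle f (a ^+ N * E x) =
  \sum_(r < N) W (a * E (branch N x r)) * f (a * E (branch N x r)).
Proof.
move=> ca; rewrite /rruelle ruelle_branch// raddf_sum; apply: eq_bigr => r _.
by rewrite -rmorphM.
Qed.

Lemma rruelle_E f x : rruelle f (E x) =
  \sum_(r < N) W (E (branch N x r)) * f (E (branch N x r)).
Proof.
have c1 : circle (1 : C) by rewrite circleE modulus1.
have := rruelle_branch f x c1; rewrite expr1n mul1r => ->.
by apply: eq_bigr => r _; rewrite mul1r.
Qed.

Lemma ruelle_real (f : C -> C) (F : C -> R) :
  (forall w, circle w -> f w = (F w)%:C) ->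
  forall w, circle w -> ruelle N m0 f w = (rruelle F w)%:C.
Proof.
move=> fF w /expi_surj[x <-].
have c1 : circle (1 : C) by rewrite circleE modulus1.
have := ruelle_branch m0 hN f x c1; rewrite expr1n mul1r => ->.
rewrite rruelle_E rmorph_sum; apply: eq_bigr => r _.
by rewrite mul1r fF ?rmorphM//; exact: circle_expi.
Qed.

Lemma iter_ruelle_real n (f : C -> C) (F : C -> R) :
  (forall w, circle w -> f w = (F w)%:C) ->
  forall w, circle w -> iter n (ruelle N m0) f w = (iter n rruelle F w)%:C.
Proof. by move=> fF; elim: n => [//|n IH] w cw /=; exact: ruelle_real. Qed.

Lemma rruelle_le f g : (forall w, circle w -> f w <= g w) ->
  forall w, circle w -> rruelle f w <= rruelle g w.
Proof.
move=> fg w /expi_surj[x <-]; rewrite !rruelle_E; apply: ler_sum => r _.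
by rewrite ler_wpM2l ?weight_ge0// fg//; exact: circle_expi.
Qed.

Lemma iter_rruelle_le n f g : (forall w, circle w -> f w <= g w) ->
  forall w, circle w -> iter n rruelle f w <= iter n rruelle g w.
Proof. by move=> fg; elim: n => [//|n IH] w cw /=; exact: rruelle_le. Qed.

Lemma eq_iter_rruelle n f g : (forall w, circle w -> f w = g w) ->
  forall w, circle w -> iter n rruelle f w = iter n rruelle g w.
Proof.
by move=> fg w cw; apply/eqP; rewrite eq_le !iter_rruelle_le// => v cv; rewrite fg.
Qed.

Lemma eq_rruelle f g : (forall w, circle w -> f w = g w) ->
  forall w, circle w -> rruelle f w = rruelle g w.
Proof. exact: (@eq_iter_rruelle 1). Qed.

Lemma iter_rruelle_sum n (I : finType) (a : I -> R) (f : I -> C -> R) w : circle w ->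
  iter n rruelle (fun v => \sum_i a i * f i v) w = \sum_i a i * iter n rruelle (f i) w.
Proof.
elim: n w => [//|n IH] w cw /=.
have [x <-] := expi_surj cw; rewrite !rruelle_E.
under [RHS]eq_bigr do rewrite rruelle_E mulr_sumr.
rewrite exchange_big /=; apply: eq_bigr => r _.
rewrite IH ?mulr_sumr; last exact: circle_expi.
by apply: eq_bigr => i _; rewrite mulrCA.
Qed.

Lemma rruelle_cst (c : R) w : circle w -> rruelle (fun=> c) w = c.
Proof.
move=> /expi_surj[x <-]; rewrite rruelle_E -mulr_suml.
have c1 : circle (1 : C) by rewrite circleE modulus1.
have := weight_sum x c1 => h.
by rewrite -[RHS]mul1r -[in RHS]h; congr (_ * _); apply: eq_bigr => r _; rewrite mul1r.
Qed.

Lemma iter_rruelle_cst n (c : R) w : circle w -> iter n rruelle (fun=> c) w = c.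
Proof.
elim: n w => [//|n IH] w cw /=; rewrite -[RHS](rruelle_cst c cw).
exact: eq_rruelle.
Qed.

Lemma iter_rruelle_addcst n f (c : R) w : circle w ->
  iter n rruelle (fun v => f v + c) w = iter n rruelle f w + c.
Proof.
move=> cw; pose ff (b : bool) := if b then f else fun=> c.
have := iter_rruelle_sum n (fun=> 1) ff cw; rewrite big_bool /= !mul1r.
rewrite iter_rruelle_cst// => <-; apply: eq_iter_rruelle => // v cv.
by rewrite big_bool /= !mul1r.
Qed.

(** The periodization of |phi_k|^2 times A, placed at z_k.  Keeping the factor A
    shows what the iterates of the Ruelle operator do to g_k times a function on
    the circle: they only rescale A (lemma [iter_wave_sum]). *)
Definition wave_sum (k : 'I_p) (A : R -> R) (w : C) : R :=
  fine (Per (fun y => wave2 k y * A y) (argT ((z k)^-1 * w))).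

Lemma coord_z k w : circle w -> exists x, w = z k * E x.
Proof.
move=> cw; have [x xE] := expi_surj (circleM (circleV (circle_z k)) cw).
by exists x; rewrite xE mulrA mulfV ?z_neq0// mul1r.
Qed.

Lemma argT_coord k x : E (argT ((z k)^-1 * (z k * E x))) = E x.
Proof.
by rewrite mulrA mulVf ?z_neq0// mul1r expi_argT//; exact: circle_expi.
Qed.

Lemma wave_sumE k A x :
  wave_sum k A (z k * E x) = fine (Per (fun y => wave2 k y * A y) x).
Proof. by rewrite /wave_sum; congr fine; apply: Per_eq_expi; exact: argT_coord. Qed.

Lemma wave_sum_step k A c : 0 <= c -> (forall y, 0 <= A y <= c) ->
  forall w, circle w ->
  rruelle (wave_sum k A) w = wave_sum (ordS k) (fun y => A (y / N%:R)) w.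
Proof.
move=> c0 hA w cw; have [x ->] := coord_z (ordS k) cw.
rewrite wave_sumE -zX rruelle_branch; last exact: circle_z.
pose V u := W (z k * E u).
have e : Per (fun y => wave2 (ordS k) y * A (y / N%:R)) x =
   Per (fun y => V (y / N%:R) * (wave2 k (y / N%:R) * A (y / N%:R))) x.
  by apply: eq_Per => y; rewrite wave2_refineV mulrA.
rewrite e -(@Per_step _ N V (fun y => wave2 k y * A y))//; last 3 first.
- by move=> y; exact: weight_ge0.
- by move=> y; rewrite mulr_ge0 ?wave2_ge0//; have /andP[] := hA y.
- by move=> y j; rewrite /V expi_period.
have fin r : Per (fun y => wave2 k y * A y) (branch N x r) \is a fin_num.
  exact: Per_wave2A c0 hA.
rewrite (eq_bigr (fun r : 'I_N => (V (branch N x r) * wave_sum k A (z k * E (branch N x r)))%:E)); last first.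
  by move=> r _; rewrite wave_sumE -[in LHS](fineK (fin r)) -EFinM.
by rewrite sumEFin.
Qed.

Lemma iter_wave_sum n k A c : 0 <= c -> (forall y, 0 <= A y <= c) ->
  forall w, circle w ->
  iter n rruelle (wave_sum k A) w =
  wave_sum (iter n (@ordS p) k) (fun y => A (y / N%:R ^+ n)) w.
Proof.
move=> c0 hA; elim: n => [|n IH] w cw.
  by rewrite /wave_sum; congr fine; apply: eq_Per => y; rewrite expr0 divr1.
rewrite /= (eq_rruelle IH)//= (@wave_sum_step _ _ c)//.
rewrite /wave_sum; congr fine; apply: eq_Per => y.
by rewrite exprS invfM mulrA.
Qed.

Definition gwave (k : 'I_p) (w : C) : R := fine (Per (wave2 k) (argT ((z k)^-1 * w))).

Lemma g_E k w : g_ N m0 z theta k w = (gwave k w)%:C.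
Proof. by []. Qed.

Lemma gwave_sum k w : gwave k w = wave_sum k (fun=> 1) w.
Proof. by rewrite /gwave /wave_sum; congr fine; apply: eq_Per => y; rewrite mulr1. Qed.

Lemma gwaveE k x : gwave k (z k * E x) = fine (Per (wave2 k) x).
Proof. by rewrite /gwave; congr fine; apply: Per_eq_expi; exact: argT_coord. Qed.

Lemma gwave_ge0 k w : 0 <= gwave k w.
Proof. by rewrite fine_ge0// Per_ge0// => y; exact: wave2_ge0. Qed.

Lemma gwave_le1 k w : gwave k w <= 1.
Proof. by rewrite -lee_fin fineK ?Per_wave2_fin// wave2_Per_le1. Qed.

Lemma gwave_ge_wave2 k x : wave2 k x <= gwave k (z k * E x).
Proof.
rewrite gwaveE -lee_fin fineK ?Per_wave2_fin//.
have := @Per_ge _ (wave2 k) x [:: 0] (wave2_ge0 k) isT.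
by rewrite big_seq1 mulr0 mul0r addr0.
Qed.

Lemma rruelle_gwave k w : circle w -> rruelle (gwave k) w = gwave (ordS k) w.
Proof.
move=> cw; rewrite (@eq_rruelle _ (wave_sum k (fun=> 1)))//=.
  rewrite (@wave_sum_step _ _ 1)// ?gwave_sum// => y; by rewrite ler01 lexx.
by move=> v cv; rewrite gwave_sum.
Qed.

Lemma iter_rruelle_gwave n k w : circle w ->
  iter n rruelle (gwave k) w = gwave (iter n (@ordS p) k) w.
Proof.
elim: n w => [//|n IH] w cw /=.
by rewrite (eq_rruelle IH)//= rruelle_gwave.
Qed.

Lemma gwave_z k : gwave k (z k) = 1.
Proof.
apply/eqP; rewrite eq_le gwave_le1 /=.
by have := gwave_ge_wave2 k 0; rewrite expi0 mulr1 wave20.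
Qed.

Lemma cycle_weight1 (q : nat) (w : 'I_q -> C) i : is_cycle N m0 w -> W (w i) = 1.
Proof.
case=> _ _ _ _ /(_ i); rewrite modulusE => -[h].
by rewrite /weight h sqr_sqrtr ?ltW// divff// gt_eqF.
Qed.

(** The weights of the N-th roots of a point have sum 1, so a root of weight 1
    leaves nothing for the others. *)
Lemma cycle_backward (q : nat) (w : 'I_q -> C) i v : is_cycle N m0 w ->
  v ^+ N = w (ordS i) -> W v != 0 -> v = w i.
Proof.
move=> hw vN Wv; have [_ _ cw wN _] := hw.
have := roots_branch hN 0 (cw i); rewrite expi0 mulr1 => /seteqP[/(_ v) + _].
rewrite /= wN => /(_ vN)[r _ rv].
have := weight_sum 0 (cw i).
have lt0N : (0 < N)%N by lia.
rewrite (bigD1 (Ordinal lt0N))//= {1}/branch !mulr0 mul0r addr0 mul0r expi0 mulr1.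
rewrite cycle_weight1// -[X in _ = X]addr0 => /addrI h.
have [r0|r0] := eqVneq r (Ordinal lt0N).
  by rewrite -rv r0 /branch !mulr0 mul0r addr0 mul0r expi0 mulr1.
move: h; rewrite (bigD1 r)//= => /eqP; rewrite paddr_eq0 ?weight_ge0//.
  by rewrite rv (negbTE Wv).
by apply: sumr_ge0 => s _; exact: weight_ge0.
Qed.

(** If |phi_k|^2 does not vanish at y, no factor of the product does, so that the
    backward orbit z_{k-n} E(y / N^n) only meets points of positive weight.  When
    z_k E(y) lies on a cycle, where the weight is 1, this backward orbit must
    follow that cycle and is periodic; since y / N^n tends to 0, y is 0. *)
Lemma wave2_cycle (q : nat) (w : 'I_q -> C) i k y : is_cycle N m0 w ->
  z k * E y = w i -> wave2 k y != 0 -> y = 0.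
Proof.
move=> hw zw py.
have step n : wave2 (iter n (@ord_pred p) k) (y / N%:R ^+ n) != 0 /\
    z (iter n (@ord_pred p) k) * E (y / N%:R ^+ n) = w (iter n (@ord_pred q) i).
  elim: n => [|n [IH1 IH2]] /=; first by rewrite expr0 divr1.
  move: IH1 IH2; set k' := iter n _ k; set i' := iter n _ i.
  rewrite -{1}(ord_predK k') wave2_refineV -mulrA -invfM -exprSr.
  rewrite mulf_eq0 negb_or => /andP[Wn pn] e; split => //.
  apply: (cycle_backward hw) => //; rewrite ord_predK -e exprMn zX ord_predK expiX.
  by congr (_ * E _); rewrite exprS; field; rewrite ?expf_neq0 ?gt_eqF.
have per m : E (y / N%:R ^+ (m * (p * q))) = E y.
  have kk : iter (m * (p * q)) (@ord_pred p) k = k.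
    by rewrite [(p * q)%N]mulnC mulnA iter_ord_pred_periodM.
  have ii : iter (m * (p * q)) (@ord_pred q) i = i.
    by rewrite mulnA iter_ord_pred_periodM.
  have [_] := step (m * (p * q))%N.
  by rewrite kk ii -zw => /(mulfI (z_neq0 k)).
have q0 : (0 < q)%N by case: hw.
have pq0 : (0 < p * q)%N by rewrite muln_gt0 p_gt0.
have [n hn] := le_half_pow `|y| (@ltr01 R).
set Q := N%:R ^+ (p * q) : R.
have Q1 : 1 < Q.
  by rewrite /Q exprn_egt1 ?gtn_eqF// (_ : 1 = 1%:R)// ltr_nat; lia.
set t := y / N%:R ^+ (n * (p * q)).
have t1 : `|t| < 1.
  rewrite normrM (@ger0_norm _ (_^-1)) ?invr_ge0 ?exprn_ge0//.
  rewrite (le_lt_trans _ (hn (n * (p * q))%N _)) ?leq_pmulr//.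
  by rewrite ler_wpM2l ?invN_half.
have tt : y / N%:R ^+ (n.+1 * (p * q)) = t / Q.
  by rewrite mulSn exprD invfM -/Q /t [Q^-1 * _]mulrC mulrA.
have : E (t - t / Q) = 1.
  by rewrite expiD expiN -tt !per mulfV// expi_neq0.
have tQ : t - t / Q = t * (1 - Q^-1) by ring.
have Q01 : 0 < 1 - Q^-1 < 1.
  by rewrite subr_gt0 invf_lt1 ?(lt_trans ltr01 Q1)// Q1 /= gtrBl invr_gt0 (lt_trans ltr01 Q1).
move=> /expi_eq1_small h.
have t0 : t * (1 - Q^-1) = 0.
  rewrite -tQ; apply: h; rewrite tQ -ltr_norml normrM.
  have := pi_ge2 R; have /andP[h1 h2] := Q01; rewrite (ger0_norm (ltW h1)).
  have := normr_ge0 t; nra.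
have {}t0 : t = 0.
  by move/eqP: t0; rewrite mulf_eq0 (gt_eqF (proj1 (andP Q01))) orbF => /eqP.
move/eqP: t0; rewrite mulf_eq0 invr_eq0 expf_eq0 (gt_eqF N_gt0) andbF orbF => /eqP//.
Qed.

Lemma gwave_cycle (q : nat) (w : 'I_q -> C) i k : is_cycle N m0 w ->
  w i != z k -> gwave k (w i) = 0.
Proof.
move=> hw wz; have cw : circle (w i) by case: hw.
have [x xE] := coord_z k cw; rewrite xE gwaveE.
rewrite (_ : Per _ _ = 0%E)//; apply: esum1 => j _.
have [->//|/eqP h] := eqVneq (wave2 k (x + 2 * j%:~R * pi)) 0.
have : x + 2 * j%:~R * pi = 0.
  apply: (@wave2_cycle _ _ i k _ hw); last exact/eqP.
  by rewrite expi_period -xE.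
by move=> e; move: wz; rewrite xE -(expi_period x j) e expi0 mulr1 eqxx.
Qed.

Lemma gwave_delta k j : gwave k (z j) = (k == j)%:R.
Proof.
have [->|kj] := eqVneq k j; first by rewrite gwave_z.
apply: (gwave_cycle hz); apply: contraNneq kj => /z_inj->//.
Qed.

Definition arc (k : 'I_p) (d : R) (v : C) : R := (modulus (v - z k) <= d)%R%:R.

Lemma arc01 k d v : 0 <= arc k d v <= 1.
Proof. by rewrite ler0n lern1 leq_b1. Qed.

Lemma gwave_arc k d v : circle v ->
  gwave k v * arc k d v = wave_sum k (fun y => arc k d (z k * E y)) v.
Proof.
move=> cv; have [x ->] := coord_z k cv.
rewrite gwaveE wave_sumE mulrC.
have /andP[a0 _] := arc01 k d (z k * E x).
transitivity (fine ((arc k d (z k * E x))%:E * Per (wave2 k) x)%E).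
  by rewrite fineM ?Per_wave2_fin.
rewrite -PerZ//; congr fine; apply: eq_esum => j _.
by rewrite expi_period mulrC.
Qed.

Lemma Per_approx k x e : 0 < e -> exists2 s : seq int, uniq s &
  fine (Per (wave2 k) x) - e <= \sum_(j <- s) wave2 k (x + 2 * j%:~R * pi).
Proof.
move=> e0; apply: contrapT => hs.
have : (Per (wave2 k) x <= (fine (Per (wave2 k) x) - e)%:E)%E.
  apply: Per_le => s us; rewrite leNgt; apply/negP => h.
  by apply: hs; exists s => //; exact: ltW.
rewrite -[leLHS](fineK (Per_wave2_fin k x)) lee_fin; lra.
Qed.

(** Under R^(m p) the cut-off at z_k is rescaled to y -> arc (y / N^(m p)), which
    is 1 on any given finite set of translates of x once m is large. *)
Lemma gwave_liminf k d e w : 0 < d -> 0 < e -> circle w ->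
  exists M, forall m, (M <= m)%N ->
  gwave k w - e <= iter (m * p) rruelle (fun v => gwave k v * arc k d v) w.
Proof.
move=> d0 e0 cw; have [x xE] := coord_z k cw.
have [s us hs] := Per_approx k x e0.
pose c := \sum_(j <- s) `|x + 2 * j%:~R * pi|.
have d20 : 0 < d / 2 by rewrite divr_gt0.
have [M hM] := le_half_pow c d20; exists M => m Mm.
rewrite (@eq_iter_rruelle _ _ (wave_sum k (fun y => arc k d (z k * E y))))//; last first.
  by move=> v cv; rewrite gwave_arc.
rewrite (@iter_wave_sum _ _ _ 1)//; last by move=> y; exact: arc01.
rewrite iter_ordS_periodM xE gwaveE wave_sumE (le_trans hs)//.
set A := fun y : R => _.
have fin : Per (fun y => wave2 k y * arc k d (z k * E (y / N%:R ^+ (m * p)))) x \is a fin_num.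
  by apply: (@Per_wave2A _ _ 1) => // y; exact: arc01.
rewrite -lee_fin fineK//.
have := @Per_ge _ (fun y => wave2 k y * arc k d (z k * E (y / N%:R ^+ (m * p)))) x s.
move=> /(_ _ us) h; apply: le_trans (h _); last first.
  by move=> y; rewrite mulr_ge0 ?wave2_ge0//; have /andP[] := arc01 k d (z k * E (y / N%:R ^+ (m * p))).
rewrite lee_fin big_seq [leRHS]big_seq ler_sum// => j js.
rewrite (_ : arc _ _ _ = 1) ?mulr1// /arc; apply/eqP; rewrite pnatr_eq1 eqb1.
rewrite modulus_coord -expi0 (le_trans (expi_lip _ _))// subr0 -ler_pdivlMl// [2^-1 * d]mulrC.
rewrite normrM (@ger0_norm _ (_^-1)) ?invr_ge0 ?exprn_ge0//.
rewrite (le_trans _ (ltW (hM (m * p)%N _)))//; last first.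
  by rewrite (leq_trans Mm)// leq_pmulr// p_gt0.
rewrite ler_pM// ?invr_ge0 ?exprn_ge0 ?invN_half//.
by rewrite /c (big_rem j)//= lerDl sumr_ge0.
Qed.

(** * Minimality and Lipschitz bounds *)

Lemma cycle_separated : exists2 d : R, 0 < d &
  forall k j v, modulus (v - z k) <= d -> modulus (v - z j) <= d -> k = j.
Proof.
pose m := \sum_k \sum_j (if k == j then 0 else (modulus (z k - z j))^-1).
have m0' : 0 <= m.
  apply: sumr_ge0 => k _; apply: sumr_ge0 => j _.
  by case: ifP => // _; rewrite invr_ge0 modulus_ge0.
have m1 : 0 < m + 1 by lra.
exists (3 * (m + 1))^-1; first by rewrite invr_gt0 mulr_gt0.
move=> k j v hk hj; apply: contrapT => /eqP kj.
have zz : 0 < modulus (z k - z j).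
  by rewrite lt_neqAle modulus_ge0 eq_sym modulus_eq0 subr_eq0 (inj_eq z_inj) kj.
have h : modulus (z k - z j) <= 2 * (3 * (m + 1))^-1.
  rewrite (le_trans (modulus_triangle _ v _))// mulr_natl mulr2n lerD//.
  by rewrite modulusBC.
have : (modulus (z k - z j))^-1 <= m.
  rewrite /m (bigD1 k)//= (bigD1 j)//= (negbTE kj) -addrA lerDl addr_ge0//.
    by apply: sumr_ge0 => i _; case: ifP => // _; rewrite invr_ge0 modulus_ge0.
  apply: sumr_ge0 => i _; apply: sumr_ge0 => l _.
  by case: ifP => // _; rewrite invr_ge0 modulus_ge0.
set M := modulus _ in zz h *; move=> hM.
have MM : M^-1 * M = 1 by rewrite mulVf// gt_eqF.
have XX : (3 * (m + 1))^-1 * (3 * (m + 1)) = 1 by rewrite mulVf// gt_eqF// mulr_gt0.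
have X0 : 0 < (3 * (m + 1))^-1 by rewrite invr_gt0 mulr_gt0.
have h1 : M^-1 * M <= m * M by rewrite ler_wpM2r// ltW.
have h2 : m * M <= m * (2 * (3 * (m + 1))^-1) by rewrite ler_wpM2l.
move: h1 h2 XX X0; rewrite MM; set X := _^-1; nra.
Qed.

(** As g_k <= 1, near z_k the function h' is at least (lam - e) g_k.  So it
    dominates (lam - e) times the sum of the cut-offs of the g_k to small disjoint
    arcs.  The iterates of the Ruelle operator fix h' and bring the cut-off of g_k
    back to g_k. *)
Lemma harmonic_ge (h' : C -> R) (lam : R) : 0 <= lam ->
  (forall w, circle w -> 0 <= h' w) ->
  (forall w, circle w -> rruelle h' w = h' w) ->
  (forall e, 0 < e -> exists2 d, 0 < d & forall k v, circle v ->
     modulus (v - z k) <= d -> lam - e <= h' v) ->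
  forall w, circle w -> lam * \sum_k gwave k w <= h' w.
Proof.
move=> lam0 h'0 hh hc w cw.
move: lam0; rewrite le_eqVlt => /orP[/eqP<-|lam0]; first by rewrite mul0r h'0.
have iterh n v : circle v -> iter n rruelle h' v = h' v.
  elim: n v => [//|n IH] v cv /=; rewrite -[RHS]hh//; exact: eq_rruelle.
have [d1 d10 hd1] := cycle_separated.
have S1 : \sum_k gwave k w <= p%:R.
  rewrite -[X in _ <= X%:R](card_ord p) -sum1_card natr_sum ler_sum// => k _.
  exact: gwave_le1.
pose cst : R := p%:R + lam * p%:R + 1.
have cst0 : 0 < cst by rewrite /cst ltr_wpDl// addr_ge0// mulr_ge0// ltW.
apply/ler_addgt0Pr => e' e'0.
pose e := Num.min lam (e' / cst).
have e0 : 0 < e by rewrite lt_min lam0 divr_gt0.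
have elam : e <= lam by rewrite ge_min lexx.
have ee' : e * cst <= e' by rewrite -ler_pdivlMr// ge_min lexx orbT.
have [d2 d20 hd2] := hc _ e0.
pose d := Num.min d1 d2.
have d0 : 0 < d by rewrite lt_min d10.
have le_arc v : circle v -> \sum_k (lam - e) * (gwave k v * arc k d v) <= h' v.
  move=> cv.
  have [[k hk]|hn] := pselect (exists k, modulus (v - z k) <= d).
    rewrite (bigD1 k)//= big1 ?addr0.
      rewrite /arc hk mulr1 (@le_trans _ _ (lam - e))//.
        by rewrite ler_piMr ?gwave_le1// subr_ge0.
      by apply: (hd2 k) => //; rewrite (le_trans hk)// ge_min lexx orbT.
    move=> j jk; rewrite /arc; case: (boolP (_ <= d)) => [hj|_]; last by rewrite !mulr0.
    have dd1 : d <= d1 by rewrite ge_min lexx.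
    by move: jk; rewrite (hd1 j k v) ?eqxx// ?(le_trans _ dd1).
  rewrite big1 ?h'0// => k _; rewrite /arc.
  by rewrite (_ : (_ <= d) = false) ?mulr0//; apply/negP => hk; apply: hn; exists k.
have [M hM] : exists M, forall k, gwave k w - e <=
    iter (M * p) rruelle (fun v => gwave k v * arc k d v) w.
  have /choice[M hM] : forall k, exists M, forall m, (M <= m)%N ->
      gwave k w - e <= iter (m * p) rruelle (fun v => gwave k v * arc k d v) w.
    by move=> k; exact: gwave_liminf.
  exists (\max_k M k)%N => k; apply: hM; exact: leq_bigmax.
have := iter_rruelle_le (M * p) le_arc cw.
rewrite iterh// iter_rruelle_sum// => h.
have : \sum_k (lam - e) * (gwave k w - e) <= h' w.
  by rewrite (le_trans _ h)// ler_sum// => k _; rewrite ler_wpM2l// subr_ge0.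
rewrite -mulr_sumr sumrB sumr_const card_ord => {}h.
have pe : 0 <= p%:R :> R by [].
rewrite -[e *+ p]mulr_natr in h.
move: h ee' S1; rewrite /cst; set S := \sum_k _; set P := p%:R => h ee' S1.
have S0 : 0 <= S by apply: sumr_ge0 => k _; exact: gwave_ge0.
have : 0 <= e * (P - S) by rewrite mulr_ge0 ?subr_ge0// ltW.
have : 0 <= e * e * P by rewrite !mulr_ge0// ltW.
move: h ee'; rewrite !mulrDl !mulrDr; nra.
Qed.

Definition angle_lip (L : R) (F : C -> R) : Prop :=
  forall x y, `|F (E x) - F (E y)| <= L * `|x - y|.

Lemma weight_lip : exists2 L : R, 0 <= L & angle_lip L W.
Proof.
have [L L0 hL] := (lipschitzTP _).1 m0_lip.
exists (2 * sN * (L * 2) / N%:R).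
  by rewrite divr_ge0 ?mulr_ge0 ?sqrtr_ge0// ltW.
move=> x y; rewrite /weight -mulrBl normrM (@ger0_norm _ (_^-1)) ?invr_ge0//.
rewrite [leRHS]mulrAC ler_pM2r ?invr_gt0// subr_sqr normrM -[leRHS]mulrA [leLHS]mulrC.
rewrite ler_pM//.
  rewrite (le_trans (ler_normD _ _))// !ger0_norm ?modulus_ge0//.
  by have := modulus_m0_le (circle_expi x); have := modulus_m0_le (circle_expi y); lra.
rewrite (le_trans (modulus_dist _ _))// (le_trans (hL _ _ _ _))//; try exact: circle_expi.
by rewrite -mulrA ler_wpM2l// expi_lip.
Qed.

(** A Lasota--Yorke inequality: the inverse branches contract distances by N >= 2
    and the weights have sum 1, so that the Lipschitz constant is halved up to a
    constant coming from the weight. *)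
Lemma rruelle_lip : exists2 K : R, 0 <= K & forall L F, 0 <= L -> angle_lip L F ->
  (forall w, circle w -> 0 <= F w <= 1) -> angle_lip (L / 2 + K) (rruelle F).
Proof.
have [K K0 hK] := weight_lip; exists K => // L F L0 hF F01 x y.
have cE := @circle_expi R.
rewrite !rruelle_E -sumrB.
have bxy r : `|branch N x r - branch N y r| = `|x - y| / N%:R.
  rewrite /branch -mulrBl opprD addrACA subrr addr0 normrM (@ger0_norm _ (_^-1)) ?invr_ge0//.
apply: (@le_trans _ _ (\sum_(r < N) (W (E (branch N x r)) * (L * (`|x - y| / N%:R))
    + K * (`|x - y| / N%:R)))).
  rewrite (le_trans (ler_norm_sum _ _ _))// ler_sum// => r _.
  set u := E (branch N x r); set v := E (branch N y r).
  have -> : W u * F u - W v * F v = W u * (F u - F v) + (W u - W v) * F v by ring.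
  rewrite (le_trans (ler_normD _ _))// [X in X + _]normrM [X in _ + X]normrM lerD//.
    rewrite ger0_norm ?weight_ge0// ler_wpM2l ?weight_ge0// -(bxy r); exact: hF.
  have /andP[Fv0 Fv1] := F01 v (cE _).
  rewrite (ger0_norm Fv0) -(bxy r) -[leRHS]mulr1 ler_pM//; exact: hK.
rewrite big_split /= -mulr_suml sumr_const card_ord.
have c1 : circle (1 : C) by rewrite circleE modulus1.
have -> : \sum_(r < N) W (E (branch N x r)) = 1.
  by rewrite -(weight_sum x c1); apply: eq_bigr => r _; rewrite mul1r.
have -> : (K * (`|x - y| / N%:R)) *+ N = K * `|x - y|.
  by rewrite -mulrnAr -[X in K * X]mulr_natr mulfVK// gt_eqF.
rewrite mul1r mulrDl lerD2r -mulrA ler_wpM2l// mulrC ler_wpM2r//.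
by rewrite lef_pV2 ?posrE// ler_nat.
Qed.

Lemma iter_rruelle_lip : exists2 K : R, 0 <= K & forall L F, 0 <= L -> angle_lip L F ->
  (forall w, circle w -> 0 <= F w <= 1) -> forall n,
  angle_lip (L / 2 ^+ n + K) (iter n rruelle F).
Proof.
have [K K0 hK] := rruelle_lip; exists (2 * K); first by rewrite mulr_ge0.
move=> L F L0 hF F01; elim=> [|n IH].
  by move=> x y; rewrite (le_trans (hF x y))// ler_wpM2r// expr0 divr1 lerDl mulr_ge0.
have Ln : 0 <= L / 2 ^+ n + 2 * K by rewrite addr_ge0 ?divr_ge0 ?mulr_ge0// exprn_ge0.
have In w : circle w -> 0 <= iter n rruelle F w <= 1.
  move=> cw; rewrite -{1}(iter_rruelle_cst n 0 cw) -(iter_rruelle_cst n 1 cw).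
  by rewrite !iter_rruelle_le// => v cv; have /andP[] := F01 v cv.
move=> x y; rewrite /= (le_trans (hK _ _ Ln IH In x y))// ler_wpM2r//.
rewrite exprS invfM.
have -> : L * (2^-1 * (2 ^+ n)^-1) = L / 2 ^+ n / 2 by rewrite mulrCA mulrC.
lra.
Qed.

Lemma angle_lip_circle (F : C -> R) L : 0 <= L -> angle_lip L F ->
  (forall w, circle w -> 0 <= F w <= 1) ->
  forall w v, circle w -> circle v -> `|F w - F v| <= (2 * L + 1) * modulus (w - v).
Proof.
move=> L0 hF F01 w v cw cv.
have [ge1|lt1] := leP 1 (modulus (w - v)).
  have /andP[a b] := F01 w cw; have /andP[c d] := F01 v cv.
  apply: (@le_trans _ _ 1); first by rewrite ler_norml; apply/andP; split; lra.
  by rewrite -[leLHS]mul1r ler_pM//; lra.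
have [x0 xw] := expi_surj cw; have [y yv] := expi_surj cv.
have [j /andP[h1 h2]] := mod2pi (- pi) (x0 - y).
set x := x0 + 2 * j%:~R * pi.
have xw' : E x = w by rewrite /x expi_period.
have exy : modulus (E (x - y) - 1) = modulus (w - v).
  rewrite -xw' -yv expiD expiN -[X in _ - X](mulfV (expi_neq0 y)) -mulrBl.
  by rewrite modulusM modulusV modulus_expi invr1 mulr1.
have := @expi_near1 R (x - y); rewrite exy => /(_ _ lt1) h.
have {}h : `|x - y| <= 2 * modulus (w - v).
  by apply: h; rewrite /x; apply/andP; split; lra.
rewrite -xw' -yv (le_trans (hF x y))// xw' yv (le_trans (ler_wpM2l L0 h))//.
rewrite mulrA [L * 2]mulrC ler_wpM2r ?modulus_ge0//; lra.
Qed.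

(** In the coordinate at z_k this is (1 + cos u) / 2, a trigonometric polynomial
    between 0 and 1 which is 1 only at z_k.  If m0 is a trigonometric
    polynomial, the Ruelle operator keeps the powers of the bump among them. *)
Definition bump (k : 'I_p) (v : C) : R := (1 + complex.Re ((z k)^-1 * v)) / 2.

Lemma bumpE k v : circle v -> bump k v = 1 - modulus (v - z k) ^+ 2 / 4.
Proof.
move=> cv; have [u ->] := coord_z k cv.
rewrite modulus_coord modulus2 /bump mulrA mulVf ?z_neq0// mul1r /= oppr0 addr0.
have := cos2Dsin2 u; lra.
Qed.

Lemma bump01 k v : circle v -> 0 <= bump k v <= 1.
Proof.
move=> cv; rewrite {2}bumpE// /bump.
have h : `|complex.Re ((z k)^-1 * v)| <= 1.
  rewrite (le_trans (Re_le_modulus _))// modulusM modulusV.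
  have /circleE -> := circle_z k; have /circleE -> := cv.
  by rewrite invr1 mulr1.
have := sqr_ge0 (modulus (v - z k)); move: h; rewrite ler_norml => /andP[]; lra.
Qed.

Lemma bump_lip k K : exists2 L : R, 0 <= L & angle_lip L (fun v => bump k v ^+ K).
Proof.
elim: K => [|K [L L0 IH]].
  by exists 0 => // x y; rewrite subrr normr0 mul0r.
exists (L + 1) => [|x y]; first by rewrite addr_ge0.
have /andP[a0 a1] := bump01 k (circle_expi x).
have /andP[b0 b1] := bump01 k (circle_expi y).
rewrite !exprS; set a := bump k (E x); set b := bump k (E y).
have -> : a * a ^+ K - b * b ^+ K = a * (a ^+ K - b ^+ K) + (a - b) * b ^+ K by ring.
rewrite (le_trans (ler_normD _ _))// [X in X + _]normrM [X in _ + X]normrM mulrDl lerD//.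
  rewrite (ger0_norm a0) -[leRHS]mul1r ler_pM//; exact: IH.
rewrite mul1r -[leRHS]mulr1 ler_pM//; last by rewrite ger0_norm ?exprn_ge0// exprn_ile1.
have -> : a - b = (complex.Re ((z k)^-1 * E x) - complex.Re ((z k)^-1 * E y)) / 2.
  rewrite /a /b /bump; lra.
rewrite normrM -raddfB -mulrBr.
have h := Re_le_modulus ((z k)^-1 * (E x - E y)).
rewrite (@ger0_norm _ (_^-1))// ler_pdivrMr// (le_trans h)// modulusM modulusV.
have /circleE -> := circle_z k; rewrite invr1 mul1r mulrC; exact: expi_lip.
Qed.

Lemma gwave_near1 e : 0 < e -> exists2 d, 0 < d &
  forall k v, circle v -> modulus (v - z k) <= d -> 1 - e <= gwave k v.
Proof.
move=> e0; have [d d0 hd] := wave2_near1 e0.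
exists (Num.min (d / 2) (2^-1)); first by rewrite lt_min divr_gt0//= invr_gt0.
move=> k v cv; rewrite le_min => /andP[h1 h2].
have [x0 xv] := coord_z k cv.
have [j /andP[h3 h4]] := mod2pi (- pi) x0; set x := x0 + 2 * j%:~R * pi in h3 h4.
have xE : v = z k * E x by rewrite /x expi_period.
have em : modulus (v - z k) = modulus (E x - 1).
  by rewrite xE modulus_coord.
have h5 := @expi_near1 R x.
rewrite xE (le_trans _ (gwave_ge_wave2 k x))// hd//.
rewrite (le_trans (h5 _ _))//; first by lra.
  by rewrite -em (le_lt_trans h2)// invf_lt1// ltr1n.
by rewrite -em mulrC -ler_pdivlMr.
Qed.

(** A high power of the bump is small away from z_k, where g_k is only known to be
    nonnegative, and at most 1 near z_k, where g_k is close to 1. *)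
Lemma bump_near k e : 0 < e -> exists K, (exists2 d, 0 < d & forall v, circle v ->
     modulus (v - z k) <= d -> 1 - e <= bump k v ^+ K) /\
  forall v, circle v -> bump k v ^+ K <= gwave k v + e.
Proof.
move=> e0; have [d d0 hd] := gwave_near1 e0.
pose d' := Num.min d 1; have d'0 : 0 < d' by rewrite lt_min d0 ltr01.
have d'1 : d' <= 1 by rewrite ge_min lexx orbT.
have d'd : d' <= d by rewrite ge_min lexx.
pose rho := 1 - d' ^+ 2 / 4.
have rho0 : 0 <= rho by rewrite /rho; nra.
have rho1 : rho < 1 by rewrite /rho; nra.
have [K hK] : exists K, rho ^+ K <= e.
  have rr : `|rho| < 1 by rewrite ger0_norm.
  have /cvgRP/(_ e e0)[K hK] := cvg_expr rr.
  by exists K; have := hK K (leqnn K); rewrite subr0 ger0_norm ?exprn_ge0// => /ltW.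
exists K; split.
  exists (Num.min 1 (e / K.+1%:R)); first by rewrite lt_min ltr01 divr_gt0.
  move=> v cv; rewrite le_min ler_pdivlMr// => /andP[h1 h2].
  set t := modulus (v - z k) in h1 h2; have t0 : 0 <= t by exact: modulus_ge0.
  have bern n : 1 - n%:R * t <= bump k v ^+ n.
    elim: n => [|n IH]; first by rewrite mul0r subr0 expr0.
    have /andP[b0 b1] := bump01 k cv.
    have b2 : 1 - t <= bump k v by rewrite bumpE// -/t; nra.
    rewrite exprS -natr1 mulrDl mul1r.
    have c0 : 0 <= bump k v ^+ n by rewrite exprn_ge0.
    have c1 : bump k v ^+ n <= 1 by rewrite exprn_ile1.
    nra.
  rewrite (le_trans _ (bern K))// lerD2l lerN2 mulrC (le_trans _ h2)//.
  by rewrite ler_wpM2l// ler_nat.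
move=> v cv; have /andP[b0 b1] := bump01 k cv.
have [h|h] := leP (modulus (v - z k)) d'.
  have := hd k v cv (le_trans h d'd).
  have : bump k v ^+ K <= 1 by rewrite exprn_ile1.
  lra.
have g0 := gwave_ge0 k v.
have : bump k v ^+ K <= rho ^+ K.
  rewrite lerXn2r ?nnegrE// bumpE// /rho lerD2l lerN2 ler_pM2r ?invr_gt0//.
  by rewrite lerXn2r ?nnegrE ?modulus_ge0// ltW.
lra.
Qed.

(** From above, b^K <= g_k + e is preserved by the iterates, which fix g_k; from
    below, b^K is nearly 1 on an arc, and the cut-off of g_k to that arc returns
    to g_k. *)
Lemma bump_iter_cvg k e : 0 < e -> exists K, forall w, circle w ->
  exists M, forall m, (M <= m)%N ->
  `|iter (m * p) rruelle (fun v => bump k v ^+ K) w - gwave k w| <= e.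
Proof.
move=> e0; have e20 : 0 < e / 2 by rewrite divr_gt0.
pose e1 := Num.min (e / 2) (2^-1).
have e10 : 0 < e1 by rewrite lt_min e20 invr_gt0 /= ltr0n.
have [K [[d d0 hd] hK]] := bump_near k e10.
exists K => w cw.
have [M hM] := gwave_liminf k d0 e20 cw; exists M => m Mm.
have e1e : e1 <= e / 2 by rewrite ge_min lexx.
have e12 : e1 <= 2^-1 by rewrite ge_min lexx orbT.
rewrite ler_norml; apply/andP; split; last first.
  rewrite lerBlDl.
  have := iter_rruelle_le (m * p) hK cw.
  rewrite iter_rruelle_addcst// iter_rruelle_gwave// iter_ordS_periodM; lra.
have low v : circle v -> \sum_(i : unit) (1 - e1) * (gwave k v * arc k d v) <= bump k v ^+ K.
  move=> cv; rewrite big_const cardE enumT unlock /= addr0 /arc.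
  have /andP[b0 b1] := bump01 k cv.
  case: (boolP (_ <= d)) => [h|_]; last by rewrite !mulr0 exprn_ge0.
  rewrite mulr1 (le_trans _ (hd v cv h))// ler_piMr ?gwave_le1//; lra.
have := iter_rruelle_le (m * p) low cw.
rewrite iter_rruelle_sum// big_const cardE enumT unlock /= addr0 => h.
have g1 := gwave_le1 k w; have g0 := gwave_ge0 k w; have := hM m Mm.
move: h; set X := iter _ _ _ _; set Y := iter _ _ _ _ => h h2.
have : (1 - e1) * (gwave k w - e / 2) <= (1 - e1) * X by rewrite ler_wpM2l//; lra.
nra.
Qed.

(** The iterates of a power of the bump come close to g_k, and
    [iter_rruelle_lip] bounds their Lipschitz constants uniformly. *)
Lemma gwave_angle_lip : exists2 K : R, 0 <= K & forall k, angle_lip K (gwave k).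
Proof.
have [K K0 hK] := iter_rruelle_lip; exists K => // k x y.
apply/ler_addgt0Pr => e e0; have e30 : 0 < e / 3 by rewrite divr_gt0.
have [q hq] := bump_iter_cvg k e30.
have [L L0 hL] := bump_lip k q.
have [M1 h1] := hq _ (circle_expi x); have [M2 h2] := hq _ (circle_expi y).
have [M3 h3] := le_half_pow (L * `|x - y|) e30.
pose m := (M1 + M2 + M3)%N.
have {}h1 := h1 m _; have {}h2 := h2 m _.
have m3 : (M3 <= m * p)%N := leq_trans (leq_addl (M1 + M2) M3) (leq_pmulr _ p_gt0).
have {}h3 := ltW (h3 _ m3).
have b01 w : circle w -> 0 <= bump k w ^+ q <= 1.
  by move=> cw; have /andP[b0 b1] := bump01 k cw; rewrite exprn_ge0//= exprn_ile1.
have h4 := hK _ _ L0 hL b01 (m * p)%N x y.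
have m1 : (M1 <= m)%N by rewrite /m; lia.
have m2 : (M2 <= m)%N by rewrite /m; lia.
move: (h1 m1) (h2 m2) h4 => {h1 h2}.
set X := iter _ _ _ _; set Y := iter _ _ _ _; rewrite mulrDl mulrAC => h1 h2 h4.
have split4 (a b c d : R) : a - b = - (c - a) + ((c - d) + (d - b)) by ring.
rewrite (split4 _ _ X Y).
rewrite (le_trans (ler_normD _ _))// normrN.
rewrite (le_trans (lerD h1 (ler_normD _ _)))//.
rewrite (le_trans (lerD (lexx _) (lerD h4 h2)))//.
move: h3; move: (L * _ / _) (K * _) => a b {h1 h2 h4 X Y m1 m2 m3 b01 m}; lra.
Qed.

Lemma gwave_lip : exists2 L : R, 0 <= L & forall k w v, circle w -> circle v ->
  `|gwave k w - gwave k v| <= L * modulus (w - v).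
Proof.
have [K K0 hK] := gwave_angle_lip.
exists (2 * K + 1); first by rewrite addr_ge0// mulr_ge0.
move=> k; apply: angle_lip_circle => // w cw.
by rewrite gwave_ge0 gwave_le1.
Qed.

(** * Trigonometric polynomials *)

(** The degree bound is what the Ruelle operator improves: P(w) / w^D with P of
    degree at most 2 D. *)
Definition trigdeg (D : nat) (f : C -> C) : Prop :=
  exists2 P : {poly C}, (size P <= D.*2.+1)%N &
    forall w, circle w -> f w = P.[w] / w ^+ D.

Lemma trigpolyP f : trigpoly f <-> exists D, trigdeg D f.
Proof.
split=> [[n [a fa]]|[D [P sP fP]]].
  exists n, (\poly_(j < n.*2.+1) a j); first exact: size_poly.
  move=> w cw; rewrite fa// horner_poly big_mkord mulr_suml.
  apply: eq_bigr => j _; have w0 := circle_neq0 cw.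
  by rewrite expfzDr// -mulrA exprnN.
exists D, (fun j => P`_j) => w cw; rewrite fP// (horner_coef_wide _ sP) big_mkord mulr_suml.
apply: eq_bigr => j _; have w0 := circle_neq0 cw.
by rewrite expfzDr// -mulrA exprnN.
Qed.

Lemma eq_trigdeg D f g : (forall w, circle w -> f w = g w) -> trigdeg D f -> trigdeg D g.
Proof. by move=> fg [P sP fP]; exists P => // w cw; rewrite -fg// fP. Qed.

Lemma trigdeg_widen D D' f : (D <= D')%N -> trigdeg D f -> trigdeg D' f.
Proof.
move=> DD [P sP fP]; exists (P * 'X^(D' - D)).
  have [->|P0] := eqVneq P 0; first by rewrite mul0r size_poly0.
  by rewrite size_mulXn//; lia.
move=> w cw; have w0 := circle_neq0 cw.
rewrite fP// hornerM hornerXn -{2}(subnKC DD) exprD invfM mulrA mulrAC.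
by rewrite mulfK// expf_neq0.
Qed.

Lemma trigdegM D D' f g : trigdeg D f -> trigdeg D' g ->
  trigdeg (D + D') (fun w => f w * g w).
Proof.
move=> [P sP fP] [Q sQ gQ]; exists (P * Q).
  by rewrite (leq_trans (size_polyMleq _ _))//; lia.
by move=> w cw; rewrite fP// gQ// hornerM exprD invfM mulrACA.
Qed.

Lemma trigdegX D f K : trigdeg D f -> trigdeg (K * D) (fun w => f w ^+ K).
Proof.
move=> fD; elim: K => [|K IH].
  exists 1; first by rewrite size_poly1.
  by move=> w cw; rewrite hornerC !expr0 divr1.
by rewrite mulSn; apply: eq_trigdeg (trigdegM fD IH) => w _; rewrite exprS.
Qed.

Lemma trigdeg_conj D f : trigdeg D f -> trigdeg D (fun w => (f w)^*%C).
Proof.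
move=> [P sP fP].
exists (\poly_(j < D.*2.+1) (P`_(D.*2 - j))^*%C); first exact: size_poly.
move=> w cw; have w0 := circle_neq0 cw.
have cjw : w^*%C = w^-1.
  by have [x <-] := expi_surj cw; rewrite expi_conj.
rewrite fP// (horner_coef_wide _ sP) horner_poly.
rewrite rmorphM /= rmorph_sum /= fmorphV /= rmorphXn /= cjw exprVn invrK.
rewrite mulr_suml [LHS](reindex_inj rev_ord_inj) /= mulr_suml; apply: eq_bigr => j _.
have jD := ltn_ord j.
rewrite rmorphM /= rmorphXn /= cjw -!mulrA; congr (_^*%C * _).
have e : (j + (D.*2 - j) = D + D)%N by lia.
apply: (mulIf (expf_neq0 D w0)); rewrite mulfVK ?expf_neq0// -mulrA -exprD -e exprD.
by rewrite subSS exprVn mulrCA mulVf ?mulr1// expf_neq0.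
Qed.

Lemma trigdeg_sum D (I : finType) (a : I -> C) (F : I -> C -> C) :
  (forall i, trigdeg D (F i)) -> trigdeg D (fun w => \sum_i a i * F i w).
Proof.
move=> hF; have /choice[P hP] : forall i, exists P : {poly C},
    (size P <= D.*2.+1)%N /\ forall w, circle w -> F i w = P.[w] / w ^+ D.
  by move=> i; have [P sP fP] := hF i; exists P.
exists (\sum_i a i *: P i).
  rewrite (leq_trans (size_sum _ _ _))//; apply/bigmax_leqP => i _.
  by rewrite (leq_trans (size_scale_leq _ _))//; exact: (hP i).1.
move=> w cw; rewrite horner_sum mulr_suml; apply: eq_bigr => i _.
by rewrite (hP i).2// hornerZ mulrA.
Qed.

(** The sum of v^(j - D) over the N-th roots v of w vanishes unless N divides
    j - D, and is then N w^((j - D) / N). *)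
Lemma trig_average (D j : nat) : (j < D.*2.+1)%N ->
  trigdeg (D %/ N) (fun w => \sum_(v \in [set v : C | v ^+ N = w]) (v ^+ j / v ^+ D)).
Proof.
move=> jD.
have c1 : circle (1 : C) by rewrite circleE modulus1.
have sumE w x : E x = w -> \sum_(v \in [set v : C | v ^+ N = w]) (v ^+ j / v ^+ D) =
    \sum_(r < N) (E (branch N x r) ^+ j / E (branch N x r) ^+ D).
  move=> xw; have := root_sum_branch hN (fun v => v ^+ j / v ^+ D) x c1.
  by rewrite expr1n mul1r xw => ->; apply: eq_bigr => r _; rewrite !mul1r.
have N00 : (0 < N)%N by lia.
have term x r : E (branch N x r) ^+ j / E (branch N x r) ^+ D =
    E ((j%:R - D%:R) * branch N x r).
  by rewrite !expiX -expiN -expiD; congr E; ring.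
have [Nd|Nnd] := boolP (N %| `|j%:Z - D%:Z|%N)%N.
  have [i hi] : exists i : int, j%:Z - D%:Z = i * N%:Z.
    by apply/dvdzP; rewrite /dvdz/=.
  have iD : (`|i| <= D %/ N)%N by rewrite leq_divRL//; nia.
  pose e := absz (i + (D %/ N)%:Z).
  have eE : e%:Z = i + (D %/ N)%:Z by rewrite /e; lia.
  exists (N%:R *: 'X^e).
    rewrite (leq_trans (size_scale_leq _ _))// size_polyXn; lia.
  move=> w cw; have [x xw] := expi_surj cw.
  rewrite (sumE _ x)// hornerZ hornerXn -xw !expiX -expiN -mulrA -expiD.
  rewrite (eq_bigr (fun=> E (e%:R * x - (D %/ N)%:R * x))); last first.
    move=> r _; rewrite term.
    have jDi : j%:R - D%:R = i%:~R * N%:R :> R.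
      by rewrite pmulrn (pmulrn _ D) -intrB hi intrM -pmulrn.
    have ei : e%:R = i%:~R + (D %/ N)%:R :> R by rewrite pmulrn eE intrD -pmulrn.
    have -> : e%:R * x - (D %/ N)%:R * x = i%:~R * x by rewrite ei; ring.
    rewrite jDi -mulrA branchK// mulrDr.
    have -> : i%:~R * (2 * r%:~R * pi) = 2 * (i * r)%:~R * pi :> R by rewrite intrM; ring.
    by rewrite expi_period.
  by rewrite big_const_ord iter_addr addr0 [RHS]mulr_natl.
exists 0; first by rewrite size_poly0.
move=> w cw; have [x xw] := expi_surj cw.
rewrite horner0 mul0r (sumE _ x)//; set S := \sum_(r < N) _.
(* Replacing x by x + 2 pi multiplies the sum by a root of 1 other than 1. *)
pose t := (j%:R - D%:R) * (2 * pi / N%:R) : R.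
have St : S = E t * S.
  have xw' : E (x + 2 * 1%:~R * pi) = w by rewrite expi_period.
  have SS := etrans (esym (sumE _ _ xw)) (sumE _ _ xw').
  rewrite {1}/S SS /S mulr_sumr; apply: eq_bigr => r _.
  rewrite !term -expiD; congr E.
  by rewrite /t /branch; ring.
have t1 : E t != 1.
  apply: contra Nnd => /eqP et1; have [i hi0] := expi_eq1 et1; move: hi0.
  have pi0 := pi_gt0 R.
  rewrite /t => hi.
  have {}hi : (j%:Z - D%:Z)%:~R = (i * N%:Z)%:~R :> R.
    rewrite intrB intrM -!pmulrn.
    apply: (mulfI (x := 2 * pi)); first by rewrite gt_eqF// mulr_gt0.
    have -> : 2 * pi * (j%:R - D%:R) = (j%:R - D%:R) * (2 * pi / N%:R) * N%:R :> R.
      by field; rewrite gt_eqF.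
    by rewrite hi; ring.
  move/eqP: hi; rewrite eqr_int => /eqP hi.
  have : (N%:Z %| j%:Z - D%:Z)%Z by apply/dvdzP; exists i.
  by rewrite /dvdz/=.
apply/eqP; have : (1 - E t) * S = 0 by rewrite mulrBl mul1r -St subrr.
by move/eqP; rewrite mulf_eq0 subr_eq0 eq_sym (negbTE t1).
Qed.

Lemma trigdeg_average D f : trigdeg D f ->
  trigdeg (D %/ N) (fun w => \sum_(v \in [set v : C | v ^+ N = w]) f v).
Proof.
move=> [P sP fP].
pose F j w := \sum_(v \in [set v : C | v ^+ N = w]) (v ^+ j / v ^+ D).
apply: (@eq_trigdeg _ (fun w => \sum_(j < D.*2.+1) P`_j * F j w)); last first.
  apply: trigdeg_sum => j; exact: trig_average.
move=> w cw; have [x xw] := expi_surj cw.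
have c1 : circle (1 : C) by rewrite circleE modulus1.
have fin : finite_set [set v : C | v ^+ N = w].
  have := roots_branch hN x c1; rewrite expr1n mul1r xw => ->.
  by apply: finite_image; exact: finite_finset.
have cv v : v ^+ N = w -> circle v.
  move=> vN; apply/circleE.
  have : modulus v ^+ N = 1 by rewrite -modulusX vN; apply/circleE.
  by move=> h; apply/eqP; rewrite -(@pexpr_eq1 _ _ N) ?modulus_ge0 ?h//; lia.
rewrite /F; under eq_bigr do rewrite fsbig_finite// mulr_sumr.
rewrite exchange_big fsbig_finite//= big_seq [RHS]big_seq.
apply: eq_bigr => v; rewrite in_fset_set// inE /= => vN.
rewrite fP ?(horner_coef_wide _ sP) ?mulr_suml; last exact: cv.
by apply: eq_bigr => j _; rewrite mulrA.
Qed.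

Lemma trigdeg_ruelle d D f : trigdeg d m0 -> trigdeg D f ->
  trigdeg ((d + d + D) %/ N) (ruelle N m0 f).
Proof.
move=> hm hf.
have h := trigdeg_average (trigdegM (trigdegM hm (trigdeg_conj hm)) hf).
have [P sP hP] := h; exists (N%:R^-1 *: P).
  by rewrite (leq_trans (size_scale_leq _ _)).
move=> w cw; rewrite hornerZ -mulrA -hP// /ruelle; congr (_ * _).
apply: eq_fsbigr => v _; congr (_ * _).
by rewrite modulusE -rmorphXn /= -mul_conj_modulus mulrC.
Qed.

(** The map D -> (2 d + D) / N decreases D down to 2 d. *)
Lemma iter_trigdeg d D f : trigdeg d m0 -> trigdeg D f ->
  exists M, forall n, (M <= n)%N -> trigdeg (d + d) (iter n (ruelle N m0) f).
Proof.
move=> hm hf; exists D => n Dn.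
suff h m : trigdeg (d + d + (D - m)) (iter m (ruelle N m0) f).
  by apply: trigdeg_widen (h n); lia.
elim: m => [|m IH]; first by apply: trigdeg_widen hf; lia.
rewrite /=; apply: trigdeg_widen (trigdeg_ruelle hm IH).
have [Dm|Dm] := leqP D m.
  rewrite (_ : D - m = 0)%N; last by lia.
  by rewrite -ltnS ltn_divLR; [apply: (leq_trans _ (leq_mul (leqnn _) hN)); lia|lia].
by rewrite -ltnS ltn_divLR; [apply: (leq_trans _ (leq_mul (leqnn _) hN)); lia|lia].
Qed.

(** A trigonometric polynomial of degree at most D is determined by its values at
    2 D + 1 points, through Lagrange interpolation; the formula passes to
    pointwise limits. *)
Lemma trigdeg_limit D (f : C -> C) :
  (forall (s : seq C) (e : R), 0 < e -> {in s, forall w, circle w} ->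
    exists2 g, trigdeg D g & {in s, forall w, modulus (g w - f w) <= e}) ->
  trigdeg D f.
Proof.
move=> hf.
pose n := D.*2.+1.
pose pt (i : 'I_n) : C := E (2 * pi * i%:R / n%:R).
have pi0 := pi_gt0 R.
have n0 : (0 : R) < n%:R by rewrite ltr0n.
have cpt i : circle (pt i) := circle_expi _.
have pt0 i : pt i != 0 := circle_neq0 (cpt i).
have ptI : injective pt.
  move=> i j eij; have : E (2 * pi * i%:R / n%:R - 2 * pi * j%:R / n%:R) = 1.
    by rewrite expiD expiN -/(pt i) -/(pt j) eij mulfV.
  move=> /expi_eq1_small h.
  have {}h : 2 * pi * i%:R / n%:R - 2 * pi * j%:R / n%:R = 0 :> R.
    have ij (a : 'I_n) : 0 <= (2 * pi * a%:R / n%:R : R) < 2 * pi.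
      rewrite divr_ge0 ?mulr_ge0 ?(ltW pi0)//= ltr_pdivrMr// ltr_pM2l ?mulr_gt0//.
      by rewrite ltr_nat.
    have /andP[a1 a2] := ij i; have /andP[b1 b2] := ij j.
    by apply: h; apply/andP; split; lra.
  move/eqP: h; rewrite -mulrBl -mulrBr !mulf_eq0 invr_eq0 (gt_eqF n0) (gt_eqF pi0).
  by rewrite pnatr_eq0 /= orbF subr_eq0 eqr_nat => /eqP/val_inj.
pose den i := \prod_(j | j != i) (pt i - pt j).
have den0 i : den i != 0.
  by apply/prodf_neq0 => j ji; rewrite subr_eq0 (inj_eq ptI) eq_sym.
pose num i := \prod_(j | j != i) ('X - (pt j)%:P).
have snum i : size (num i) = n.
  rewrite /num -big_filter size_prod_XsubC -/(size _).
  by rewrite -cardE/= cardC1 card_ord.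
pose lag (g : C -> C) := \sum_i (g (pt i) * pt i ^+ D / den i) *: num i.
have slag g : (size (lag g) <= n)%N.
  apply: (leq_trans (size_sum _ _ _)); apply/bigmax_leqP => i _.
  by rewrite (leq_trans (size_scale_leq _ _))// snum.
have lagE g i : (lag g).[pt i] = g (pt i) * pt i ^+ D.
  rewrite /lag horner_sum (bigD1 i)//= big1 ?addr0.
    rewrite hornerZ /num horner_prod (_ : \prod_(_ | _) _ = den i) ?mulfVK//.
    by apply: eq_bigr => j _; rewrite hornerXsubC.
  move=> j ji; rewrite hornerZ /num horner_prod (bigD1 i)//= ?hornerXsubC ?subrr ?mul0r ?mulr0//.
  by rewrite eq_sym.
have interp g w : trigdeg D g -> circle w -> g w = (lag g).[w] / w ^+ D.
  move=> [P sP gP] cw; rewrite gP//; congr (_.[w] / _).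
  apply/eqP; rewrite -subr_eq0; apply: contraT => PL.
  have := @max_poly_roots _ (P - lag g) [seq pt i | i <- enum 'I_n] PL.
  rewrite (map_inj_uniq ptI) enum_uniq size_map -cardE card_ord.
  have -> : all (root (P - lag g)) [seq pt i | i <- enum 'I_n].
    apply/allP => _ /mapP[i _ ->]; rewrite rootE hornerD hornerN lagE gP//.
    by rewrite mulfVK ?subrr// expf_neq0.
  move=> /(_ isT isT); rewrite ltnNge (leq_trans (size_polyD _ _))//.
  by rewrite geq_max sP size_polyN slag.
exists (lag f); first exact: slag.
move=> w cw; have w0 := circle_neq0 cw.
apply/eqP; rewrite -subr_eq0 -modulus_eq0 eq_le modulus_ge0 andbT.
pose c := 1 + \sum_i modulus (pt i ^+ D / den i * (num i).[w] / w ^+ D).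
have c0 : 0 < c by rewrite ltr_pwDl// sumr_ge0// => i _; exact: modulus_ge0.
apply/ler_addgt0Pr => e e0; rewrite add0r.
have ec : 0 < e / c by rewrite divr_gt0.
have [|g gD hg] := hf (w :: [seq pt i | i <- enum 'I_n]) (e / c) ec.
  by move=> v; rewrite inE => /orP[/eqP->//|/mapP[i _ ->]]; exact: cpt.
have lagD : (lag g).[w] / w ^+ D - (lag f).[w] / w ^+ D =
    \sum_i (g (pt i) - f (pt i)) * (pt i ^+ D / den i * (num i).[w] / w ^+ D).
  rewrite -mulrBl /lag !horner_sum -sumrB mulr_suml; apply: eq_bigr => i _.
  rewrite !hornerZ; ring.
rewrite (le_trans (modulus_triangle _ (g w) _))//.
rewrite {2}(interp g w gD cw) lagD.
apply: (@le_trans _ _ (e / c * c)); last by rewrite divfK// gt_eqF.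
rewrite /c mulrDr mulr1 lerD//.
  by rewrite modulusBC hg// inE eqxx.
rewrite (le_trans (modulus_sum _ _ _))// mulr_sumr ler_sum// => i _.
rewrite modulusM ler_wpM2r ?modulus_ge0// hg// inE; apply/orP; right.
by apply/mapP; exists i; rewrite ?mem_enum.
Qed.

Lemma bump_trigdeg k : trigdeg 1 (fun v => (bump k v)%:C).
Proof.
exists ((4^-1 : C) *: ((z k)^-1 *: 'X^2 + 2 *: 'X + (z k)%:P)).
  rewrite (leq_trans (size_scale_leq _ _))//.
  rewrite (leq_trans (size_polyD _ _))// geq_max; apply/andP; split; last first.
    by rewrite (leq_trans (size_polyC_leq1 _)).
  rewrite (leq_trans (size_polyD _ _))// geq_max.
  by rewrite !(leq_trans (size_scale_leq _ _)) ?size_polyXn ?size_polyX.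
move=> v cv; have v0 := circle_neq0 cv; have z0 := z_neq0 k.
rewrite expr1 hornerZ !hornerD !hornerZ hornerXn hornerX hornerC.
have [u uE] := coord_z k cv; have u0 := expi_neq0 u.
rewrite /bump uE mulrA mulVf// mul1r.
rewrite rmorphM /= rmorphD /= rmorph1 fmorphV /= rmorph_nat.
have -> : (complex.Re (E u))%:C = (E u + (E u)^-1) / 2.
  by rewrite -expi_conj addcJ mulrAC mulfV ?mul1r// pnatr_eq0.
by field; rewrite u0 z0.
Qed.

(** g_k is a pointwise limit of iterates of powers of the bump, whose degrees end
    up at most 2 d. *)
Lemma gwave_trigdeg d k : trigdeg d m0 -> trigdeg (d + d) (fun w => (gwave k w)%:C).
Proof.
move=> hm; apply: trigdeg_limit => s e e0 cs.
have [K hK] := bump_iter_cvg k e0.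
pose F w := (bump k w ^+ K)%:C.
have FD : trigdeg (K * 1) F.
  apply: (@eq_trigdeg _ (fun w => (bump k w)%:C ^+ K)); last exact: trigdegX (bump_trigdeg k).
  by move=> w _; rewrite /F rmorphXn.
have [M0 hM0] := iter_trigdeg hm FD.
have [M hM] : exists M, {in s, forall w, forall m, (M <= m)%N ->
    `|iter (m * p) rruelle (fun v => bump k v ^+ K) w - gwave k w| <= e}.
  elim: s cs => [|a s IH] cs; first by exists 0%N.
  have [M1 h1] := IH (fun w ws => cs w (mem_behead (s := a :: s) ws)).
  have [M2 h2] := hK a (cs a (mem_head a s)).
  exists (M1 + M2)%N => w; rewrite inE => /orP[/eqP->|ws] m mM.
    by apply: h2; lia.
  by apply: h1 => //; lia.
pose m := (M + M0)%N.
exists (iter (m * p) (ruelle N m0) F).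
  by apply: hM0; rewrite (leq_trans (leq_addl M M0))// leq_pmulr// p_gt0.
move=> w ws; rewrite (iter_ruelle_real (m * p) (F := fun v => bump k v ^+ K))//; last exact: cs.
have cB (a b : R) : a%:C - b%:C = (a - b)%:C by rewrite rmorphB.
by rewrite cB modulus_real; apply: hM => //; exact: leq_addr.
Qed.

(** * The harmonic function of the cycle *)

Local Notation leb := (@lebesgue_measure R).

Lemma measurable_wave2 k : measurable_fun setT (wave2 k).
Proof.
by apply: measurable_modulus2; apply: cmeasurable_continuous; exact: continuous_phi.
Qed.

Lemma phi_L2 k : phi_ k \in @L2fun R.
Proof.
apply/L2funP; split; first by apply: cmeasurable_continuous; exact: continuous_phi.
rewrite /normsq -/(wave2 k) (integral_Per (wave2_ge0 k) (measurable_wave2 k)).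
apply: (@le_lt_trans _ _ (\int[leb]_(x in `[0%R, (2 * pi)%R]) (cst 1%E x))%E).
  apply: ge0_le_integral => //.
  - by move=> x _; apply: Per_ge0; exact: wave2_ge0.
  - apply: measurable_funTS; apply: measurable_Per (measurable_wave2 k).
    exact: wave2_ge0.
  - by move=> x _; exact: wave2_Per_le1.
by rewrite integral_cst// mul1e /= lebesgue_measure_itv /=; case: ifP => _; rewrite -?EFinB ?ltry.
Qed.

Lemma Per_phi_fin k x : (Per_phi N m0 z theta k x < +oo)%E.
Proof. by rewrite (le_lt_trans (wave2_Per_le1 k x))// ltry. Qed.

Local Notation g := (g_ N m0 z theta).
Local Notation h := (hC N m0 z theta).

Definition hwave (w : C) : R := \sum_k gwave k w.

Lemma h_E w : h w = (hwave w)%:C.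
Proof. by rewrite /hC /hwave rmorph_sum. Qed.

Lemma real_lipschitzT (F : C -> R) (f : C -> C) L : 0 <= L ->
  (forall w, f w = (F w)%:C) ->
  (forall w v, circle w -> circle v -> `|F w - F v| <= L * modulus (w - v)) ->
  lipschitzT f.
Proof.
move=> L0 fF FL; apply/lipschitzTP; exists L => // w v cw cv.
have cB (a b : R) : a%:C - b%:C = (a - b)%:C by rewrite rmorphB.
by rewrite !fF cB modulus_real FL.
Qed.

Lemma g_lip k : lipschitzT (g k).
Proof.
have [L L0 hL] := gwave_lip.
by apply: (real_lipschitzT L0 (g_E k)) => w v cw cv; exact: hL.
Qed.

Lemma hwave_lip : exists2 L : R, 0 <= L & forall w v, circle w -> circle v ->
  `|hwave w - hwave v| <= L * modulus (w - v).
Proof.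
have [L L0 hL] := gwave_lip; exists (\sum_(k < p) L).
  exact: sumr_ge0.
move=> w v cw cv; rewrite /hwave -sumrB mulr_suml.
by rewrite (le_trans (ler_norm_sum _ _ _))// ler_sum// => k _; exact: hL.
Qed.

Lemma h_lip : lipschitzT h.
Proof.
have [L L0 hL] := hwave_lip.
by apply: (real_lipschitzT L0 h_E) => w v cw cv; exact: hL.
Qed.

Lemma g_trigpoly k : trigpoly m0 -> trigpoly (g k).
Proof.
move=> /trigpolyP[d hd]; apply/trigpolyP; exists (d + d)%N.
exact: gwave_trigdeg.
Qed.

Lemma h_trigpoly : trigpoly m0 -> trigpoly h.
Proof.
move=> /trigpolyP[d hd]; apply/trigpolyP; exists (d + d)%N.
have := trigdeg_sum (fun=> 1) (fun k => gwave_trigdeg k hd).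
by apply: eq_trigdeg => w _; apply: eq_bigr => k _; rewrite mul1r g_E.
Qed.

Lemma ruelle_g k w : circle w -> ruelle N m0 (g k) w = g (ordS k) w.
Proof.
by move=> cw; rewrite (ruelle_real (F := gwave k))// rruelle_gwave.
Qed.

Lemma iter_ruelle_g k w : circle w -> iter p (ruelle N m0) (g k) w = g k w.
Proof.
move=> cw; have hr := iter_ruelle_real p (fun v (_ : circle v) => g_E k v) cw.
apply: (etrans hr); rewrite g_E; congr (_%:C).
clear hr; rewrite (iter_rruelle_gwave p k cw).
exact: (congr1 (fun j => gwave j w) (iter_ordS_period k)).
Qed.

Lemma rruelle_hwave w : circle w -> rruelle hwave w = hwave w.
Proof.
move=> cw; rewrite /hwave [RHS](reindex_inj (can_inj (@ordSK p))) /=.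
have := @iter_rruelle_sum 1 _ (fun=> 1) gwave w cw; rewrite /=.
under eq_fun do under eq_bigr do rewrite mul1r.
by move=> ->; apply: eq_bigr => k _; rewrite mul1r rruelle_gwave.
Qed.

Lemma ruelle_h w : circle w -> ruelle N m0 h w = h w.
Proof.
move=> cw; rewrite (ruelle_real (F := hwave))//; last by move=> v _; exact: h_E.
by rewrite rruelle_hwave// h_E.
Qed.

Lemma g_delta k j : g k (z j) = (k == j)%:R.
Proof. by rewrite g_E gwave_delta rmorph_nat. Qed.

Lemma hwave_z k : hwave (z k) = 1.
Proof.
rewrite /hwave (bigD1 k)//= gwave_z big1 ?addr0// => j jk.
by rewrite gwave_delta (negPf jk).
Qed.

Lemma g_zero k : zero_on_disjoint_cycles N m0 z (g k).
Proof.
move=> q w hw wz i; rewrite g_E (gwave_cycle hw)//.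
by apply/eqP; exact: wz.
Qed.

Lemma h_zero : zero_on_disjoint_cycles N m0 z h.
Proof.
by move=> q w hw wz i; apply: big1 => k _; exact: (g_zero k hw wz).
Qed.

Lemma branch00 : branch N 0 0 = 0 :> R.
Proof. by rewrite /branch mulr0 mul0r addr0 mul0r. Qed.

(** z_k has weight 1, so that the other N-th roots of z_(k+1) have weight 0. *)
Lemma rruelle_cycle f k : rruelle f (z (ordS k)) = f (z k).
Proof.
have cz := circle_z k.
have h0 : (0 < N)%N by lia.
have W1 : W (z k) = 1 by exact: cycle_weight1 hz.
have := rruelle_branch f 0 cz; rewrite expi0 mulr1 zX => ->.
have := weight_sum 0 cz.
rewrite (bigD1 (Ordinal h0))//= branch00 expi0 mulr1 W1 => /eqP.
rewrite -subr_eq0 addrAC subrr add0r psumr_eq0; last by move=> *; exact: weight_ge0.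
move=> /allP hr; rewrite (bigD1 (Ordinal h0))//= branch00 expi0 mulr1 W1 mul1r.
rewrite big1 ?addr0// => r r0; have /implyP/(_ r0)/eqP -> := hr r (mem_index_enum r).
by rewrite mul0r.
Qed.

Lemma cycle_orbit (j k : 'I_p) : exists n, k = iter n (@ordS p) j.
Proof.
exists (k + (p - j))%N; apply: val_inj; rewrite iter_ordS_val.
rewrite addnC -addnA subnK ?modnDr ?modn_small//. exact: ltnW.
Qed.

Lemma harmonic_cycle f j k : (forall w, circle w -> rruelle f w = f w) ->
  f (z k) = f (z j).
Proof.
move=> hf; have [n ->] := cycle_orbit j k.
by elim: n => [//|n IH] /=; rewrite -IH -hf ?rruelle_cycle//; exact: circle_z.
Qed.

Lemma continuousT_near (h' : C -> C) w e : continuousT h' -> circle w -> 0 < e ->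
  exists2 d, 0 < d & forall v, circle v -> modulus (v - w) <= d ->
    modulus (h' v - h' w) < e.
Proof.
move=> /subspace_continuousP hc cw e0.
have /cvgrPdist_lt/(_ e%:C) := hc w cw; rewrite ltcR => /(_ e0).
rewrite near_withinE => /nbhs_ballP[d d0 hd].
have d1 : d = (complex.Re d)%:C by rewrite RRe_real// ger0_real// ltW.
exists (complex.Re d / 2); first by move: d0; rewrite /= d1 ltcR => ?; rewrite divr_gt0.
move=> v cv vw; have := hd v; rewrite -ball_normE /= modulusE d1 ltcR => h1.
have : modulus (w - v) < complex.Re d.
  rewrite modulusBC (le_lt_trans vw)//; move: d0; rewrite /= d1 ltcR => ?; lra.
by move=> /h1/(_ cv); rewrite modulusE ltcR modulusBC.
Qed.

Lemma hwave_near1 e : 0 < e -> exists2 d, 0 < d & forall k v, circle v ->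
  modulus (v - z k) <= d -> `|hwave v - 1| <= e.
Proof.
move=> e0; have [L L0 hL] := hwave_lip.
exists (e / (L + 1)); first by rewrite divr_gt0// ltr_wpDl.
move=> k v cv vz; rewrite -(hwave_z k) (le_trans (hL _ _ cv (circle_z k)))//.
rewrite (le_trans (ler_wpM2l L0 vz))// mulrCA ler_piMr ?(ltW e0)//.
by rewrite ler_pdivrMr ?mul1r ?ltr_wpDl// lerDl.
Qed.

Lemma cycle_near (h' : C -> C) e : continuousT h' -> 0 < e -> exists2 d, 0 < d &
  forall k v, circle v -> modulus (v - z k) <= d -> modulus (h' v - h' (z k)) < e.
Proof.
move=> hc e0; have /choice[d hd] : forall k : 'I_p, exists d, 0 < d /\
    forall v, circle v -> modulus (v - z k) <= d -> modulus (h' v - h' (z k)) < e.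
  by move=> k; have [d ? ?] := continuousT_near hc (circle_z k) e0; exists d.
exists (\big[Num.min/1]_k d k).
  by apply: lt_bigmin => // k _; exact: (hd k).1.
move=> k v cv vz; apply: (hd k).2 => //; rewrite (le_trans vz)//.
exact: bigmin_le_cond.
Qed.

Lemma Re_circle (h' : C -> C) : (forall w, circle w -> 0 <= h' w) ->
  forall w, circle w -> h' w = (complex.Re (h' w))%:C.
Proof. by move=> h0 w cw; rewrite RRe_real// ger0_real// h0. Qed.

Lemma rruelle_Re (h' : C -> C) : (forall w, circle w -> 0 <= h' w) ->
  (forall w, circle w -> ruelle N m0 h' w = h' w) ->
  forall w, circle w -> rruelle (fun v => complex.Re (h' v)) w = complex.Re (h' w).
Proof.
move=> h0 hh w cw; apply: complexI; rewrite -(ruelle_real (Re_circle h0) cw) hh//.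
by rewrite -Re_circle.
Qed.

Lemma Re_circle_ge0 (h' : C -> C) w : 0 <= h' w -> 0 <= complex.Re (h' w).
Proof. by move=> h0; rewrite -lecR RRe_real// ger0_real. Qed.

Lemma h_le (h' : C -> C) : continuousT h' -> (forall w, circle w -> 0 <= h' w) ->
  (forall w, circle w -> ruelle N m0 h' w = h' w) -> (forall k, h' (z k) = 1) ->
  forall w, circle w -> h w <= h' w.
Proof.
move=> hc h0 hh hz1 w cw; rewrite h_E (Re_circle h0 cw) lecR -[hwave w]mul1r.
apply: (harmonic_ge (h' := fun v => complex.Re (h' v))) => //.
- by move=> v cv; apply: Re_circle_ge0; exact: h0.
- exact: rruelle_Re.
- move=> e e0; have [d d0 hd] := cycle_near hc e0; exists d => // k v cv vz.
  have := hd k v cv vz; rewrite hz1 => /ltW/(le_trans (Re_le_modulus _)).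
  by rewrite raddfB /= ler_norml => /andP[]; lra.
Qed.

(** A harmonic function h' takes a single value lam on the cycle.  If
    0 <= h' <= c h, the domination applies to h' with the value lam and to
    c h - h' with the value c - lam, which gives the two inequalities. *)
Lemma h_minimal (h' : C -> C) (c : R) : continuousT h' -> 0 < c ->
  (forall w, circle w -> 0 <= h' w <= c%:C * h w) ->
  (forall w, circle w -> ruelle N m0 h' w = h' w) ->
  exists2 lam : R, 0 <= lam & forall w, circle w -> h' w = lam%:C * h w.
Proof.
move=> hc c0 hb hh.
have h0 w : circle w -> 0 <= h' w by move=> /hb/andP[].
pose H v := complex.Re (h' v).
have HE := Re_circle h0; have Hh := rruelle_Re h0 hh.
have Hb w : circle w -> H w <= c * hwave w.
  by move=> cw; have /andP[_] := hb w cw; rewrite HE// h_E -rmorphM lecR.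
have H0 w : circle w -> 0 <= H w by move=> /h0; exact: Re_circle_ge0.
pose lam := H (z (Ordinal p_gt0)).
have Hz k : H (z k) = lam by exact: harmonic_cycle.
have lam0 : 0 <= lam by apply: H0; exact: circle_z.
have lamc : lam <= c by rewrite -(mulr1 c) -(hwave_z (Ordinal p_gt0)) Hb//; exact: circle_z.
exists lam => // w cw; rewrite HE// h_E -rmorphM; congr (_%:C); apply/eqP.
rewrite eq_le; apply/andP; split; last first.
  apply: (harmonic_ge (h' := H)) => // e e0.
  have [d d0 hd] := cycle_near hc e0; exists d => // k v cv vz.
  have := hd k v cv vz => /ltW/(le_trans (Re_le_modulus _)).
  by rewrite raddfB /= ler_norml -/(H _) -/(H (z k)) Hz => /andP[]; lra.
suff : (c - lam) * hwave w <= c * hwave w - H w by lra.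
apply: (harmonic_ge (h' := fun v => c * hwave v - H v)) => //.
- by rewrite subr_ge0.
- by move=> v cv; rewrite subr_ge0 Hb.
- move=> v cv; rewrite -[in RHS](rruelle_hwave cv) -[H v](Hh v cv).
  have [x <-] := expi_surj cv; rewrite !rruelle_E mulr_sumr -sumrB.
  by apply: eq_bigr => r _; rewrite mulrBr mulrCA.
- move=> e e0; have e2 : 0 < e / 2 by lra.
  have [d d0 hd] := cycle_near hc e2.
  have ec : 0 < e / 2 / c by rewrite divr_gt0.
  have [d' d'0 hd'] := hwave_near1 ec.
  exists (Num.min d d'); first by rewrite lt_min d0.
  move=> k v cv; rewrite le_min => /andP[vz vz'].
  have := hd k v cv vz => /ltW/(le_trans (Re_le_modulus _)).
  rewrite raddfB /= ler_norml -/(H _) -/(H (z k)) Hz => /andP[_ h1].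
  have /(ler_wpM2l (ltW c0)) := hd' k v cv vz'.
  rewrite (_ : c * (_ / c) = e / 2) => [h2|]; last by rewrite mulrC divfK ?gt_eqF.
  have : c * (1 - hwave v) <= e / 2.
    by apply: le_trans h2; apply: ler_wpM2l (ltW c0) _ _ _; rewrite distrC ler_norm.
  lra.
Qed.

(** * The representation on L^2(R)^p *)

Local Notation U := (UC N theta).
Local Notation dot := (@L2pdot R p).
Local Notation Phi := (phiC N m0 z theta).
Local Notation period := (`[0%R, (2 * pi)%R]%classic : set R).

Let N0 : (0 < N)%N. Proof. by lia. Qed.

Lemma lipT_cmeasurable f : lipschitzT f -> cmeasurable (f \o E).
Proof.
move=> /lipschitzTP[L L0 hL]; apply: cmeasurable_continuous.
apply: (@lip_continuous _ _ (L * 2)) => [|x y]; first by rewrite mulr_ge0.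
by rewrite (le_trans (hL _ _ (circle_expi _) (circle_expi _)))// -mulrA ler_wpM2l// expi_lip.
Qed.

Lemma measurable_gwave k : measurable_fun setT (fun x => gwave k (E x)).
Proof. by have [] := lipT_cmeasurable (g_lip k). Qed.

Lemma measurable_hwave : measurable_fun setT (fun x => hwave (E x)).
Proof.
have [h1 _] := lipT_cmeasurable h_lip; move: h1; congr measurable_fun.
by apply/funext => x /=; rewrite h_E.
Qed.

Lemma hwave_ge0 w : 0 <= hwave w.
Proof. by apply: sumr_ge0 => k _; exact: gwave_ge0. Qed.

Lemma h_L1T : L1T h.
Proof.
split; first exact: lipT_cmeasurable h_lip.
apply: (@le_lt_trans _ _ (\int[leb]_(x in period) (cst (p%:R)%:E x))%E).
  apply: ge0_le_integral => //.
  - by move=> x _; rewrite lee_fin modulus_ge0.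
  - apply/measurable_EFinP; apply: measurable_funTS; apply: measurable_modulus.
    exact: lipT_cmeasurable h_lip.
  - move=> x _; rewrite lee_fin h_E modulus_real ger0_norm ?hwave_ge0//.
    rewrite /hwave (le_trans (ler_sum _ (fun k _ => gwave_le1 k _)))//.
    by rewrite sumr_const card_ord.
rewrite integral_cst//= lebesgue_measure_itv /=; case: ifP => _;
  by rewrite ?mule0 ?ltry// -?EFinB -?EFinM ltry.
Qed.

Lemma h_harmonicT : eqT (ruelle N m0 h) h.
Proof. by apply: aeW => x; apply: ruelle_h; exact: circle_expi. Qed.

Lemma LinfT_pow (f : C -> C) : LinfT f -> LinfT (fun w => f (w ^+ N)).
Proof.
have NR : 0 < N%:R :> R by rewrite ltr0n.
move=> /(Linf_aff 0 NR); congr Linf; apply/funext => x.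
by rewrite /= /aff addr0 expiX.
Qed.

Lemma U_piC f : LinfT f -> forall xi, U (piC z f xi) = piC z (fun w => f (w ^+ N)) (U xi).
Proof.
move=> hf xi; rewrite !piCE; apply: UC_diag_op => //.
- by move=> k; exact: (Linf_rotate circle_z k hf).
- by move=> k; exact: (Linf_rotate circle_z k (LinfT_pow hf)).
- by move=> k; apply: aeW => x; rewrite /= /alpha exprMn zX expiX.
Qed.

Lemma LinfT_m0 : LinfT m0.
Proof.
split; first exact: lipT_cmeasurable m0_lip.
by exists sN; apply: aeW => x; apply: modulus_m0_le; exact: circle_expi.
Qed.

Lemma PhiE k : {ae leb, forall x, L2fun_of (Phi k) x = phi_ k x}.
Proof. by rewrite ffunE; exact: L2classE (phi_L2 k). Qed.

Lemma U_Phi : U Phi = piC z m0 Phi.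
Proof.
apply: L2p_ext => k; rewrite piCE.
have h1 := UCE N0 theta Phi k; have h2 := ae_dilate N0 (PhiE (ordS k)).
have h3 := diag_opE Phi k (fun k => Linf_rotate circle_z k LinfT_m0).
apply: filterS3 h1 h2 (filterI h3 (PhiE k)) => x -> -> [-> ->].
rewrite phi_refine /lowpass /= /alpha expiN.
have s0 : sN%:C != 0 by rewrite fmorph_eq0 gt_eqF// sqrtN_gt0.
have e0 := expi_neq0 (theta k).
by move: (E (theta k)) (m0 _) sN%:C (phi_ k x) s0 e0 => a b c d c0 a0; field; rewrite c0 a0.
Qed.

(** The line is folded onto a period, on which the periodization of |phi_k|^2 is
    g_k up to the rotation by z_k; the rotation does not change the integral over
    a period. *)
Lemma integral_wave2 k (Q : C -> R) : (forall w, 0 <= Q w) ->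
  measurable_fun setT (fun x => Q (E x)) ->
  (\int[leb]_x (Q (z k * E x) * wave2 k x)%:E =
   \int[leb]_(x in period) (Q (E x) * gwave k (E x))%:E)%E.
Proof.
move=> Q0 mQ; have [a ha] := expi_coord circle_z k.
have mQz : measurable_fun setT (fun x => Q (z k * E x)).
  have := measurableT_comp mQ (measurable_aff 1 a).
  by congr measurable_fun; apply/funext => x; rewrite /= ha.
rewrite (integral_Per (B := fun x => Q (z k * E x) * wave2 k x)); first last.
- by apply: measurable_funM => //; exact: measurable_wave2.
- by move=> x; rewrite mulr_ge0// wave2_ge0.
pose F x := Q (E x) * gwave k (E x).
have <- := @integral_period_shift _ F a.
- apply: eq_integral => x _; rewrite /F.
  have -> : E (x + a) = z k * E x by rewrite ha /aff mul1r.
  rewrite EFinM gwaveE fineK ?Per_wave2_fin// -PerZ//.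
  by apply: eq_esum => j _; rewrite expi_period.
- by apply: measurable_funM => //; exact: measurable_gwave.
- by move=> x; rewrite mulr_ge0// gwave_ge0.
- by move=> x j; rewrite /F expi_period.
Qed.

Lemma wave2E k x : (wave2 k x)%:C = (phi_ k x)^*%C * phi_ k x.
Proof. by rewrite mul_conj_modulus. Qed.

Lemma cintegrable_wave2 k f : LinfT f ->
  cintegrable setT (fun x => f (z k * E x) * (wave2 k x)%:C).
Proof.
move=> hf; have := cintegrable_dot (phi_L2 k) (L2fun_mul (Linf_rotate circle_z k hf) (phi_L2 k)).
by congr cintegrable; apply/funext => x; rewrite wave2E mulrCA.
Qed.

Lemma cintegrable_gwave k f : LinfT f ->
  cintegrable period (fun x => f (E x) * (gwave k (E x))%:C).
Proof.
move=> hf; have [mf _] := hf.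
apply: cintegrableP => //.
  by apply: cmeasurableM => //; apply: cmeasurable_real; exact: measurable_gwave.
have mm : measurable_fun setT (fun x => modulus (f (E x))) := measurable_modulus mf.
have := @integral_wave2 k (fun w => modulus (f w)) (fun w => modulus_ge0 _) mm.
have -> : (\int[leb]_(x in period) (modulus (f (E x) * (gwave k (E x))%:C)%R)%:E =
    \int[leb]_(x in period) (modulus (f (E x)) * gwave k (E x))%:E)%E.
  by apply: eq_integral => x _; rewrite modulusM modulus_real ger0_norm ?gwave_ge0.
move=> <-.
have hm : LinfT (fun w => (modulus (f w))%:C).
  split; first by apply: cmeasurable_real.
  have [_ [M hM]] := hf; exists M; apply: filterS hM => x; apply: le_trans.
  by rewrite modulus_real ger0_norm ?modulus_ge0.
have [hr _] := cintegrable_wave2 k hm.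
have /integrableP[_] := hr; congr (_ < _)%E; apply: eq_integral => x _.
rewrite /comp -rmorphM /= ger0_norm// mulr_ge0 ?modulus_ge0 ?wave2_ge0//.
Qed.

Lemma cintegral_wave2_real k (Q : C -> R) : (forall w, 0 <= Q w) ->
  measurable_fun setT (fun x => Q (E x)) ->
  cintegral setT (fun x => (Q (z k * E x))%:C * (wave2 k x)%:C) =
  cintegral period (fun x => (Q (E x))%:C * (gwave k (E x))%:C).
Proof.
move=> Q0 mQ; rewrite /cintegral; congr (_ +i* _).
  have := integral_wave2 k Q0 mQ => hi.
  rewrite (@eq_Rintegral _ _ _ leb setT (fun x => Q (z k * E x) * wave2 k x)); last first.
    by move=> x _; rewrite -rmorphM.
  rewrite (@eq_Rintegral _ _ _ leb period (fun x => Q (E x) * gwave k (E x))); last first.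
    by move=> x _; rewrite -rmorphM.
  by rewrite /Rintegral hi.
rewrite (@eq_Rintegral _ _ _ leb setT (cst 0)); last by move=> x _; rewrite -rmorphM.
rewrite (@eq_Rintegral _ _ _ leb period (cst 0)); last by move=> x _; rewrite -rmorphM.
by rewrite /Rintegral !integral0.
Qed.

Lemma cintegral_wave2 k f : LinfT f ->
  cintegral setT (fun x => f (z k * E x) * (wave2 k x)%:C) =
  cintegral period (fun x => f (E x) * (gwave k (E x))%:C).
Proof.
move=> hf; have [mf [M hM]] := hf.
have hL i : LinfT (fun w => (part i (f w))%:C).
  split; first by apply: cmeasurable_real; exact: (measurable_part i mf).
  exists M; apply: filterS hM => x; apply: le_trans; rewrite modulus_real.
  exact: part_le.
have split_ (D : set R) (v w : R -> C) : (fun x => f (v x) * w x) =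
    (fun x => \sum_i part_coef R i * ((part i (f (v x)))%:C * w x)).
  apply/funext => x; rewrite {1}[f (v x)]partE mulr_suml.
  by apply: eq_bigr => i _; rewrite mulrA.
rewrite (split_ setT) (split_ period) !cintegral_sum//.
- apply: eq_bigr => i _; congr (_ * _).
  apply: (cintegral_wave2_real k (Q := fun w => part i (f w))).
    by move=> w; exact: part_ge0.
  exact: (measurable_part i mf).
- by move=> i; exact: cintegrable_gwave (hL i).
- by move=> i; exact: cintegrable_wave2 (hL i).
Qed.

Lemma Phi_state f : LinfT f -> dot Phi (piC z f Phi) = integralT (fun w => f w * h w).
Proof.
move=> hf; have hr k := Linf_rotate circle_z k hf.
rewrite /integralT.
have -> : ((fun w => f w * h w) \o E) =
    (fun x => \sum_k 1 * (f (E x) * (gwave k (E x))%:C)).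
  apply/funext => x; rewrite /= /hC mulr_sumr; apply: eq_bigr => k _.
  by rewrite mul1r g_E.
rewrite cintegral_sum//; last by move=> k; exact: cintegrable_gwave.
rewrite mulr_sumr; apply: eq_bigr => k _; rewrite mul1r -cintegral_wave2//.
have h1 := diag_opE Phi k hr.
have h2 : {ae leb, forall x, L2fun_of (diag_op (fun k => alpha (z k) f \o E) Phi k) x =
    f (z k * E x) * phi_ k x}.
  by apply: filterS2 h1 (PhiE k) => x -> ->.
rewrite piCE (L2dotE (phi_L2 k) _ (PhiE k) h2); last exact: L2fun_mul (hr k) (phi_L2 k).
by rewrite /dotf; congr (_ * cintegral _ _); apply/funext => x; rewrite wave2E mulrCA.
Qed.

(** The state computed at |f|^2 gives the norm of pi(f) Phi. *)
Lemma nsq_piC_Phi f : LinfT f -> ((nsq (piC z f Phi))%:E =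
  \int[leb]_(x in period) (modulus (f (E x)) ^+ 2 * hwave (E x))%:E)%E.
Proof.
move=> hf; have hr k := Linf_rotate circle_z k hf.
have [mf _] := hf.
have m2 : measurable_fun setT (fun x => modulus (f (E x)) ^+ 2) := measurable_modulus2 mf.
have -> : (\int[leb]_(x in period) (modulus (f (E x)) ^+ 2 * hwave (E x))%:E =
    \sum_k \int[leb]_(x in period) (modulus (f (E x)) ^+ 2 * gwave k (E x))%:E)%E.
  rewrite -ge0_integral_sum//.
  - by apply: eq_integral => x _; rewrite sumEFin -mulr_sumr.
  - move=> k; apply/measurable_EFinP; apply: measurable_funTS.
    by apply: measurable_funM => //; exact: measurable_gwave.
  - by move=> k x _; rewrite lee_fin mulr_ge0 ?sqr_ge0 ?gwave_ge0.
rewrite /nsq -sumEFin; apply: eq_bigr => k _.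
rewrite fineK; last by apply: L2fun_fin; exact: L2fun_of_in.
rewrite -(integral_wave2 k (Q := fun w => modulus (f w) ^+ 2))//; last by move=> w; exact: sqr_ge0.
rewrite piCE (normsq_ae _ _ (_ : {ae leb, forall x, _ = f (z k * E x) * phi_ k x})).
- by apply: eq_integral => x _; rewrite modulusM exprMn.
- exact: L2fun_meas (L2fun_of_in _).
- exact: L2fun_meas (L2fun_mul (hr k) (phi_L2 k)).
- by apply: filterS2 (diag_opE Phi k hr) (PhiE k) => x -> ->.
Qed.

(** * Cyclicity *)

Local Notation V := (UCinv N theta).

Lemma iter_UCinvE n k : exists c0 : C, modulus c0 ^+ 2 * N%:R ^+ n = 1 /\
  forall zeta : L2p R p, {ae leb, forall x, L2fun_of (iter n V zeta k) x =
    c0 * L2fun_of (zeta (iter n (@ord_pred p) k)) (x / N%:R ^+ n)}.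
Proof.
elim: n k => [|n IH] k.
  exists 1; split; first by rewrite modulus1 expr1n expr0 mulr1.
  by move=> zeta; apply: aeW => x; rewrite /= expr0 divr1 mul1r.
have [c0 [c1 hc]] := IH (ord_pred k).
exists (E (- theta (ord_pred k)) * (sN^-1)%:C * c0); split.
  rewrite !modulusM modulus_expi mul1r modulus_real !exprMn real_normK ?num_real//.
  rewrite exprVn sqr_sqrtr ?(ltW N_gt0)// (exprS N%:R n) mulrACA mulVf ?gt_eqF//.
  by rewrite mul1r.
move=> zeta; have h1 := UCinvE N0 theta (iter n V zeta) k.
have h2 := ae_contract N0 (hc zeta).
apply: filterS2 h1 h2 => x e1 e2; apply: (etrans e1).
by rewrite e2 (iterSr n (@ord_pred p)) mulrA exprS invfM mulrA.
Qed.

Lemma nsq_UCinv zeta : nsq (V zeta) = nsq zeta.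
Proof. by rewrite -(nsq_UC N0 theta) UCinvK. Qed.

(** On the right half of the circle this is the angle in ]-pi/2, pi/2[; unlike
    argT, it is continuous near 1. *)
Definition ang (w : C) : R := atan (complex.Im w / complex.Re w).

Lemma angE x : `|x| < pi / 2 -> ang (E x) = x.
Proof. by move=> xpi; apply: (@tanK R); rewrite in_itv /= -ltr_norml. Qed.

Lemma right_half (x : R) : 0 < cos x -> exists j : int, `|x + 2 * j%:~R * pi| < pi / 2.
Proof.
move=> cx; have [j /andP[h1 h2]] := mod2pi (- (pi / 2)) x; exists j.
have pi0 := pi_gt0 R.
have : 0 < cos (x + 2 * j%:~R * pi).
  by have := congr1 (@complex.Re R) (expi_period x j) => /= ->.
move: (x + _) h1 h2 => y h1 h2 cy.
rewrite ltr_norml lt_neqAle h1 andbT; apply/andP; split.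
  by apply/eqP => e; move: cy; rewrite -e cosN cos_pihalf ltxx.
rewrite ltNge; apply/negP => hy.
have : 0 <= cos (y - pi) by apply: cos_ge0_pihalf; apply/andP; split; lra.
by rewrite -(opprK (cos _)) -cosDpi subrK; lra.
Qed.

Lemma measurable_ang : measurable_fun setT (fun x => ang (E x)).
Proof.
have ms : measurable_fun setT (@sin R) by exact: continuous_measurable_fun (@continuous_sin R).
have mc : measurable_fun setT (@cos R) by exact: continuous_measurable_fun (@continuous_cos R).
have [mi _] := cmeasurable_inv (cmeasurable_real mc).
have ma : measurable_fun setT (@atan R).
  by apply: continuous_measurable_fun => x; exact: continuous_atan.
have := measurableT_comp ma (measurable_funM ms mi).
congr measurable_fun; apply/funext => x.
have hV : complex.Re ((cos x)%:C^-1) = (cos x)^-1 by rewrite -(fmorphV (real_complex R)).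
by rewrite /ang -[complex.Re (E x)]/(cos x) -hV.
Qed.

Lemma modulus_expi1 (t : R) : modulus (E t - 1) <= 2 * `|t|.
Proof. by have := expi_lip t 0; rewrite expi0 subr0. Qed.

Lemma near_cycle e : 0 < e -> exists2 d : R, 0 < d <= 1 / 2 & forall k u, `|u| <= d ->
  1 - e <= wave2 k u /\ hwave (z k * E u) <= 1 + e.
Proof.
move=> e0; have [d1 d10 h1] := hwave_near1 e0; have [d2 d20 h2] := wave2_near1 e0.
exists (Num.min (1 / 2) (Num.min (d1 / 2) d2)).
  by rewrite !lt_min d20 ge_min lexx /= andbT; apply/andP; split; lra.
move=> k u; rewrite !le_min => /and3P[_ u1 u2]; split; first exact: h2.
have cw : circle (z k * E u) by apply: circleM; [exact: circle_z|exact: circle_expi].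
have := h1 k _ cw; rewrite modulus_coord => h.
have : modulus (E u - 1) <= d1 by rewrite (le_trans (modulus_expi1 _))//; lra.
by move=> /h; rewrite ler_norml => /andP[_]; rewrite lerBlDl.
Qed.

Section Target.
Variables (k : 'I_p) (xi : R -> C) (A : nat).
Hypotheses (xiL : xi \in @L2fun R) (xiA : forall x, modulus (xi x) <= A%:R).
Hypothesis xi_supp : forall x, A%:R < `|x| -> xi x = 0.
Variables (n : nat) (c : C) (d e : R).
Hypotheses (d0 : 0 < d <= 1 / 2) (e0 : 0 < e <= 1 / 2) (An : A%:R / N%:R ^+ n <= d).
Hypothesis cn : modulus c ^+ 2 = N%:R ^+ n.
Hypothesis near_d : forall u, `|u| <= d -> 1 - e <= wave2 k u /\ hwave (z k * E u) <= 1 + e.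

Definition in_arc (w : C) : bool := (0 < complex.Re w) && (`|ang w| <= d).

(** The symbol f, supported on an arc around z_k, such that the vector eta with
    U^n eta = pi(f) Phi has xi as component of index k.  Indeed n steps backwards
    along the cycle dilate by N^n, so that this component is, up to a constant,
    f(z_k E(u)) phi_k(u) at u = x / N^n. *)
Definition symbol (w : C) : C :=
  let v := (z k)^-1 * w in let u := ang v in
  if in_arc v then c * (xi (N%:R ^+ n * u) / phi_ k u) else 0.

Let halfpi (u : R) : `|u| <= d -> `|u| < pi / 2.
Proof.
by move=> ud; have := pi_ge2 R; case/andP: d0 => _; move: ud; lra.
Qed.

Lemma symbolE u : `|u| <= d ->
  symbol (z k * E u) = c * (xi (N%:R ^+ n * u) / phi_ k u).
Proof.
move=> ud; rewrite /symbol (mulrA (z k)^-1) mulVf ?z_neq0// mul1r /in_arc angE ?halfpi// ud andbT.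
by rewrite /= cos_gt0_pihalf// -ltr_norml halfpi.
Qed.

Lemma in_arcP x : in_arc (E x) -> exists j : int, ang (E x) = x + 2 * j%:~R * pi /\
  `|x + 2 * j%:~R * pi| <= d.
Proof.
move=> /andP[/right_half[j hj]]; rewrite -(expi_period x j) angE// => h1.
by exists j.
Qed.

Lemma wave2_half u : `|u| <= d -> 1 / 2 <= wave2 k u.
Proof. by move=> /near_d[h _]; move: e0 h; lra. Qed.

Lemma symbol_Linf : LinfT symbol.
Proof.
have [b hb] : exists b, E b = (z k)^-1 by apply: expi_surj; apply: circleV; exact: circle_z.
have zE x : (z k)^-1 * E x = E (aff 1 b x) by rewrite -hb -expiD /aff mul1r addrC.
have mphi : cmeasurable (phi_ k) by apply: cmeasurable_continuous; exact: continuous_phi.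
have marc : measurable_fun setT (fun x => in_arc (E x)).
  apply: measurable_and.
    apply: measurable_fun_ltr => //.
    exact: continuous_measurable_fun (@continuous_cos R).
  by apply: measurable_fun_ler => //; apply: measurableT_comp => //; exact: measurable_ang.
pose f0 x := if in_arc (E x) then c * (xi (N%:R ^+ n * ang (E x)) / phi_ k (ang (E x))) else 0.
have mf0 : cmeasurable f0.
  apply: cmeasurable_if => //; last exact: cmeasurable_cst.
  apply: cmeasurableM; first exact: cmeasurable_cst.
  apply: cmeasurableM.
    apply: (cmeasurable_comp (L2fun_meas xiL)).
    by apply: measurable_funM => //; exact: measurable_ang.
  by apply: (cmeasurable_comp (cmeasurable_inv mphi)); exact: measurable_ang.
split.
  have := cmeasurable_aff 1 b mf0; congr cmeasurable; apply/funext => x.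
  by rewrite /f0 /= /symbol zE.
exists (modulus c * (A%:R * 2)); apply: aeW => x; rewrite /= /symbol zE.
have nn : 0 <= modulus c * (A%:R * 2) by rewrite !mulr_ge0 ?modulus_ge0.
case: ifP => [arcx|_]; last by rewrite modulus0.
have [j [-> hj]] := in_arcP arcx.
rewrite !modulusM ler_wpM2l ?modulus_ge0// ler_pM ?modulus_ge0 ?xiA// modulusV.
have := wave2_half hj; rewrite /wave2; move: (phi_ _ _) => t ht.
have t0 := modulus_ge0 t.
have t1 : 1 / 2 <= modulus t by nra.
by rewrite invf_ple ?posrE//; lra.
Qed.

(** On the arc h is at most 1 + e and |phi_k|^2 at least 1 - e; the arc being
    short, the integral over the circle is at most one over the line. *)
Lemma symbol_norm : (\int[leb]_(x in period) (modulus (symbol (E x)) ^+ 2 * hwave (E x))%:E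
  <= ((1 + e) / (1 - e))%:E * normsq xi)%E.
Proof.
have [b hb] : exists b, E b = (z k)^-1 by apply: expi_surj; apply: circleV; exact: circle_z.
have zE x : (z k)^-1 * E x = E (aff 1 b x) by rewrite -hb -expiD /aff mul1r addrC.
pose rho := (1 + e) / (1 - e).
have e1 : 0 < 1 - e by move: e0; lra.
have rho0 : 0 <= rho by rewrite divr_ge0 ?ltW//; move: e0; lra.
have Nn0 : 0 < N%:R ^+ n :> R by rewrite exprn_gt0.
pose B u := rho * (N%:R ^+ n * modulus (xi (aff (N%:R ^+ n) 0 u)) ^+ 2).
have B0 u : 0 <= B u by rewrite mulr_ge0// mulr_ge0 ?sqr_ge0// ltW.
have mxi := L2fun_meas xiL.
have mB : measurable_fun setT B.
  apply: measurable_funM => //; apply: measurable_funM => //.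
  by apply: measurable_modulus2; exact: cmeasurable_aff.
pose B' x := B (aff 1 b x).
have pw x : ((modulus (symbol (E x)) ^+ 2 * hwave (E x))%:E <= Per B' x)%E.
  rewrite /symbol; case: ifP => [arcx|_]; last first.
    by rewrite modulus0 expr0n mul0r Per_ge0// => y; exact: B0.
  have [j [ej hj]] : exists j : int, ang ((z k)^-1 * E x) = aff 1 b (x + 2 * j%:~R * pi) /\
      `|aff 1 b (x + 2 * j%:~R * pi)| <= d.
    rewrite zE in arcx *; have [j hj] := in_arcP arcx; exists j.
    by rewrite /aff !mul1r addrAC -[x + b]mul1r in hj *.
  have := @Per_ge _ B' x [:: j] (fun y => B0 _) isT; rewrite big_seq1.
  apply: le_trans; rewrite lee_fin /B' /B ej; set u := aff 1 b _ in hj *.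
  have [hw hh] := near_d hj.
  have ex : z k * E u = E x.
    have -> : E u = E (aff 1 b x) by rewrite /u /aff !mul1r addrAC expi_period.
    by rewrite -zE mulrA mulfV ?z_neq0// mul1r.
  rewrite ex in hh; rewrite /aff addr0 !modulusM modulusV !exprMn exprVn cn -/(wave2 k u).
  move: hw hh (hwave_ge0 (E x)) (sqr_ge0 (modulus (xi (N%:R ^+ n * u)))).
  move: (wave2 k u) (hwave (E x)) (modulus _ ^+ 2) => s g t hs hg g0 t0.
  have s0 : 0 < s by lra.
  have -> : N%:R ^+ n * (t / s) * g = (g / s) * (N%:R ^+ n * t) by ring.
  apply: ler_wpM2r; first by rewrite mulr_ge0// ltW.
  by rewrite /rho ler_pM ?invr_ge0 ?(ltW s0)// lef_pV2 ?posrE.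
have <- : (\int[leb]_x (B' x)%:E = rho%:E * normsq xi)%E.
  rewrite (integral_affT (f := fun x => (B x)%:E) b ltr01); first last.
  - by move=> x; rewrite lee_fin.
  - exact/measurable_EFinP.
  rewrite invr1 mul1e /B.
  under eq_integral do rewrite EFinM.
  have mx : measurable_fun setT (fun x => modulus (xi (aff (N%:R ^+ n) 0 x)) ^+ 2).
    by apply: measurable_modulus2; exact: cmeasurable_aff.
  rewrite ge0_integralZl//; first last.
  - by move=> x _; rewrite lee_fin mulr_ge0 ?sqr_ge0 ?ltW.
  - by apply/measurable_EFinP; apply: measurable_funM.
  congr (_ * _)%E; under eq_integral do rewrite EFinM.
  rewrite ge0_integralZl//; first last.
  - by move=> x _; rewrite lee_fin sqr_ge0.
  - exact/measurable_EFinP.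
  rewrite -/(normsq (fun x => xi (aff (N%:R ^+ n) 0 x))) normsq_aff// muleA -EFinM.
  by rewrite mulfV ?mul1e ?gt_eqF.
have mB' : measurable_fun setT B' by exact: measurableT_comp mB (measurable_aff 1 b).
rewrite (integral_Per (fun x => B0 _) mB'); apply: ge0_le_integral => //.
- by move=> x _; rewrite lee_fin mulr_ge0 ?sqr_ge0 ?hwave_ge0.
- apply/measurable_EFinP; apply: measurable_funTS; apply: measurable_funM.
    by apply: measurable_modulus2; have [] := symbol_Linf.
  exact: measurable_hwave.
- by apply: measurable_funTS; apply: measurable_Per => // x; exact: B0.
Qed.

(** eta agrees with xi on [-A, A], outside of which xi vanishes, and its norm is
    hardly larger than that of xi; hence all the rest of eta is small. *)
Lemma symbol_target : (forall zeta : L2p R p,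
    {ae leb, forall x, L2fun_of (iter n V zeta k) x =
    c^-1 * L2fun_of (zeta k) (x / N%:R ^+ n)}) ->
  nsq (iter n V (piC z symbol Phi) - single k xi) <=
  ((1 + e) / (1 - e) - 1) * fine (normsq xi).
Proof.
move=> hc; set eta := iter n V _.
have Nn0 : 0 < N%:R ^+ n :> R by rewrite exprn_gt0.
have c0 : c != 0.
  by rewrite -modulus_eq0 -sqrf_eq0 cn gt_eqF.
have nsqV : nsq eta = nsq (piC z symbol Phi).
  by rewrite /eta; elim: (n) => [//|m IH]; rewrite iterS nsq_UCinv.
have hle : nsq eta <= (1 + e) / (1 - e) * fine (normsq xi).
  rewrite -lee_fin nsqV EFinM fineK ?L2fun_fin// (nsq_piC_Phi symbol_Linf).
  exact: symbol_norm.
have hr j := Linf_rotate circle_z j symbol_Linf.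
have etaE : {ae leb, forall x, `|x| <= A%:R -> L2fun_of (eta k) x = xi x}.
  have NV : 0 < (N%:R ^+ n)^-1 :> R by rewrite invr_gt0.
  have h2 : {ae leb, forall x, L2fun_of (piC z symbol Phi k) x =
      symbol (z k * E x) * phi_ k x}.
    by apply: filterS2 (diag_opE Phi k hr) (PhiE k) => x -> ->.
  have h3 := ae_aff 0 NV h2.
  apply: filterS2 (hc (piC z symbol Phi)) h3 => x e1 e2 xA; apply: (etrans e1).
  have <- : aff (N%:R ^+ n)^-1 0 x = x / N%:R ^+ n by rewrite /aff addr0 mulrC.
  set u := aff _ _ _ in e2 *.
  have ud : `|u| <= d.
    have -> : u = x / N%:R ^+ n by rewrite /u /aff addr0 mulrC.
    rewrite normrM (ger0_norm (ltW NV)) (le_trans _ An)//.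
    by rewrite ler_wpM2r// ltW.
  rewrite e2 symbolE// -!mulrA mulKf// mulVf ?mulr1; last first.
    by apply/eqP => p0; have := wave2_half ud; rewrite /wave2 p0 modulus0 expr0n /=; lra.
  by rewrite /u /aff addr0 mulrA mulfV ?mul1r ?gt_eqF.
have mxi := L2fun_meas xiL; have heta := L2fun_of_in (eta k).
have mdiff : cmeasurable (fun x => L2fun_of (eta k) x - xi x).
  by apply: cmeasurableB => //; exact: L2fun_meas.
have fdiff : normsq (fun x => L2fun_of (eta k) x - xi x) \is a fin_num.
  by apply: L2fun_fin; exact: L2funB.
have pyth : (normsq (fun x => L2fun_of (eta k) x - xi x)%R + normsq xi =
    normsq (L2fun_of (eta k)))%E.
  rewrite -ge0_integralD//; try exact: cmeasurable_modulus2;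
    try by move=> x _; rewrite lee_fin sqr_ge0.
  apply: ae_eq_integral => //.
  - by apply: emeasurable_funD; exact: cmeasurable_modulus2.
  - by apply: cmeasurable_modulus2; exact: L2fun_meas.
  apply: filterS etaE => x hx _; rewrite -EFinD.
  have [xA|xA] := leP `|x| A%:R.
    by rewrite hx// subrr modulus0 expr0n add0r.
  by rewrite xi_supp// subr0 modulus0 expr0n addr0.
have nsq_split : nsq (eta - single k xi) + fine (normsq xi) = nsq eta.
  rewrite /nsq (bigD1 k)//= [RHS](bigD1 k)//= !ffunE eqxx normsqB_class//.
  rewrite -pyth (fineD fdiff (L2fun_fin xiL)) addrAC; congr (_ + _).
  apply: eq_bigr => j jk; rewrite !ffunE (negPf jk) subr0//.
by rewrite mulrBl mul1r lerBrDr nsq_split.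
Qed.

End Target.

Lemma single_spanned k (xi : R -> C) (A : nat) : xi \in @L2fun R ->
  (forall x, modulus (xi x) <= A%:R) -> (forall x, A%:R < `|x| -> xi x = 0) ->
  spanned [set x | exists n f, LinfT f /\ iter n U x = piC z f Phi] (single k xi).
Proof.
move=> xiL xiA xis; apply: spanned_lim => s s0.
pose S := fine (normsq xi); have S0 : 0 <= S by rewrite fine_ge0// normsq_ge0.
pose e := Num.min (1 / 2) (s / (8 * (S + 1))).
have S1 : 0 < 8 * (S + 1) by lra.
have e0 : 0 < e <= 1 / 2.
  apply/andP; split; last by rewrite ge_min lexx.
  by rewrite lt_min; apply/andP; split; [lra|exact: divr_gt0].
have [d d0 hd] := near_cycle (proj1 (andP e0)).
have [m hm] := le_half_pow A%:R (proj1 (andP d0)).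
(* A multiple of p steps leads back to the component k. *)
pose n := (m * p)%N.
have [c0 [hc0 hc]] := iter_UCinvE n k.
have c00 : c0 != 0.
  by apply: contra_eqN hc0 => /eqP ->; rewrite modulus0 expr0n mul0r eq_sym oner_neq0.
have Nn0 : 0 < N%:R ^+ n :> R by rewrite exprn_gt0.
have An : A%:R / N%:R ^+ n <= d.
  have mn : (m <= n)%N by rewrite leq_pmulr// p_gt0.
  rewrite (le_trans _ (ltW (hm n mn)))// ler_wpM2l// lef_pV2 ?posrE ?exprn_gt0//.
  by rewrite lerXn2r ?nnegrE ?ler_nat.
have cn : modulus c0^-1 ^+ 2 = N%:R ^+ n.
  rewrite modulusV exprVn; apply: (mulfI (x := modulus c0 ^+ 2)).
    by rewrite sqrf_eq0 modulus_eq0.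
  by rewrite hc0 mulfV// sqrf_eq0 modulus_eq0.
have hsym : LinfT (symbol k xi n c0^-1 d) by apply: (symbol_Linf xiL xiA n c0^-1 e0 (hd k)).
exists (iter n V (piC z (symbol k xi n c0^-1 d) Phi)).
  apply: spanned_in; exists n, (symbol k xi n c0^-1 d); split; first exact: hsym.
  by elim: (n) (piC _ _ _) => [//|j IH] v; rewrite iterSr iterS UCinvK// IH.
have hcz (zeta : L2p R p) : {ae leb, forall x, L2fun_of (iter n V zeta k) x =
    c0^-1^-1 * L2fun_of (zeta k) (x / N%:R ^+ n)}.
  by rewrite invrK; have := hc zeta; rewrite iter_ord_pred_periodM.
rewrite nsqBC; apply: le_lt_trans (symbol_target xiL xiA xis d0 e0 An cn (hd k) hcz) _.
rewrite -/S; have e1 : 0 < 1 - e by move: e0; lra.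
have -> : (1 + e) / (1 - e) - 1 = 2 * e / (1 - e).
  by move: (e) e1 => t t1; field; rewrite gt_eqF.
rewrite mulrAC ltr_pdivrMr//.
have : e * (8 * (S + 1)) <= s by rewrite -ler_pdivlMr// ge_min lexx orbT.
by move: e0; nra.
Qed.

Lemma Phi_cyclic :
  dense_span dot [set x | exists n f, LinfT f /\ iter n U x = piC z f Phi].
Proof. by apply: spanned_dense; apply: spanned_all => k f A; exact: single_spanned. Qed.

Lemma cyclic_h : cyclic_representation dot N m0 h U (piC z) Phi.
Proof.
split; first split.
- exact: h_L1T.
- by apply: aeW => x; rewrite h_E ler0c hwave_ge0.
- exact: h_harmonicT.
split; first split.
- exact: L2p_hilbert.
- exact: UC_unitary.
- by apply: piC_star_rep; exact: circle_z.
split.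
- exact: U_piC.
- exact: U_Phi.
- exact: Phi_state.
- exact: Phi_cyclic.
Qed.

(** * The commutant *)

Hypothesis m0_ns : nonsingular m0.

Lemma m0_expi_neq0 : {ae leb, forall x, m0 (E x) != 0}.
Proof.
have pi0 := pi_gt0 R.
pose Z : set R := `[0%R, (2 * pi)%R[%classic `&`
  (setT `&` [set x | (modulus (m0 (E x)) <= (cst 0 x : R))%R]).
have mm : measurable_fun setT (fun x => modulus (m0 (E x))) :=
  measurable_modulus (lipT_cmeasurable m0_lip).
have mZ : measurable Z by apply: measurableI => //; exact: measurable_fun_le.
have Z0 : leb Z = 0%E.
  have /eqP := m0_ns; rewrite /haar mule_eq0 eqe gt_eqF ?twopiV_gt0//= => /eqP h0.
  rewrite -[RHS]h0; congr (leb _); apply/seteqP; split => x.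
    move=> [xi [_ /= xm]]; split; first by move: xi; rewrite /= in_itv.
    split; first exact: circle_expi.
    by apply/eqP; rewrite /= -modulus_eq0 eq_le xm modulus_ge0.
  move=> [/= xi [_ /= xm]]; split; first by rewrite /= in_itv.
  by split => //=; rewrite xm modulus0.
have aeZ : {ae leb, forall x, ~ Z x}.
  by exists Z; split => // x /= /contrapT.
have := ae_foralln (fun n => ae_aff (2 * (int_of_nat n)%:~R * pi) ltr01 aeZ).
apply: filterS => x hx; apply/negP => /eqP x0.
have [j jx] := mod2pi 0 x; have [_ _ /(_ j I)[n _ nj]] := int_of_nat_bij.
apply: (hx n); rewrite /aff mul1r nj; split; first by rewrite /= in_itv /= -[_ * pi]add0r add0r in jx *; move: jx; rewrite add0r.
by split => //=; rewrite expi_period x0 modulus0.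
Qed.

Lemma phi_iter n k x : (forall j k', m0 (z k' * E (x / N%:R ^+ j.+1)) != 0) ->
  (forall k', phi_ k' (x / N%:R ^+ n) != 0) -> phi_ k x != 0.
Proof.
move=> hm; elim: n k => [|n IH] k hn.
  by have := hn k; rewrite expr0 divr1.
apply: IH => k'; rewrite -(ord_predK k').
have -> : x / N%:R ^+ n = N%:R * (x / N%:R ^+ n.+1).
  have Nn : N%:R ^+ n != 0 :> R by rewrite expf_neq0// gt_eqF.
  have N1 : N%:R != 0 :> R by rewrite gt_eqF.
  have e : N%:R ^+ n.+1 = N%:R * N%:R ^+ n :> R := exprS _ _.
  by rewrite e; move: (N%:R ^+ n : R) (N%:R : R) Nn N1 => a b a0 b0; field; rewrite a0 b0.
rewrite phi_refine mulf_neq0 ?hn// /lowpass !mulf_neq0 ?expi_neq0 ?hm//.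
by rewrite invr_eq0 fmorph_eq0 gt_eqF// sqrtN_gt0.
Qed.

(** phi_k(x) is the product of finitely many values of m0, up to nonzero factors,
    and of a value of some phi_j near 0, which is not 0.  So its zeros lie in
    countably many dilates of the zeros of m0. *)
Lemma phi_neq0 k : {ae leb, forall x, phi_ k x != 0}.
Proof.
have h1 k' : {ae leb, forall x, m0 (z k' * E x) != 0}.
  by have := @ae_rotate R p z circle_z k' (fun w => m0 w != 0) m0_expi_neq0.
have NV j : 0 < (N%:R ^+ j)^-1 :> R by rewrite invr_gt0 exprn_gt0.
have h2 j : {ae leb, forall x, forall k', m0 (z k' * E (aff (N%:R ^+ j.+1)^-1 0 x)) != 0}.
  by apply: filter_forall => k'; exact: (ae_aff 0 (NV j.+1) (h1 k')).
apply: filterS (ae_foralln h2) => x hx.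
have [d d0 hd] := wave2_near1 (ltr01 : 0 < 1 :> R).
have [d' d'0 hd'] := near_cycle (ltac:(lra) : 0 < 1 / 2 :> R).
have [n hn] := le_half_pow `|x| (proj1 (andP d'0)).
apply: (phi_iter (n := n)).
  move=> j k'; have := hx j k'.
  by have -> : aff (N%:R ^+ j.+1)^-1 0 x = x / N%:R ^+ j.+1 by rewrite /aff addr0 mulrC.
move=> k'; apply/eqP => p0.
have [] := hd' k' (x / N%:R ^+ n).
  rewrite normrM (ger0_norm (ltW (NV n))) (le_trans _ (ltW (hn n (leqnn _))))//.
  by rewrite ler_wpM2l// invN_half.
by rewrite /wave2 p0 modulus0 expr0n /=; lra.
Qed.

Section Commutant.
Variable T : L2p R p -> L2p R p.
Hypothesis Tcom : commutant dot U (piC z) T.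

Let T_bounded : bounded_op dot T. Proof. by case: Tcom. Qed.
Let T_linear : linear T. Proof. by case: T_bounded. Qed.

Let TU xi : T (U xi) = U (T xi).
Proof. by case: Tcom => _ /(congr1 (fun F => F xi)) /= + _ _. Qed.

Let Tpi f xi : LinfT f -> T (piC z f xi) = piC z f (T xi).
Proof. by case: Tcom => _ _ _ h /h /(congr1 (fun F => F xi)). Qed.

(** If T is multiplication by functions f_k, then (T Phi)_k = f_k phi_k. *)
Definition quotient k x : C := L2fun_of (T Phi k) x * (phi_ k x)^-1.

Lemma quotientE k : {ae leb, forall x, L2fun_of (T Phi k) x = quotient k x * phi_ k x}.
Proof. by apply: filterS (phi_neq0 k) => x h0; rewrite /quotient divfK. Qed.

Lemma cmeasurable_quotient k : cmeasurable (quotient k).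
Proof.
apply: cmeasurableM; first exact: L2fun_meas (L2fun_of_in _).
by apply: cmeasurable_inv; apply: cmeasurable_continuous; exact: continuous_phi.
Qed.

(** Phi and T Phi are both multiplied by the symbol m0 under U, and the common
    factor cancels in the quotient. *)
Lemma quotient_refine k : {ae leb, forall x, quotient (ordS k) (N%:R * x) = quotient k x}.
Proof.
have hT : U (T Phi) = piC z m0 (T Phi) by rewrite -TU U_Phi Tpi//; exact: LinfT_m0.
have hr k' := Linf_rotate circle_z k' LinfT_m0.
have h1 := UCE N0 theta (T Phi) k; rewrite hT in h1.
have h2 := diag_opE (T Phi) k hr.
have h3 : {ae leb, forall x, m0 (z k * E x) != 0} by have := @ae_rotate R p z circle_z k (fun w => m0 w != 0) m0_expi_neq0.
apply: filterS3 h1 h2 h3 => x e1 e2 mx.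
have e3 : m0 (z k * E x) * L2fun_of (T Phi k) x =
    E (theta k) * sN%:C * L2fun_of (T Phi (ordS k)) (N%:R * x).
  exact: etrans (esym e2) e1.
rewrite /quotient phi_refine /lowpass expiN.
have s0 : sN%:C != 0 by rewrite fmorph_eq0 gt_eqF// sqrtN_gt0.
have t0 := expi_neq0 (theta k).
have -> : L2fun_of (T Phi (ordS k)) (N%:R * x) =
    m0 (z k * E x) * L2fun_of (T Phi k) x / (E (theta k) * sN%:C).
  by rewrite e3 mulrAC mulfV ?mul1r// mulf_neq0.
move: mx s0 t0; move: (m0 _) (sN%:C) (E (theta k)) (L2fun_of _ _) => a b c d a0 b0 c0.
rewrite !invfM !invrK.
have -> : a * d * (c^-1 / b) * (c / a * b / phi_ k x) =
  (a / a) * (c / c) * (b / b) * (d / phi_ k x) by ring.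
by rewrite !mulfV// !mul1r.
Qed.

Lemma quotient_iter n k : {ae leb, forall x,
  quotient (iter n (@ord_pred p) k) (x / N%:R ^+ n) = quotient k x}.
Proof.
elim: n k => [|n IH] k; first by apply: aeW => x; rewrite expr0 divr1.
have h1 := ae_contract N0 (IH (ord_pred k)).
have h2 := ae_contract N0 (quotient_refine (ord_pred k)).
apply: filterS2 h1 h2 => x e1 e2; rewrite iterSr exprS invfM mulrA e1 -e2 ord_predK.
by rewrite mulrC mulfVK// gt_eqF.
Qed.

(** T commutes with pi(f), which multiplies both Phi and T Phi by f; going back n
    steps dilates both by N^n, and the quotient is invariant under this. *)
Lemma T_orbit n f eta k : LinfT f -> iter n U eta = piC z f Phi ->
  {ae leb, forall x, L2fun_of (T eta k) x = quotient k x * L2fun_of (eta k) x}.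
Proof.
move=> hf he.
have iterK m (v : L2p R p) : iter m V (iter m U v) = v.
  by elim: m v => [//|m IH] v; rewrite iterSr iterS UCK// IH.
have hT : iter n U (T eta) = piC z f (T Phi).
  rewrite -Tpi// -he; elim: (n) => [//|m IH].
  by rewrite !iterS IH TU.
have [c [_ hc]] := iter_UCinvE n k.
have VT : iter n V (piC z f (T Phi)) = T eta by rewrite -hT iterK.
have VE : iter n V (piC z f Phi) = eta by rewrite -he iterK.
have eT := hc (piC z f (T Phi)); rewrite VT in eT.
have eE := hc (piC z f Phi); rewrite VE in eE.
have NV : 0 < (N%:R ^+ n)^-1 :> R by rewrite invr_gt0 exprn_gt0.
set k' := iter n _ k in eT eE *.
have hr j := Linf_rotate circle_z j hf.
have h1 := ae_aff 0 NV (diag_opE (T Phi) k' hr).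
have h2 := ae_aff 0 NV (diag_opE Phi k' hr).
have h3 := ae_aff 0 NV (quotientE k').
have h3' := ae_aff 0 NV (PhiE k').
have h4 := quotient_iter n k.
apply: filterS3 (filterI eT eE) (filterI h1 h2) (filterI (filterI h3 h3') h4) => x.
move=> [aT aE] [b1 b2] [[q1 q2] q3]; rewrite aT aE.
have a0 : aff (N%:R ^+ n)^-1 0 x = x / N%:R ^+ n by rewrite /aff addr0 mulrC.
rewrite a0 in b1 b2 q1 q2.
have -> : L2fun_of (piC z f (T Phi) k') (x / N%:R ^+ n) =
   (alpha (z k') f \o E) (x / N%:R ^+ n) * L2fun_of (T Phi k') (x / N%:R ^+ n) := b1.
have -> : L2fun_of (piC z f Phi k') (x / N%:R ^+ n) =
   (alpha (z k') f \o E) (x / N%:R ^+ n) * L2fun_of (Phi k') (x / N%:R ^+ n) := b2.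
by rewrite q1 q2 q3 -/k'; ring.
Qed.

Definition bounded_on (n : nat) (k : 'I_p) (x : R) : bool := modulus (quotient k x) <= n%:R.

Lemma measurable_bounded_on n k : measurable_fun setT (bounded_on n k).
Proof.
apply: measurable_fun_ler => //; apply: measurable_modulus; exact: cmeasurable_quotient.
Qed.

Lemma Linf_cut_quotient n k : Linf (cutoff (bounded_on n k) (quotient k)).
Proof.
split.
  by apply: cmeasurable_cut; [exact: measurable_bounded_on|exact: cmeasurable_quotient].
exists n%:R; apply: aeW => x; rewrite /cutoff.
by case: ifP => [//|_]; rewrite modulus0.
Qed.

(** Multiplication by the quotient is not yet known to be bounded, hence the
    cut-off.  With it both sides are bounded operators, and they agree on a set
    which spans a dense subspace. *)
Lemma T_cut n xi : diag_op (fun k => cutoff (bounded_on n k) (fun=> 1)) (T xi) =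
  diag_op (fun k => cutoff (bounded_on n k) (quotient k)) xi.
Proof.
set P := diag_op _; set D := diag_op _.
have hP k := Linf_indic (measurable_bounded_on n k).
have hD := Linf_cut_quotient n.
have lP : linear P := diag_op_linear hP.
have lD : linear D := diag_op_linear hD.
have [M M0 hM] := nsq_bounded T_bounded.
have [M1 M10 hM1] := nsq_bounded (diag_op_bounded hP).
have [M2 M20 hM2] := nsq_bounded (diag_op_bounded hD).
pose Q v := P (T v) - D v.
have lQ : linear Q.
  move=> a u v; rewrite /Q T_linear lP lD scalerBr opprD addrACA//.
apply/eqP; rewrite -subr_eq0 -/(Q xi); apply/eqP.
pose K := 2 * (M1 ^+ 2 * M ^+ 2) + 2 * M2 ^+ 2.
apply: (vanish_spanned (G := [set x | exists n f, LinfT f /\ iter n U x = piC z f Phi]) (K := K)).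
- exact: lQ.
- by rewrite /K addr_ge0// mulr_ge0 ?mulr_ge0 ?sqr_ge0.
- move=> v; rewrite /Q (le_trans (nsqD _ _))// -scaleN1r nsqZ modulusN modulus1 expr1n mul1r.
  have h1 := le_trans (hM1 (T v)) (ler_wpM2l (sqr_ge0 M1) (hM v)).
  have h2 := hM2 v; rewrite /K.
  by move: (nsq _) (nsq _) (nsq v) h1 h2 => r s t; lra.
- move=> v [m [f [hf hv]]]; apply/eqP; rewrite subr_eq0; apply/eqP; apply: L2p_ext => k.
  have h1 := diag_opE (T v) k hP; have h2 := diag_opE v k hD.
  have h3 := T_orbit k hf hv.
  apply: filterS3 h1 h2 h3 => x e1 e2 e3; apply: (etrans e1); rewrite e3.
  by apply: esym; apply: (etrans e2); rewrite /cutoff; case: ifP => _; rewrite ?mul1r ?mul0r.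
- by apply: spanned_all => k f A; exact: single_spanned.
Qed.

(** Let M be a bound for T.  On the set b where M < |f_k| <= n and |x| <= n the
    indicator function of b is mapped to f_k 1_b; the bound says that the
    integral of |f_k|^2 - M^2 over b is at most 0, so that b is a null set. *)
Lemma quotient_bounded : exists M : R, forall k, {ae leb, forall x, modulus (quotient k x) <= M}.
Proof.
have [M M0 hM] := nsq_bounded T_bounded; exists M => k.
pose b n x := [&& `|x| <= n%:R, bounded_on n k x & M < modulus (quotient k x)].
have mq := cmeasurable_quotient k; have mmq := measurable_modulus mq.
have mb n : measurable_fun setT (b n).
  apply: measurable_and; first by apply: measurable_fun_ler => //; exact: measurableT_comp.
  by apply: measurable_and; [exact: measurable_bounded_on|apply: measurable_fun_ltr].
have null n : {ae leb, forall x, ~~ b n x}.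
  pose one := cutoff (b n) (fun=> 1 : C).
  have m1 : cmeasurable one.
    by apply: cmeasurable_cut => //; exact: cmeasurable_cst.
  have oneL : one \in @L2fun R.
    apply/L2funP; split => //.
    pose D : set R := `[(- n%:R)%R, n%:R%R]%classic.
    have mD : measurable D by exact: measurable_itv.
    apply: (@le_lt_trans _ _ (\int[leb]_x (\1_D x)%:E)%E).
      apply: ge0_le_integral => //.
      - by move=> x _; rewrite lee_fin sqr_ge0.
      - exact: cmeasurable_modulus2.
      - by apply/measurable_EFinP; exact: measurable_indic.
      - move=> x _; rewrite lee_fin indicE /D mem_setE /= in_itv /= -ler_norml /one /cutoff /b.
        case: ifP => [/andP[-> _]|_]; first by rewrite modulus1 expr1n.
        by rewrite modulus0 expr0n /= ler0n.
    rewrite integral_indic// setIT /D /= lebesgue_measure_itv /=.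
    by case: ifP => _; rewrite ?ltry// -EFinB ltry.
  pose F x := Num.sqrt (modulus (quotient k x) ^+ 2 - M ^+ 2).
  pose v x : C := cutoff (b n) (fun x => (F x)%:C) x.
  have mv : cmeasurable v.
    apply: cmeasurable_cut => //; apply: cmeasurable_real.
    apply: (measurableT_comp (continuous_measurable_fun (@sqrt_continuous R))).
    by apply: measurable_funB => //; exact: measurable_modulus2.
  have key : (normsq v + (M ^+ 2)%:E * normsq one =
      normsq (cutoff (b n) (quotient k)))%E.
    rewrite [X in (_ * X)%E]/normsq -ge0_integralZl//; first last.
    - by rewrite lee_fin sqr_ge0.
    - by move=> x _; rewrite lee_fin sqr_ge0.
    - exact: cmeasurable_modulus2.
    rewrite -ge0_integralD//; first last.
    - by apply: measurable_funeM; exact: cmeasurable_modulus2.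
    - by move=> x _; rewrite -EFinM lee_fin mulr_ge0 ?sqr_ge0.
    - exact: cmeasurable_modulus2.
    - by move=> x _; rewrite lee_fin sqr_ge0.
    apply: eq_integral => x _; rewrite -EFinM -EFinD; congr EFin.
    rewrite /v /one /cutoff; case: ifP => [/and3P[_ _ hq]|_]; last by rewrite modulus0 expr0n mulr0 addr0.
    rewrite modulus_real ger0_norm ?sqrtr_ge0// sqr_sqrtr ?modulus1 ?expr1n ?mulr1 ?subrK//.
    by rewrite subr_ge0 lerXn2r ?nnegrE ?modulus_ge0 ?(ltW hq).
  have bnd : (normsq (cutoff (b n) (quotient k)) <= (M ^+ 2)%:E * normsq one)%E.
    pose xi := single k one.
    have hP j := Linf_indic (measurable_bounded_on n j).
    have le1 : nsq (diag_op (fun j => cutoff (bounded_on n j) (quotient j)) xi) <=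
        M ^+ 2 * nsq xi.
      rewrite -T_cut (le_trans _ (hM xi))// -[leRHS]mul1r -[X in X * _](expr1n _ 2).
      apply: nsq_diag_op => // j; apply: aeW => x.
      by rewrite (le_trans (modulus_cut _ _ _))// modulus1.
    have nxi : nsq xi = fine (normsq one) := nsq_single k oneL.
    have ae_xi : {ae leb, forall x, L2fun_of (xi k) x = one x}.
      by rewrite ffunE eqxx; exact: L2classE.
    have ae1 := diag_opE xi k (Linf_cut_quotient n).
    rewrite -[leRHS]fineK; last by rewrite fin_numM// L2fun_fin.
    rewrite fineM// ?L2fun_fin//= -nxi.
    have mc : cmeasurable (cutoff (b n) (quotient k)) by exact: cmeasurable_cut.
    apply: (@le_trans _ _ (nsq (diag_op (fun j => cutoff (bounded_on n j) (quotient j)) xi))%:E).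
      rewrite (normsq_ae mc (L2fun_meas (L2fun_of_in _)) (_ : {ae leb, forall x, _ =
         L2fun_of (diag_op (fun j => cutoff (bounded_on n j) (quotient j)) xi k) x})).
        by rewrite -[leLHS]fineK ?L2fun_fin ?L2fun_of_in// lee_fin le_nsq.
      apply: filterS2 ae1 ae_xi => x -> ->; rewrite /one /cutoff.
      case: ifP => [/and3P[_ -> _]|_]; by rewrite ?mulr1 ?mulr0.
    by rewrite lee_fin.
  have v0 : normsq v = 0%E.
    have cfin : ((M ^+ 2)%:E * normsq one)%E \is a fin_num.
      by rewrite fin_numM// L2fun_fin.
    move: bnd; rewrite -key; move: (normsq_ge0 v) cfin.
    case: (normsq v) => [r| |//]; case: (_ * _)%E => [t| |//] //=.
    by rewrite lee_fin => r0 _; rewrite lee_fin => h; congr EFin; lra.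
  apply: filterS (normsq_eq0 mv v0) => x vx; apply/negP => bx.
  move: vx; rewrite /v /cutoff bx => /complexI/eqP; rewrite sqrtr_eq0 subr_le0.
  have /and3P[_ _ hq] := bx.
  by rewrite ler_sqr ?nnegrE ?modulus_ge0// leNgt hq.
apply: filterS (ae_foralln null) => x hx; rewrite leNgt; apply/negP => Mq.
have [n hn] := bounded_by_ev (quotient k) x.
by have /andP[h1 h2] := hn n (leqnn _); have := hx n; rewrite /b h1 /bounded_on h2 Mq.
Qed.

Lemma Linf_quotient k : Linf (quotient k).
Proof.
have [M hM] := quotient_bounded; split; first exact: cmeasurable_quotient.
by exists M.
Qed.

Lemma T_diag : T = diag_op quotient.
Proof.
apply/funext => xi; apply: L2p_ext => k.
have h1 := ae_foralln (fun n => diag_opE (T xi) k (fun j => Linf_indic (measurable_bounded_on n j))).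
have h2 := ae_foralln (fun n => diag_opE xi k (Linf_cut_quotient n)).
have h3 := diag_opE xi k Linf_quotient.
apply: filterS3 h1 h2 h3 => x e1 e2 e3.
have [n hn] := bounded_by_ev (quotient k) x.
have bx : bounded_on n k x by have /andP[] := hn n (leqnn _).
have a1 := e1 n; have a2 := e2 n; rewrite T_cut a2 /cutoff bx mul1r in a1.
by rewrite -a1; exact: esym e3.
Qed.

End Commutant.

Lemma commutantE : commutant dot U (piC z) =
  [set T | exists f : 'I_p -> R -> C, [/\ forall k, Linf (f k),
     forall k, {ae leb, forall x, f (ordS k) (N%:R * x) = f k x} & T = diag_op f]].
Proof.
apply/seteqP; split=> [T hT|T [f [fL fN ->]]].
  exists (quotient T); split.
  - by move=> k; exact: (Linf_quotient hT).
  - by move=> k; exact: (quotient_refine hT).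
  - exact: (T_diag hT).
have comU xi : diag_op f (U xi) = U (diag_op f xi).
  by rewrite (UC_diag_op N0 theta xi fL fL fN).
split.
- exact: diag_op_bounded.
- by apply/funext => xi; exact: comU.
- move=> V' hV; apply/funext => xi /=.
  have VE : V' =1 V by exact: adjoint_uniq hV (UC_adjoint N0 theta).
  rewrite !VE -[LHS](UCK N0 theta) -comU UCinvK//.
- move=> g gL; apply/funext => xi /=; rewrite piCE.
  have hr k := Linf_rotate circle_z k gL.
  rewrite -!diag_opM//; apply: diag_op_eq => [k|k|k].
  + exact: LinfM.
  + exact: LinfM.
  + by apply: aeW => x; rewrite mulrC.
Qed.

End CycleWave.

Theorem proposition2p13 (R : realType) (N : nat) (hN : (2 <= N)%N)
  (m0 : R[i] -> R[i]) (m0_lip : lipschitzT m0) (m0_ns : nonsingular m0)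
  (m0_qmf : forall w, circle w -> ruelle N m0 (fun=> 1) w = 1)
  (p : nat) (z : 'I_p -> R[i]) (hz : is_cycle N m0 z)
  (theta : 'I_p -> R)
  (htheta : forall k, m0 (z k) = (Num.sqrt N%:R)%:C * expi (theta k)) :
  let phi_ := phi N m0 z theta in
  let g := g_ N m0 z theta in
  let h := hC N m0 z theta in
  (* (i) *)
  (forall k, [/\ forall x, cvgn (phi_partial N m0 z theta k x),
      continuous (phi_ k : R -> R[i]^o) & phi_ k \in @L2fun R]) /\
  (* (ii) *)
  (forall k, (forall x, Per_phi N m0 z theta k x < +oo)%E /\
    [/\ lipschitzT (g k), trigpoly m0 -> trigpoly (g k),
        forall w, circle w -> iter p (ruelle N m0) (g k) w = g k w &
        forall w, circle w -> ruelle N m0 (g k) w = g (ordS k) w] /\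
    (forall j, g k (z j) = (k == j)%:R) /\
    zero_on_disjoint_cycles N m0 z (g k)) /\
  (* (iii) *)
  ([/\ lipschitzT h, trigpoly m0 -> trigpoly h,
       forall w, circle w -> ruelle N m0 h w = h w,
       forall k, h (z k) = 1 &
       zero_on_disjoint_cycles N m0 z h]) /\
  (* (iv) *)
  (forall (h' : R[i] -> R[i]) (c : R), continuousT h' -> 0 < c ->
    (forall w, circle w -> 0 <= h' w <= c%:C * h w) ->
    (forall w, circle w -> ruelle N m0 h' w = h' w) ->
    exists2 lam : R, 0 <= lam & forall w, circle w -> h' w = lam%:C * h w) /\
  (* (v) *)
  (forall h' : R[i] -> R[i], continuousT h' ->
    (forall w, circle w -> 0 <= h' w) ->
    (forall w, circle w -> ruelle N m0 h' w = h' w) ->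
    (forall k, h' (z k) = 1) ->
    forall w, circle w -> h w <= h' w) /\
  (* (vi) *)
  cyclic_representation (@L2pdot R p) N m0 h (UC N theta) (piC z)
    (phiC N m0 z theta) /\
  (* (vii) *)
  commutant (@L2pdot R p) (UC N theta) (piC z) =
    [set T | exists f : 'I_p -> R -> R[i],
      [/\ forall k, Linf (f k),
          forall k, {ae @lebesgue_measure R, forall x,
            f (ordS k) (N%:R * x) = f k x} &
          T = diag_op f]].
Proof.
move=> phi_ g h; split.
  move=> k; split.
  - exact: (phi_partial_cvgn hN m0_lip m0_qmf hz htheta).
  - exact: (continuous_phi hN m0_lip m0_qmf hz htheta).
  - exact: (phi_L2 hN m0_lip m0_qmf hz htheta).
split.
  move=> k; split; first by move=> x; exact: (Per_phi_fin hN m0_lip m0_qmf hz htheta).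
  split; first split.
  - exact: (g_lip hN m0_lip m0_qmf hz htheta).
  - exact: (g_trigpoly hN m0_lip m0_qmf hz htheta).
  - move=> w; exact: (iter_ruelle_g hN m0_lip m0_qmf hz htheta).
  - move=> w; exact: (ruelle_g hN m0_lip m0_qmf hz htheta).
  split.
  - exact: (g_delta hN m0_lip m0_qmf hz htheta).
  - exact: (g_zero hN m0_lip m0_qmf hz htheta).
split.
  split.
  - exact: (h_lip hN m0_lip m0_qmf hz htheta).
  - exact: (h_trigpoly hN m0_lip m0_qmf hz htheta).
  - move=> w; exact: (ruelle_h hN m0_lip m0_qmf hz htheta).
  - by move=> k; rewrite /h h_E (hwave_z hN m0_lip m0_qmf hz htheta).
  - exact: (h_zero hN m0_lip m0_qmf hz htheta).
split; first by move=> h' c; exact: (h_minimal hN m0_lip m0_qmf hz htheta).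
split; first by move=> h'; exact: (h_le hN m0_lip m0_qmf hz htheta).
split; first exact: (cyclic_h hN m0_lip m0_qmf hz htheta).
exact: (commutantE hN m0_lip m0_qmf hz htheta m0_ns).
Qed.
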